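(* Let $a\in L^\infty S^{-n}_0$ and $\omega\in A_1$. Then there is a constant $C$ such that for all Schwartz functions $u$ on $\mathbb{R}^n$, $$\|T^*_a u\|_{L^{1,\infty}_\omega}\le C\|u\|_{L^1_\omega}.$$
   Context: The rough symbol class $L^\infty S^m_\varrho$ ($m\in\mathbb{R}$, $0\le\varrho\le1$) consists of functions $a(x,\xi)$ on $\mathbb{R}^n\times\mathbb{R}^n$, bounded measurable in $x$ and smooth in $\xi$, such that for all multi-indices $\alpha$, $\|\partial_\xi^\alpha a(\cdot,\xi)\|_{L^\infty(\mathbb{R}^n)}\le C_\alpha\langle\xi\rangle^{m-\varrho|\alpha|}$, with $\langle\xi\rangle=(1+|\xi|^2)^{1/2}$. The operator $T^*_a$ is defined by $T^*_a u(x)=\int_{\mathbb{R}^n}K^*(x,y)u(y)\,dy$ with $K^*(x,y)=(2\pi)^{-n}\int_{\mathbb{R}^n}e^{i\langle x-y,\xi\rangle}a(y,\xi)\,d\xi$ (as an oscillatory integral). A nonnegative locally integrable $\omega$ is in $A_1$ if $M\omega\le C\omega$ a.e., $M$ being the Hardy–Littlewood maximal function over axis-parallel cubes containing the point. $\|u\|_{L^1_\omega}=\int|u|\omega$, $\|u\|_{L^{1,\infty}_\omega}=\sup_{\lambda>0}\lambda\,\omega(\{|u|>\lambda\})$. *)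

(* Defs.v *)
From HB Require Import structures.
From mathcomp Require Import all_boot all_order all_algebra.
From mathcomp Require Import all_classical all_reals all_analysis measurable_realfun.
Set Implicit Arguments. Unset Strict Implicit. Unset Printing Implicit Defensive.
Import Order.TTheory GRing.Theory Num.Theory.
Import numFieldNormedType.Exports.
Local Open Scope classical_set_scope.
Local Open Scope ring_scope.

Section Defs.
Variable R : realType.

Fixpoint iint (n : nat) : ('rV[R]_n -> \bar R) -> \bar R :=
  match n with
  | 0 => fun f => f 0
  | m.+1 => fun f => (\int[lebesgue_measure]_t
                       iint (fun x : 'rV[R]_m => f (row_mx (const_mx t : 'rV[R]_1) x)))%E
  end.

Definition borelRn (n : nat) : set (set 'rV[R]_n) := <<s [set A | open A] >>.

Definition dotR n (x y : 'rV[R]_n) : R := \sum_(i < n) x 0 i * y 0 i.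
Definition jb n (x : 'rV[R]_n) : R := Num.sqrt (1 + dotR x x).

Definition partial n (i : 'I_n) (f : 'rV[R]_n -> R) : 'rV[R]_n -> R :=
  fun x => 'D_(delta_mx 0 i) f x.
Definition dpartial n (al : 'I_n -> nat) (f : 'rV[R]_n -> R) :=
  foldr (fun i g => iter (al i) (partial i) g) f (enum 'I_n).
Definition smooth n (f : 'rV[R]_n -> R) := forall al x, differentiable (dpartial al f) x.

Definition monom n (be : 'I_n -> nat) (x : 'rV[R]_n) : R := \prod_(i < n) x 0 i ^+ be i.
Definition mabs n (al : 'I_n -> nat) : R := (\sum_(i < n) al i)%:R.

Definition borel_fun n d (V : measurableType d) (f : 'rV[R]_n -> V) :=
  forall B : set V, measurable B -> borelRn (f @^-1` B).

(* Lebesgue integral of a nonnegative function on R^n (outer integral: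
   infimum of iterated integrals of Borel majorants; equal to the
   Lebesgue integral for Lebesgue measurable functions) *)
Definition lint n (f : 'rV[R]_n -> \bar R) : \bar R :=
  ereal_inf [set iint g | g in [set g : 'rV[R]_n -> \bar R |
                          borel_fun g /\ forall x, (f x <= g x)%E]].

Definition indE n (A : set 'rV[R]_n) : 'rV[R]_n -> \bar R := fun x => (\1_A x)%:E.

Definition lnull n (A : set 'rV[R]_n) := lint (indE A) = 0%E.
Definition lmeas n (A : set 'rV[R]_n) :=
  exists B, borelRn B /\ lnull ((A `\` B) `|` (B `\` A)).
Definition lmeasfun n (f : 'rV[R]_n -> R) :=
  forall B : set R, measurable B -> lmeas (f @^-1` B).
Definition ae n (P : 'rV[R]_n -> Prop) :=
  exists N, lnull N /\ forall x, ~ N x -> P x.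

Definition rint n (f : 'rV[R]_n -> R) : R :=
  fine (lint (fun x => (Num.max (f x) 0)%:E)) - fine (lint (fun x => (Num.max (- f x) 0)%:E)).
Definition rintegrable n (f : 'rV[R]_n -> R) :=
  lmeasfun f /\ (lint (fun x => `|f x|%:E) < +oo)%E.

Definition cabs (z : R * R) : R := Num.sqrt (z.1 ^+ 2 + z.2 ^+ 2).
Definition cmul (z w : R * R) : R * R := (z.1 * w.1 - z.2 * w.2, z.1 * w.2 + z.2 * w.1).
Definition cscale (r : R) (z : R * R) : R * R := (r * z.1, r * z.2).
Definition cexpi (t : R) : R * R := (cos t, sin t).
Definition cint n (f : 'rV[R]_n -> R * R) : R * R :=
  (rint (fun x => (f x).1), rint (fun x => (f x).2)).
Definition cintegrable n (f : 'rV[R]_n -> R * R) :=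
  rintegrable (fun x => (f x).1) /\ rintegrable (fun x => (f x).2).
Definition cmeasfun n (f : 'rV[R]_n -> R * R) :=
  lmeasfun (fun x => (f x).1) /\ lmeasfun (fun x => (f x).2).

Definition rschwartz n (f : 'rV[R]_n -> R) :=
  smooth f /\ forall al be : 'I_n -> nat, exists C : R, forall x,
    `|monom be x * dpartial al f x| <= C.
Definition schwartz n (u : 'rV[R]_n -> R * R) :=
  rschwartz (fun x => (u x).1) /\ rschwartz (fun x => (u x).2).

Definition Linf_symbol n (m rho : R) (a : 'rV[R]_n -> 'rV[R]_n -> R * R) :=
  [/\ forall xi, cmeasfun (fun x => a x xi),
      forall x, smooth (fun xi => (a x xi).1) /\ smooth (fun xi => (a x xi).2) &
      forall al : 'I_n -> nat, exists C : R, forall xi, ae (fun x =>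
        cabs (dpartial al (fun eta => (a x eta).1) xi,
              dpartial al (fun eta => (a x eta).2) xi)
        <= C * jb xi `^ (m - rho * mabs al))].

Definition cube n (c : 'rV[R]_n) (s : R) : set 'rV[R]_n :=
  [set y | forall i, c 0 i <= y 0 i <= c 0 i + s].
Definition maxfun n (w : 'rV[R]_n -> R) (x : 'rV[R]_n) : \bar R :=
  ereal_sup [set r | exists (c : 'rV[R]_n) (s : R), [/\ 0 < s, cube c s x &
     r = (((s ^+ n)^-1)%:E * lint (fun y => (\1_(cube c s) y * w y)%:E))%E]].
Definition A1 n (w : 'rV[R]_n -> R) :=
  [/\ forall x, 0 <= w x, lmeasfun w,
      (forall c s, (lint (fun y => (\1_(cube c s) y * w y)%:E) < +oo)%E) &
      exists C : R, ae (fun x => (maxfun w x <= (C * w x)%:E)%E)].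

Definition L1w n (w : 'rV[R]_n -> R) (u : 'rV[R]_n -> R * R) : \bar R :=
  lint (fun x => (cabs (u x) * w x)%:E).
Definition wL1w n (w : 'rV[R]_n -> R) (v : 'rV[R]_n -> R * R) : \bar R :=
  ereal_sup [set r | exists lam : R, 0 < lam /\
     r = (lam%:E * lint (fun x => (\1_[set y | lam < cabs (v y)] x * w x)%:E))%E].

(* v = T^*_a u : v is the function representing the distribution
   x |-> \int K^*(x,y) u(y) dy, K^* being the oscillatory integral
   (2pi)^-n \int e^{i<x-y,xi>} a(y,xi) dxi, i.e. for every Schwartz phi,
   \int v phi = (2pi)^-n \int_y u(y) \int_xi e^{-i<y,xi>} a(y,xi)
                                    (\int_x e^{i<x,xi>} phi(x) dx) dxi dy. *)
Definition Tstar_rep n (a : 'rV[R]_n -> 'rV[R]_n -> R * R)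
    (u v : 'rV[R]_n -> R * R) :=
  cmeasfun v /\
  forall phi : 'rV[R]_n -> R * R, schwartz phi ->
    cintegrable (fun x => cmul (v x) (phi x)) /\
    cint (fun x => cmul (v x) (phi x)) =
    cscale ((2 * pi) ^- n)
      (cint (fun y => cmul (u y)
         (cint (fun xi => cmul (cmul (cexpi (- dotR y xi)) (a y xi))
                   (cint (fun x => cmul (cexpi (dotR x xi)) (phi x))))))).
End Defs.

(* Main.v *)
(* The operator is even bounded on L^1_w.  The core is the estimate
     |int_xi b(y, xi) int_x psi(x) cos((x - y).xi + s)| <= C w(y)    (1)
   for almost every y and every measurable psi of bounded support with
   |psi| <= w, where b is the real or imaginary part of the symbol; it is
   applied with psi = sgn(v) min(w, N) 1_{|x| <= N}, v being the function that
   represents the distribution.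
   For (1), psi is cut into its part on |x - y| <= 1 and the parts on
   |x - y| <= 2^(j+1), |x_i - y_i| > 2^j.  On the latter, put h = 2^-j: dividing
   psi by (2 sin(h (x_i - y_i) / 2))^(n+1), which is bounded below there, and
   summing by parts turns b into an (n+1)-fold central difference of step h in
   the direction e_i.  As all derivatives of b are O(<xi>^-n), this gains
   h^(n+1), which beats the volume 2^(jn) of the support.  What is left is a
   bound of int <xi>^-n |psi^(xi)| by the mass of w on a cube.  On the annulus
   |xi| ~ 2^k it follows from the quadratic identity
     int e^(-2^-k |xi|_1) |psi^|^2 = double integral of psi psi against
     a product of Poisson kernels,
   and the sum over k converges geometrically because an A_1 weight satisfies
   w(Q / 2) <= theta w(Q) with theta < 1.
   Two functions representing the same distribution agree a.e.: products of
   exp (- m s^(2m)) are Schwartz and converge to indicators of open boxes. *)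
Require Import Defs.
From HB Require Import structures.
From mathcomp Require Import all_boot all_order all_algebra.
From mathcomp Require Import all_classical all_reals all_analysis measurable_realfun.
From mathcomp Require Import ring lra.
Set Implicit Arguments. Unset Strict Implicit. Unset Printing Implicit Defensive.
Import Order.TTheory GRing.Theory Num.Theory.
Import numFieldNormedType.Exports.
Local Open Scope classical_set_scope.
Local Open Scope ring_scope.

(** * Borel sets and Lebesgue measure on R^n *)

(** Since int <xi>^-n dxi diverges, with every dyadic annulus weighing the same, the decay in k
    cannot come from the size of the symbol: it has to come from [psi]. The energy on the annulus
    |xi| ~ 2^k sees the mass of [psi] on cubes of radius about 2^-k centred at its own support,
    while the final bound has to be w(y) at one fixed y. The link is that for x in the support, at
    most 2^j away from y, the cube of radius 2^j about x contains y, so the A_1 inequality at y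
    bounds the mass from which the halving at x starts. The function [v] has to exist before a
    weight can act on it. It is the sum of its frequency pieces, and the same annulus estimate, with
    the explicit integrable weight [Phi] in place of w, makes this sum converge absolutely almost
    everywhere. The bound (1) does not depend on the truncation of w, so monotone convergence yields
    the estimate in L^1_w, and the weak bound follows by Chebyshev. Complex quantities are split
    into real ones. A phase shift by -pi/2 turns a cosine into a sine, so one real estimate with a
    free phase covers the eight combinations of components of the symbol, of u and of the
    exponential. *)

Definition opensR (R : realType) n : set (set 'rV[R]_n) := [set A | open A].
(* R^n with the sigma-algebra [borelRn]. *)
Notation Esp R n := (g_sigma_algebraType (@opensR R n)) (only parsing).

Section prod_meas.
Context d1 d2 (T1 : measurableType d1) (T2 : measurableType d2) (R : realType).
Variable m1 : {sigma_finite_measure set T1 -> \bar R}.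
Variable m2 : {sigma_finite_measure set T2 -> \bar R}.

(* [product_measure1] carries no usable sigma-finiteness instance: the
   instance for sub-probability measures shadows it *)
Definition prod_meas : set (T1 * T2) -> \bar R := (m1 \x m2)%E.

HB.instance Definition _ := Measure.on prod_meas.

Lemma sigma_finite_prod_meas : sigma_finite setT prod_meas.
Proof.
have /sigma_finiteP[F [TF ndF Foo]] := sigma_finiteT m1.
have /sigma_finiteP[G [TG ndG Goo]] := sigma_finiteT m2.
exists (fun n => F n `*` G n).
  rewrite -setXTT TF TG predeqE => -[x y]; split; last first.
    by move=> [n _ []/= ? ?]; split; exists n.
  move=> [/= [n _ Fnx] [k _ Gky]]; exists (maxn n k) => //; split.
  - by move: x Fnx; exact/subsetPset/ndF/leq_maxl.
  - by move: y Gky; exact/subsetPset/ndG/leq_maxr.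
move=> k; have [? ?] := Foo k; have [? ?] := Goo k.
split; first exact: measurableX.
by rewrite /prod_meas product_measure1E// lte_mul_pinfty// ge0_fin_numE.
Qed.

HB.instance Definition _ := Measure_isSigmaFinite.Build _ _ _ prod_meas sigma_finite_prod_meas.

End prod_meas.

Section Borel.
Variable R : realType.

Definition obox n (c : 'rV[R]_n) (r : R) : set 'rV[R]_n :=
  [set x | forall i, c 0 i - r < x 0 i < c 0 i + r].

Lemma rat_near (x e : R) : 0 < e -> exists q : rat, `|x - ratr q| < e.
Proof.
move=> e0; have xe : x - e < x + e by lra.
have [q] := rat_in_itvoo xe; rewrite in_itv/= => /andP[q1 q2].
by exists q; rewrite ltr_distlC; apply/andP; split; lra.
Qed.

Lemma obox_nbhs n (x : 'rV[R]_n) (A : set 'rV[R]_n) : nbhs x A ->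
  exists2 e : R, 0 < e & obox x e `<=` A.
Proof.
move=> /nbhs_ballP[e /= e0 H]; exists e => // y xy; apply: H; split => // i j.
rewrite !ord1 /ball /=; have /andP[? ?] := xy j.
by rewrite ltr_distlC; apply/andP; split; lra.
Qed.

(** An open set is the union of the countably many boxes with rational centre and radius 1/(k+1)
    that it contains, and the preimage of a box is a finite intersection of coordinate preimages. *)
Lemma measurable_to_Esp d (X : measurableType d) n (f : X -> Esp R n) :
  (forall i, measurable_fun setT (fun x => (f x : 'rV[R]_n) 0 i)) ->
  measurable_fun setT f.
Proof.
move=> mf; apply: (@measurability _ _ _ (Esp R n) _ _ (@opensR R n)) => //.
move=> _ [U oU <-]; rewrite setTI.
pose B (p : 'rV[rat]_n * nat) : set X := if `[< obox (map_mx ratr p.1) (p.2.+1%:R^-1 : R) `<=` U >]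
   then f @^-1` (obox (map_mx ratr p.1) (p.2.+1%:R^-1 : R)) else set0.
have -> : f @^-1` U = \bigcup_p B p.
  apply/seteqP; split => [x /= Ux|x [p _]]; last first.
    rewrite /B; case: asboolP => // H /= /H //.
  have [e e0 He] : exists2 e : R, 0 < e & obox (f x) e `<=` U.
    by apply: obox_nbhs; exact: open_nbhs_nbhs.
  (* Below e/2, because the rational centre is itself only within this radius of [f x]; the triangle
     inequality then keeps the box inside [obox (f x) e]. *)
  have [k ke] : exists k : nat, (k.+1%:R^-1 : R) < e / 2.
    exists (Num.truncn (e / 2)^-1).
    rewrite invf_plt ?posrE// ?ltr0n ?divr_gt0//.
    exact: truncnS_gt.
  have k0 : 0 < (k.+1%:R^-1 : R) by rewrite invr_gt0 ltr0n.
  set r := (k.+1%:R^-1 : R) in ke k0 *.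
  have [q Hq] := choice (fun i => rat_near ((f x : 'rV_n) 0 i) k0).
  exists (\row_i q i, k) => //; rewrite /B /=; case: asboolP => [_|].
    move=> i; rewrite !mxE; have := Hq i; rewrite ltr_distlC => /andP[h1 h2].
    by apply/andP; split; [rewrite ltrBlDr|rewrite -ltrBlDr].
  case=> y yB; apply: He => i; have := yB i; rewrite !mxE => /andP[h3 h4].
  have := Hq i; rewrite ltr_distlC => /andP[].
  move=> h1 h2; apply/andP; split; move: h1 h2 h3 h4 e0 ke k0; clear; move: (ratr (q i)) ((f x : 'rV_n) 0 i) (y 0 i) => u v t; rewrite -/r => *; lra.
apply: countable_bigcupT_measurable => [|p]; first exact: countableP.
rewrite /B; case: asboolP => // _.
have -> : f @^-1` obox (map_mx ratr p.1) (p.2.+1%:R^-1 : R) =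
   \bigcap_(i : 'I_n) (fun x => (f x : 'rV[R]_n) 0 i) @^-1` `](map_mx ratr p.1 0 i - p.2.+1%:R^-1), (map_mx ratr p.1 0 i + p.2.+1%:R^-1)[.
  apply/seteqP; split => x /=.
    by move=> H i _; rewrite /= in_itv/=; exact: H.
  by move=> H i; have := H i Logic.I; rewrite /= in_itv/=.
apply: fin_bigcap_measurable => // i _.
rewrite -[X in measurable X]setTI; apply: mf => //.
Qed.

Lemma measurable_open_Esp n (U : set 'rV[R]_n) : open U -> measurable (U : set (Esp R n)).
Proof. exact: sub_sigma_algebra. Qed.

Lemma measurable_cont_Esp n (f : 'rV[R]_n -> R) : continuous f ->
  measurable_fun setT (f : Esp R n -> R).
Proof.
move=> cf; apply: (measurability _ (RGenOpens.measurableE R)).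
move=> _ [_ [a [b ->] <-]]; rewrite setTI; apply: measurable_open_Esp.
by apply: open_comp => [x _|]; [exact: cf|exact: interval_open].
Qed.

Lemma measurable_coord n (i : 'I_n) : measurable_fun setT (fun x : Esp R n => (x : 'rV[R]_n) 0 i).
Proof. by apply: measurable_cont_Esp => x; exact: coord_continuous. Qed.

Definition consR n (t : R) (x : 'rV[R]_n) : 'rV[R]_n.+1 := row_mx (const_mx t : 'rV[R]_1) x.

Lemma consR0 n t (x : 'rV[R]_n) : consR t x 0 ord0 = t.
Proof.
by rewrite /consR mxE; case: splitP => [j _|//]; rewrite mxE.
Qed.

Lemma consRS n t (x : 'rV[R]_n) i : consR t x 0 (lift ord0 i) = x 0 i.
Proof.
rewrite /consR mxE; case: splitP => [j|j /= e]; first by rewrite ord1.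
by congr (x _ _); apply/val_inj; move: e; rewrite /bump /= add1n => -[].
Qed.

Lemma consR_surj n (x : 'rV[R]_n.+1) : x = consR (x 0 ord0) (\row_i x 0 (lift ord0 i)).
Proof.
apply/rowP => i; have [->|[j ->]] : i = ord0 \/ exists j, i = lift ord0 j.
    by case: (unliftP ord0 i) => [j ->|->]; [right; exists j|left].
  by rewrite consR0.
by rewrite consRS mxE.
Qed.

Definition uconsR n (p : measurableTypeR R * Esp R n) : Esp R n.+1 := consR p.1 p.2.

Lemma measurable_consR d (X : measurableType d) n (f : X -> R) (g : X -> Esp R n) :
  measurable_fun setT f -> measurable_fun setT g ->
  measurable_fun setT (fun x => consR (f x) (g x) : Esp R n.+1).
Proof.
move=> mf mg; apply: measurable_to_Esp => i.
case: (unliftP ord0 i) => [j ->|->].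
  under eq_fun do rewrite consRS.
  exact: (measurableT_comp (measurable_coord j) mg).
by under eq_fun do rewrite consR0.
Qed.

Lemma measurable_uconsR n : measurable_fun setT (@uconsR n).
Proof. by apply: measurable_consR. Qed.

Section step.
Variables (n : nat) (lam : {sigma_finite_measure set (measurableTypeR R) -> \bar R})
  (nu : {sigma_finite_measure set (Esp R n) -> \bar R}).

Definition cons_measure := pushforward (prod_meas lam nu) (@uconsR n).

Let cm0 : cons_measure set0 = 0%E.
Proof. by rewrite /cons_measure /pushforward preimage_set0 measure0. Qed.

Let cm_ge0 A : (0 <= cons_measure A)%E.
Proof. by rewrite /cons_measure /pushforward; exact: measure_ge0. Qed.

Let cm_sigma : semi_sigma_additive cons_measure.
Proof.
exact: (@measure_semi_sigma_additive _ _ _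
  (measure_function_pushforward__canonical__measure_function_Measure
     (prod_meas lam nu) (@measurable_uconsR n))).
Qed.

HB.instance Definition _ := isMeasure.Build _ _ _ cons_measure cm0 cm_ge0 cm_sigma.

Lemma sigma_finite_cons : sigma_finite setT cons_measure.
Proof.
have [F TF Ffin] := sigma_finiteT (prod_meas lam nu).
pose dec (x : Esp R n.+1) : measurableTypeR R * Esp R n :=
  ((x : 'rV[R]_n.+1) 0 ord0, (\row_i (x : 'rV[R]_n.+1) 0 (lift ord0 i))).
have mdec : measurable_fun setT dec.
  apply: measurable_fun_pair; first exact: measurable_coord.
  apply: measurable_to_Esp => i; under eq_fun do rewrite mxE.
  exact: measurable_coord.
exists (fun k => dec @^-1` F k).
  by rewrite -preimage_bigcup -TF preimage_setT.
move=> k; have [mF Fk] := Ffin k; split.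
  by rewrite -[X in measurable X]setTI; exact: mdec.
rewrite /cons_measure /pushforward.
suff -> : @uconsR n @^-1` (dec @^-1` F k) = F k by [].
apply/seteqP; split => -[t x] /=; rewrite /dec /uconsR /= consR0.
  by congr (F k (_, _)); apply/rowP => i; rewrite mxE consRS.
by congr (F k (_, _)); apply/rowP => i; rewrite mxE consRS.
Qed.

HB.instance Definition _ := Measure_isSigmaFinite.Build _ _ _ cons_measure sigma_finite_cons.

Lemma integral_cons_measure (f : Esp R n.+1 -> \bar R) : measurable_fun setT f ->
  (forall x, 0 <= f x)%E ->
  (\int[cons_measure]_x f x = \int[lam]_t \int[nu]_x f (consR t x))%E.
Proof.
move=> mf f0; rewrite ge0_integral_pushforward//=; last exact: measurable_uconsR.
rewrite preimage_setT.
rewrite (fubini_tonelli1 (f \o @uconsR n))//=.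
by apply: measurableT_comp => //; exact: measurable_uconsR.
Qed.

End step.

(** Follows the recursion of [iint], so that [iintE] is Tonelli's theorem applied once per
    coordinate. In dimension 0 the iterated integral is evaluation at the only point, hence the
    Dirac mass. *)
Fixpoint leb n : {sigma_finite_measure set (Esp R n) -> \bar R} :=
  match n with
  | 0 => (\d_(0%R : Esp R 0) : {sigma_finite_measure set (Esp R 0) -> \bar R})
  | m.+1 => (cons_measure lebesgue_measure (leb m) : {sigma_finite_measure set (Esp R m.+1) -> \bar R})
  end.

Lemma iintE n (f : 'rV[R]_n -> \bar R) : measurable_fun setT (f : Esp R n -> _) ->
  (forall x, 0 <= f x)%E -> iint f = (\int[leb n]_x f x)%E.
Proof.
elim: n f => [|n IH] f mf f0 /=.
  by rewrite integral_dirac// diracT mul1e.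
rewrite integral_cons_measure//; apply: eq_integral => t _; rewrite IH//.
by apply: measurableT_comp mf _; exact: measurable_consR.
Qed.

End Borel.

(** * Outer integrals *)

Section Outer.
Variable R : realType.
Implicit Types n : nat.

Lemma borel_funE n d (V : measurableType d) (f : 'rV[R]_n -> V) :
  borel_fun f <-> measurable_fun setT (f : Esp R n -> V).
Proof.
split=> [bf _ B mB|mf B mB]; first by rewrite setTI; exact: bf.
by have := mf measurableT B mB; rewrite setTI.
Qed.

Lemma lint_borel n (f : 'rV[R]_n -> \bar R) : measurable_fun setT (f : Esp R n -> _) ->
  (forall x, 0 <= f x)%E -> lint f = (\int[leb R n]_x f x)%E.
Proof.
move=> mf f0; apply/eqP; rewrite eq_le; apply/andP; split.
  apply: ereal_inf_lbound; exists f => //=; last exact: iintE.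
  by split => //; exact/borel_funE.
apply: le_ereal_inf_tmp => _ /= [g [/borel_funE mg fg] <-].
have g0 x : (0 <= g x)%E := le_trans (f0 x) (fg x).
by rewrite iintE//; apply: ge0_le_integral.
Qed.

Lemma lint_le n (f g : 'rV[R]_n -> \bar R) : (forall x, f x <= g x)%E ->
  (lint f <= lint g)%E.
Proof.
move=> fg; apply: ereal_inf_le_tmp => _ [h [bh gh] <-]; exists h => //=; split => // x.
exact: le_trans (fg x) (gh x).
Qed.

Lemma lint_ge0 n (f : 'rV[R]_n -> \bar R) : (forall x, 0 <= f x)%E -> (0 <= lint f)%E.
Proof.
move=> f0; apply: le_ereal_inf_tmp => _ [g [/borel_funE mg fg] <-].
have g0 x : (0 <= g x)%E := le_trans (f0 x) (fg x).
by rewrite iintE//; apply: integral_ge0.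
Qed.

(** The infimum in [lint] comes only with majorants [g k] of integral below 1/(k+1). By Markov's
    inequality the intersection of the sets where [g k] is at least 1 is a Borel null set, and it
    contains [N]. *)
Lemma lnullP n (N : set 'rV[R]_n) : lnull N <-> (leb R n).-negligible (N : set (Esp R n)).
Proof.
split.
  move=> N0.
  have H (k : nat) : exists g : Esp R n -> \bar R, [/\ measurable_fun setT g,
      (forall x, indE N x <= g x)%E & (\int[leb R n]_x g x < (k.+1%:R^-1)%:E)%E].
    have [] := @ereal_inf_lt _ [set iint g | g in [set g : 'rV[R]_n -> \bar R |
                          borel_fun g /\ forall x, (indE N x <= g x)%E]] (k.+1%:R^-1)%:E.
      by rewrite -/(lint _) N0 lte_fin invr_gt0.
    move=> _ [g [/borel_funE mg Ng] <-]; rewrite iintE//; last first.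
      by move=> x; apply: le_trans (Ng x); rewrite lee_fin.
    by exists g.
  have [g Hg] := choice H.
  have mgE k : measurable [set x : Esp R n | (1%:E <= g k x)%E].
    have [mg _ _] := Hg k.
    by rewrite -[X in measurable X]setTI; exact: emeasurable_fun_c_infty.
  exists (\bigcap_k [set x : Esp R n | (1%:E <= g k x)%E]); split.
  - exact: bigcap_measurableType.
  - apply/eqP; rewrite eq_le measure_ge0 andbT.
    apply/lee_addgt0Pr => _/posnumP[e]; rewrite add0e.
    have [k ke] : exists k : nat, (k.+1%:R^-1 : R) < e%:num.
      exists (Num.truncn (e%:num)^-1).
      by rewrite invf_plt ?posrE// truncnS_gt.
    have [mg Ng gk] := Hg k.
    have g0 x : (0 <= g k x)%E by apply: le_trans (Ng x); rewrite lee_fin.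
    apply: (@le_trans _ _ (\int[leb R n]_x g k x)%E); last first.
      by apply/ltW/(lt_trans gk); rewrite lte_fin.
    apply: (@le_trans _ _ (leb R n [set x : Esp R n | (1%:E <= g k x)%E])).
      apply: le_measure; rewrite ?inE//; first exact: bigcap_measurableType.
      by apply: bigcap_inf.
    rewrite -(setIT [set x : Esp R n | _]) -integral_indic//.
    apply: ge0_le_integral => //.
      by apply/measurable_EFinP; exact: measurable_indic.
    move=> x _ /=; rewrite indicE; case: (boolP (x \in _)) => [|_ //].
    by rewrite inE.
  - move=> x Nx k _ /=; have [_ Ng _] := Hg k; apply: le_trans (Ng x).
    by rewrite /indE indicE mem_set.
move=> [B [mB B0 NB]]; apply/eqP; rewrite /lnull eq_le lint_ge0 ?andbT; last first.
  by move=> x; rewrite lee_fin.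
apply: (@le_trans _ _ (lint (indE B))).
  apply: lint_le => x; rewrite lee_fin !indicE.
  by have [/set_mem/NB/mem_set ->|] := boolP (x \in N); rewrite ?ler0n.
rewrite lint_borel; [by rewrite integral_indic// setIT; move/eqP: B0; rewrite eq_le => /andP[]| |by move=> x; rewrite lee_fin].
by rewrite /indE; apply/measurable_EFinP; exact: measurable_indic.
Qed.

Lemma aeP n (P : 'rV[R]_n -> Prop) : ae P <-> {ae leb R n, forall x, P x}.
Proof.
split=> [[N [/lnullP N0 NP]]|[N [mN N0 NP]]].
  by apply: negligibleS N0 => x /= nP; apply: contrapT => /NP.
exists (~` P); split => [|x /contrapT//]; apply/lnullP.
by exists N; split.
Qed.

Lemma aeS n (P Q : Esp R n -> Prop) : {ae leb R n, forall x, P x} ->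
  (forall x, P x -> Q x) -> {ae leb R n, forall x, Q x}.
Proof. by move=> P0 PQ; apply: negligibleS P0 => x nQ Px; apply/nQ/PQ. Qed.

Lemma aeI n (P Q : Esp R n -> Prop) : {ae leb R n, forall x, P x} ->
  {ae leb R n, forall x, Q x} -> {ae leb R n, forall x, P x /\ Q x}.
Proof.
move=> P0 Q0; apply: (negligibleS _ (negligibleU P0 Q0)) => x /not_andP[]; by [left|right].
Qed.

Lemma aeT n (P : Esp R n -> Prop) : (forall x, P x) -> {ae leb R n, forall x, P x}.
Proof. by move=> H; exists set0; split => // x; have := H x. Qed.

Lemma lint_ae_le n (f g : 'rV[R]_n -> \bar R) :
  (forall x, 0 <= f x)%E -> (forall x, 0 <= g x)%E ->
  {ae leb R n, forall x, f x <= g x}%E -> (lint f <= lint g)%E.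
Proof.
move=> f0 g0 [B [mB B0 BP]]; apply: le_ereal_inf_tmp => _ [h [/borel_funE mh gh] <-].
have h0 x : (0 <= h x)%E := le_trans (g0 x) (gh x).
(* The value +oo on the exceptional null set turns a Borel majorant of [g] into one of [f] without
   changing the integral. *)
pose h' (x : Esp R n) := if x \in B then +oo%E else h x.
have mh' : measurable_fun setT h'.
  apply: measurable_fun_ifT => //; apply: (measurable_fun_bool true).
  rewrite setTI (_ : _ @^-1` _ = B)//.
  by apply/seteqP; split => x /=; [exact: set_mem|exact: mem_set].
have h'0 x : (0 <= h' x)%E by rewrite /h'; case: ifP.
apply: (@le_trans _ _ (iint h')).
  apply: ereal_inf_lbound; exists h' => //=; split; first exact/borel_funE.
  move=> x; rewrite /h'; case: ifPn => [_|]; rewrite ?leey// notin_setE => nBx.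
  by apply: le_trans (gh x); apply: contrapT => /BP.
rewrite !iintE//; apply: ae_ge0_le_integral => //.
exists B; split => // x; apply: contra_notP => nBx _.
by rewrite /h'; move/mem_set: (nBx) => _; rewrite memNset.
Qed.

Lemma lint_ae_eq n (f g : 'rV[R]_n -> \bar R) :
  (forall x, 0 <= f x)%E -> (forall x, 0 <= g x)%E ->
  {ae leb R n, forall x, f x = g x}%E -> (lint f = lint g)%E.
Proof.
move=> f0 g0 fg; apply/eqP; rewrite eq_le; apply/andP; split; apply: lint_ae_le => //.
  by apply: (aeS fg) => x ->.
by apply: (aeS fg) => x ->.
Qed.

(** The Borel sets approximating {f < q} for rational q leave countably many null errors. Off their
    union {f < r} is the union of the approximations with q <= r, so resetting f to 0 on that union
    gives a Borel function. *)
Lemma lmeasfun_borel n (f : 'rV[R]_n -> R) : lmeasfun f ->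
  exists2 g : Esp R n -> R, measurable_fun setT g & {ae leb R n, forall x, f x = g x}.
Proof.
move=> mf.
have /choice[B HB] : forall q : rat, exists B : set (Esp R n), measurable B /\
    (leb R n).-negligible ((f @^-1` `]-oo, ratr q[ `\` B) `|` (B `\` f @^-1` `]-oo, ratr q[)).
  move=> q; have [B [mB /lnullP NB]] := mf `]-oo, (ratr q : R)[%classic (measurable_itv _).
  by exists B.
have [N [mN N0 BN]] : (leb R n).-negligible (\bigcup_q
    ((f @^-1` `]-oo, (ratr q : R)[ `\` B q) `|` (B q `\` f @^-1` `]-oo, (ratr q : R)[))).
  have /pcard_eqP/bijPex[e be] := card_rat.
  pose e' := 'pinv_(fun=> 0%Q) setT e.
  have -> : (\bigcup_q
    ((f @^-1` `]-oo, (ratr q : R)[ `\` B q) `|` (B q `\` f @^-1` `]-oo, (ratr q : R)[))) =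
    \bigcup_k ((f @^-1` `]-oo, (ratr (e' k) : R)[ `\` B (e' k)) `|` (B (e' k) `\` f @^-1` `]-oo, (ratr (e' k) : R)[)).
    apply/seteqP; split=> x [q _ qx]; last by exists (e' q).
    exists (e q) => //; rewrite /e' pinvKV ?inE//.
    by move=> ? ? _ _; apply: (set_bij_inj be); rewrite ?inE.
  by apply: negligible_bigcup => k; have [] := HB (e' k).
pose g (x : Esp R n) := if x \in N then 0 else f x.
have mN' : measurable_fun setT (fun x : Esp R n => x \in N).
  apply: (measurable_fun_bool true).
  rewrite setTI (_ : _ @^-1` _ = N)//.
  by apply/seteqP; split => x /=; [exact: set_mem|exact: mem_set].
exists g; last first.
  exists N; split => // x; apply: contra_notP => nNx.
  by rewrite /= /g memNset.
apply: (measurability _ (RGenInftyO.measurableE R)) => _ [_ [r ->] <-]; rewrite setTI.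
(* On [N] the function is 0, so [N] belongs to the preimage exactly when 0 < r. *)
have -> : g @^-1` `]-oo, r[ = (if (0 < r) then N else set0) `|`
    (\bigcup_(q in [set q : rat | ratr q <= r]) B q `\` N).
  apply/seteqP; split => [x /=|x /= [|]].
  - rewrite in_itv/= /g; case: ifPn; rewrite ?inE ?notin_setE => Nx fr.
      by left; rewrite fr.
    right; have [q] := rat_in_itvoo fr; rewrite in_itv/= => /andP[q1 q2].
    split => //; exists q; first exact: ltW.
    apply: contrapT => nB; apply: Nx; apply: BN; exists q => //; left; split => //=.
  - case: ifPn => r0 Nx; last by case: Nx.
    by rewrite in_itv/= /g mem_set.
  - move=> [[q /= qr Bx] Nx]; rewrite in_itv/= /g memNset//.
    apply: contrapT => nfr; apply: Nx; apply: BN; exists q => //; right; split => //=.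
    by rewrite in_itv/= => fq; apply: nfr; exact: lt_le_trans qr.
apply: measurableU; first by case: ifPn.
apply: measurableD => //.
rewrite bigcup_mkcond; apply: countable_bigcupT_measurable => [|q]; first exact: countableP.
by case: ifPn => // _; have [] := HB q.
Qed.

Lemma lmeasfun_ae n (f : 'rV[R]_n -> R) (g : Esp R n -> R) : measurable_fun setT g ->
  {ae leb R n, forall x, f x = g x} -> lmeasfun f.
Proof.
move=> mg fg B mB; exists (g @^-1` B); split.
  by have := mg measurableT B mB; rewrite setTI.
apply/lnullP; apply: negligibleS fg => x /= [[fB gB]|[gB fB]] fgx.
  by apply: gB; rewrite -fgx.
by apply: fB; rewrite fgx.
Qed.

Definition L1f n (f : Esp R n -> R) := (leb R n).-integrable setT (EFin \o f).

Lemma lint_ae n (f : 'rV[R]_n -> R) (g : Esp R n -> R) : measurable_fun setT g ->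
  (forall x, 0 <= f x) -> (forall x, 0 <= g x) ->
  {ae leb R n, forall x, f x = g x} ->
  lint (fun x => (f x)%:E) = (\int[leb R n]_x (g x)%:E)%E.
Proof.
move=> mg f0 g0 fg; rewrite -lint_borel => [||x]; rewrite ?lee_fin//; last first.
  exact/measurable_EFinP.
by apply: lint_ae_eq => [x|x|]; rewrite ?lee_fin//; apply: (aeS fg) => x ->.
Qed.

Lemma rint_ae n (f : 'rV[R]_n -> R) (g : Esp R n -> R) : L1f g ->
  {ae leb R n, forall x, f x = g x} -> rint f = \int[leb R n]_x g x.
Proof.
move=> ig fg; have /measurable_int/measurable_EFinP mg := ig.
rewrite /rint (@lint_ae _ _ (fun x => Num.max (g x) 0)); first last.
- by apply: (aeS fg) => x ->.
- by move=> x; rewrite le_max lexx orbT.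
- by move=> x; rewrite le_max lexx orbT.
- exact: measurable_maxr.
rewrite (@lint_ae _ (fun x => Num.max (- f x) 0) (fun x => Num.max (- g x) 0)); first last.
- by apply: (aeS fg) => x ->.
- by move=> x; rewrite le_max lexx orbT.
- by move=> x; rewrite le_max lexx orbT.
- by apply: measurable_maxr => //; exact: measurable_funN.
transitivity (fine (\int[leb R n]_x (EFin \o g)^\+ x) - fine (\int[leb R n]_x (EFin \o g)^\- x)).
  by congr (fine _ - fine _); apply: eq_integral => x _;
    rewrite ?funeposE ?funenegE /= ?EFin_max.
rewrite /Rintegral [in RHS]integralE [RHS]fineB//.
- exact: integrable_pos_fin_num.
- exact: integrable_neg_fin_num.
Qed.

Lemma rintegrable_ae n (f : 'rV[R]_n -> R) (g : Esp R n -> R) : L1f g ->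
  {ae leb R n, forall x, f x = g x} -> rintegrable f.
Proof.
move=> ig fg; have /integrableP[/measurable_EFinP mg g_lty] := ig.
split; first exact: lmeasfun_ae fg.
rewrite (@lint_ae _ (fun x => `|f x|) (fun x => `|g x|))//.
- exact: measurableT_comp.
- by apply: (aeS fg) => x ->.
Qed.

Lemma rintegrable_L1f n (f : 'rV[R]_n -> R) (g : Esp R n -> R) : measurable_fun setT g ->
  {ae leb R n, forall x, f x = g x} -> rintegrable f -> L1f g.
Proof.
move=> mg fg [_ flty]; apply/integrableP; split; first exact/measurable_EFinP.
move: flty; rewrite (@lint_ae _ (fun x => `|f x|) (fun x => `|g x|))//.
- exact: measurableT_comp.
- by apply: (aeS fg) => x ->.
Qed.

End Outer.

(** * Real-valued integrals: dominated convergence and Fubini *)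

Section RealIntegral.
Context d (X : measurableType d) (R : realType) (mu : {measure set X -> \bar R}).
Implicit Types f g h : X -> R.

Definition L1 f := mu.-integrable setT (EFin \o f).

Lemma L1_meas f : L1 f -> measurable_fun setT f.
Proof. by move/measurable_int/measurable_EFinP. Qed.

Lemma L1_dom g f : measurable_fun setT f -> L1 g -> (forall x, `|f x| <= g x) -> L1 f.
Proof.
move=> mf ig fg; apply: (le_integrable _ _ _ ig) => //; first exact/measurable_EFinP.
move=> x _ /=; rewrite lee_fin (le_trans (fg x))//; exact: ler_norm.
Qed.

Lemma L1_lty f : measurable_fun setT f -> (\int[mu]_x `|f x|%:E < +oo)%E -> L1 f.
Proof. by move=> mf flty; apply/integrableP; split => //; exact/measurable_EFinP. Qed.

Lemma L1_fin f : L1 f -> (\int[mu]_x `|f x|%:E < +oo)%E.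
Proof. by move/integrableP => []. Qed.

Lemma L1_eq f g : L1 f -> (forall x, f x = g x) -> L1 g.
Proof. by move=> L1 fg; rewrite (_ : g = f)//; apply/funext => x; rewrite fg. Qed.

Lemma L1D f g : L1 f -> L1 g -> L1 (fun x => f x + g x).
Proof. by move=> If Ig; have := integrableD measurableT If Ig; apply: eq_integrable. Qed.

Lemma L1Z r f : L1 f -> L1 (fun x => r * f x).
Proof. by move=> If; have := integrableZl measurableT r If; apply: eq_integrable. Qed.

Lemma L1N f : L1 f -> L1 (fun x => - f x).
Proof. by move=> If; have := integrableN If; apply: eq_integrable. Qed.

Lemma L1B f g : L1 f -> L1 g -> L1 (fun x => f x - g x).
Proof. by move=> If Ig; apply: L1D => //; exact: L1N. Qed.

Lemma L10 : L1 (fun=> 0).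
Proof. by have := integrable0 mu setT; apply: eq_integrable. Qed.

Lemma L1_sum I (s : seq I) (P : pred I) (f : I -> X -> R) :
  (forall i, L1 (f i)) -> L1 (fun x => \sum_(i <- s | P i) f i x).
Proof.
move=> If; elim: s => [|i s IH].
  by apply: (L1_eq L10) => x; rewrite big_nil.
case Pi: (P i).
  by apply: (L1_eq (L1D (If i) IH)) => x; rewrite big_cons Pi.
by apply: (L1_eq IH) => x; rewrite big_cons Pi.
Qed.

Lemma L1_norm f : L1 f -> L1 (fun x => `|f x|).
Proof. by move=> If; have := integrable_abse If; apply: eq_integrable. Qed.

Lemma L1_mulb M h f : measurable_fun setT h -> (forall x, `|h x| <= M) -> L1 f ->
  L1 (fun x => h x * f x).
Proof.
move=> mh hM If; apply: (@L1_dom (fun x => M * `|f x|)).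
- by apply: measurable_funM => //; exact: L1_meas.
- exact/L1Z/L1_norm.
- by move=> x; rewrite normrM ler_wpM2r.
Qed.

Lemma EFin_int f : L1 f -> (\int[mu]_x f x)%:E = (\int[mu]_x (f x)%:E)%E.
Proof. by move=> If; rewrite /Rintegral fineK//; exact: integrable_fin_num. Qed.

Lemma RintD f g : L1 f -> L1 g ->
  \int[mu]_x (f x + g x) = \int[mu]_x f x + \int[mu]_x g x.
Proof. by move=> If Ig; rewrite RintegralD. Qed.

Lemma RintB f g : L1 f -> L1 g ->
  \int[mu]_x (f x - g x) = \int[mu]_x f x - \int[mu]_x g x.
Proof. by move=> If Ig; rewrite RintegralB. Qed.

Lemma RintZ r f : L1 f -> \int[mu]_x (r * f x) = r * \int[mu]_x f x.
Proof. by move=> If; rewrite RintegralZl. Qed.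

Lemma Rint0 : \int[mu]_x (0 : R) = 0.
Proof. by rewrite /Rintegral integral0. Qed.

Lemma Rint_sum I (s : seq I) (P : pred I) (f : I -> X -> R) :
  (forall i, L1 (f i)) ->
  \int[mu]_x (\sum_(i <- s | P i) f i x) = \sum_(i <- s | P i) \int[mu]_x f i x.
Proof.
move=> If; elim: s => [|i s IH].
  by rewrite big_nil -[RHS]Rint0; apply: eq_Rintegral => x _; rewrite big_nil.
rewrite big_cons; case: ifPn => Pi.
  rewrite -IH -RintD//; last exact: L1_sum.
  by apply: eq_Rintegral => x _; rewrite big_cons Pi.
by rewrite -IH; apply: eq_Rintegral => x _; rewrite big_cons (negbTE Pi).
Qed.

Lemma Rint_le f g : L1 f -> L1 g -> (forall x, f x <= g x) ->
  \int[mu]_x f x <= \int[mu]_x g x.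
Proof. by move=> If Ig fg; rewrite le_Rintegral. Qed.

Lemma Rint_norm f : L1 f -> `|\int[mu]_x f x| <= \int[mu]_x `|f x|.
Proof. by move=> If; rewrite le_normr_Rintegral. Qed.

Lemma Rint_norm_le f g : L1 f -> L1 g -> (forall x, `|f x| <= g x) ->
  `|\int[mu]_x f x| <= \int[mu]_x g x.
Proof.
move=> If Ig fg; rewrite (le_trans (Rint_norm If))// Rint_le//; exact: L1_norm.
Qed.

Lemma Rint_dcvg (f_ : nat -> X -> R) f g :
  (forall k, measurable_fun setT (f_ k)) -> measurable_fun setT f ->
  (forall x, (fun k => f_ k x) @ \oo --> f x) ->
  L1 g -> (forall k x, `|f_ k x| <= g x) ->
  L1 f /\ (fun k => \int[mu]_x f_ k x) @ \oo --> \int[mu]_x f x.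
Proof.
move=> mf_ mf cf Ig fg.
have cf' x : EFin \o (fun k => f_ k x) @ \oo --> (f x)%:E.
  by apply: cvg_EFin; [exact: nearW|exact: cf].
have [] := @dominated_convergence _ _ _ mu setT measurableT
  (fun k => EFin \o f_ k) (EFin \o f) (EFin \o g).
- by move=> k; exact/measurable_EFinP.
- exact/measurable_EFinP.
- by exists set0; split => // x /= H; exfalso; apply: H => _; exact: cf'.
- exact: Ig.
- by exists set0; split => // x /= H; exfalso; apply: H => k _ /=; rewrite lee_fin.
move=> If _ cv; split => //.
by apply: fine_cvg; rewrite fineK//; exact: integrable_fin_num.
Qed.

Lemma Rint_ge0 f : (forall x, 0 <= f x) -> 0 <= \int[mu]_x f x.
Proof. by move=> f0; rewrite Rintegral_ge0. Qed.

End RealIntegral.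

Section RealFubini.
Context d1 d2 (X : measurableType d1) (Y : measurableType d2) (R : realType).
Variables (mx : {sigma_finite_measure set X -> \bar R})
  (my : {sigma_finite_measure set Y -> \bar R}).
Implicit Type f : X * Y -> R.

(** Integrability is asked of every section, not of almost every one: the inner integral is then the
    true one at each x, and real integrals can be iterated without exceptional sets. *)
Lemma Rfubini1 f : L1 (prod_meas mx my) f -> (forall x, L1 my (fun y => f (x, y))) ->
  L1 mx (fun x => \int[my]_y f (x, y)) /\
  \int[prod_meas mx my]_z f z = \int[mx]_x \int[my]_y f (x, y).
Proof.
move=> If Ifx.
have E : (fun x => (\int[my]_y f (x, y))%:E) = fubini_F my (EFin \o f).
  by apply/funext => x; rewrite /fubini_F EFin_int.
have IF : L1 mx (fun x => \int[my]_y f (x, y)).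
  by have H := integrable_fubini_F If; rewrite -E in H; exact: H.
split => //; apply: EFin_inj; rewrite !EFin_int// E.
by rewrite -[LHS](integral12_prod_meas1 If).
Qed.

Lemma Rfubini2 f : L1 (prod_meas mx my) f -> (forall y, L1 mx (fun x => f (x, y))) ->
  L1 my (fun y => \int[mx]_x f (x, y)) /\
  \int[prod_meas mx my]_z f z = \int[my]_y \int[mx]_x f (x, y).
Proof.
move=> If Ify.
have E : (fun y => (\int[mx]_x f (x, y))%:E) = fubini_G mx (EFin \o f).
  by apply/funext => y; rewrite /fubini_G EFin_int.
have IF : L1 my (fun y => \int[mx]_x f (x, y)).
  apply: L1_lty.
    by apply/measurable_EFinP; have H := measurable_fubini_G If; rewrite -E in H; exact: H.
  have mnf : measurable_fun setT (fun z => (`|f z|)%:E).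
    by apply/measurable_EFinP; apply: measurableT_comp => //; exact: L1_meas If.
  have := L1_fin If; rewrite [ltLHS](fubini_tonelli2 (fun z => (`|f z|)%:E))//.
  apply: le_lt_trans; apply: ge0_le_integral => //.
  - apply: measurableT_comp => //; apply: measurableT_comp => //.
    by apply/measurable_EFinP; have H := measurable_fubini_G If; rewrite -E in H; exact: H.
  - exact: measurable_fun_fubini_tonelli_G.
  - move=> y _; rewrite /fubini_G -(EFin_int (L1_norm (Ify y))) lee_fin.
    exact: Rint_norm.
split => //; apply: EFin_inj; rewrite !EFin_int// E.
by rewrite -[LHS](integral21_prod_meas1 If).
Qed.

Lemma L1_prod f (g : X -> R) : measurable_fun setT f ->
  (forall x, L1 my (fun y => f (x, y))) ->
  L1 mx g -> (forall x, \int[my]_y `|f (x, y)| <= g x) -> L1 (prod_meas mx my) f.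
Proof.
move=> mf Ify Ig fg; apply: L1_lty => //.
have mnf : measurable_fun setT (fun z => (`|f z|)%:E).
  by apply/measurable_EFinP; exact: measurableT_comp.
rewrite [ltLHS](fubini_tonelli1 (fun z => (`|f z|)%:E))//.
have /integrableP[_ Ilty] := Ig; apply: le_lt_trans Ilty.
apply: ge0_le_integral => //.
- by move=> x _; apply: integral_ge0.
- exact: measurable_fun_fubini_tonelli_F.
- by apply: measurableT_comp => //; exact: (measurable_int mx Ig).
- move=> x _ /=; rewrite /fubini_F -(EFin_int (L1_norm (Ify x))).
  by rewrite lee_fin (le_trans (fg x))// ler_norm.
Qed.

Lemma L1_tensor (f : X -> R) (g : Y -> R) : L1 mx f -> L1 my g ->
  L1 (prod_meas mx my) (fun z => f z.1 * g z.2).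
Proof.
move=> If Ig; apply: (@L1_prod _ (fun x => `|f x| * \int[my]_y `|g y|)).
- apply: measurable_funM.
    exact: (measurableT_comp (L1_meas If) measurable_fst).
  exact: (measurableT_comp (L1_meas Ig) measurable_snd).
- by move=> x; exact: (L1Z (f x) Ig).
- by apply: (L1_eq (L1Z (\int[my]_y `|g y|) (L1_norm If))) => x; rewrite mulrC.
- move=> x /=; under eq_Rintegral do rewrite normrM.
  by rewrite RintZ//; exact: L1_norm.
Qed.

(** Tonelli gives measurability for nonnegative integrands; as each section is integrable, the inner
    integral is the difference of those of the positive and negative parts. *)
Lemma measurable_Rint f : measurable_fun setT f -> (forall x, L1 my (fun y => f (x, y))) ->
  measurable_fun setT (fun x => \int[my]_y f (x, y)).
Proof.
move=> mf If.
have -> : (fun x => \int[my]_y f (x, y)) = (fun x => \int[my]_y Num.max (f (x, y)) 0 - \int[my]_y Num.max (- f (x, y)) 0).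
  apply/funext => x; rewrite -RintB.
  - apply: eq_Rintegral => y _; rewrite /Num.max; case: ltP => h1; case: ltP => h2; lra.
  - apply: (L1_dom _ (L1_norm (If x))) => [|y].
      by apply: measurable_maxr => //; exact: (L1_meas (If x)).
    by rewrite /Num.max; case: ltP => h1; rewrite ?normr0//.
  - apply: (L1_dom _ (L1_norm (If x))) => [|y].
      by apply: measurable_maxr => //; apply: measurable_funN; exact: (L1_meas (If x)).
    by rewrite /Num.max; case: ltP => h1; rewrite ?normr0// normrN.
have main (g : X * Y -> R) : measurable_fun setT g -> (forall z, 0 <= g z) ->
    measurable_fun setT (fun x => \int[my]_y g (x, y)).
  move=> mg g0; apply: measurableT_comp => //.
  apply: (measurable_fun_fubini_tonelli_F (EFin \o g)); first exact/measurable_EFinP.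
  by move=> z; rewrite lee_fin.
apply: measurable_funB; [apply: (main (fun z => Num.max (f z) 0))|
  apply: (main (fun z => Num.max (- f z) 0))].
- exact: measurable_maxr.
- by move=> z; rewrite le_max lexx orbT.
- by apply: measurable_maxr => //; exact: measurable_funN.
- by move=> z; rewrite le_max lexx orbT.
Qed.

End RealFubini.

(** * The Fourier transform of exp (- r |t|) *)

Section OneDim.
Variable R : realType.
Local Notation leb1 := (@lebesgue_measure R).

(** The summand 1 makes the integrand nonnegative, as the fundamental theorem of calculus on a
    half-line demands in [expcos_half]; it is subtracted again in [expcos_int]. *)
Lemma expcos_derive (r z s t : R) : 0 < r ->
  is_derive t 1 (fun t => expR (- (r * t)) * (- r^-1 + (z * sin (z * t + s) - r * cos (z * t + s)) / (r ^+ 2 + z ^+ 2)))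
   (expR (- (r * t)) * (1 + cos (z * t + s))).
Proof.
move=> r0; have D0 : r ^+ 2 + z ^+ 2 != 0.
  by rewrite gt_eqF// ltr_wpDr ?sqr_ge0// exprn_gt0.
apply: is_derive_eq; rewrite /GRing.scale /=; field.
by rewrite D0 gt_eqF.
Qed.

Lemma expcos_cvg (r z s : R) : 0 < r ->
  expR (- (r * t)) * (- r^-1 + (z * sin (z * t + s) - r * cos (z * t + s)) / (r ^+ 2 + z ^+ 2)) @[t --> +oo] --> (0 : R).
Proof.
move=> r0.
pose G t := - r^-1 + (z * sin (z * t + s) - r * cos (z * t + s)) / (r ^+ 2 + z ^+ 2).
have [M HM] : exists M, forall t, `|G t| <= M.
  exists (r^-1 + (`|z| + r) / (r ^+ 2 + z ^+ 2)) => t; rewrite /G.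
  have ri : 0 <= r^-1 by rewrite invr_ge0 ltW.
  apply: (le_trans (ler_normD _ _)); rewrite normrN (ger0_norm ri) lerD2l.
  have D0 : 0 < r ^+ 2 + z ^+ 2 by rewrite ltr_wpDr ?sqr_ge0// exprn_gt0.
  rewrite normrM normfV (gtr0_norm D0); apply: ler_wpM2r; first by rewrite invr_ge0 ltW.
  apply: (le_trans (ler_normB _ _)); rewrite !normrM (gtr0_norm r0) lerD//.
    by rewrite ler_piMr// sin_max.
  by rewrite ler_piMr ?cos_max// ltW.
have E0 : expR (- (r * t)) @[t --> +oo] --> (0 : R).
  apply: (@cvg_comp _ _ _ (fun t => r * t) (fun u => expR (- u)) _ (+oo)); last exact: cvgr_expR.
  exact: (gt0_cvgMry r0 (@cvg_id _ _)).
have M0 : 0 <= M := le_trans (normr_ge0 _) (HM 0).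
have ME (a : R) : expR (- (r * t)) * a @[t --> +oo] --> (0 : R).
  by rewrite -[X in _ --> X](mul0r a); apply: cvgM => //; exact: cvg_cst.
apply: (squeeze_cvgr _ (ME (- M)) (ME M)).
near=> t; have := HM t; rewrite ler_norml => /andP[h1 h2].
by apply/andP; split; rewrite ler_wpM2l ?expR_ge0.
Unshelve. all: by end_near. Qed.

Lemma expcos_half (r z s : R) : 0 < r ->
  (\int[leb1]_(t in `[0%R, +oo[) (expR (- (r * t)) * (1 + cos (z * t + s)))%:E =
  (r^-1 - (z * sin s - r * cos s) / (r ^+ 2 + z ^+ 2))%:E)%E.
Proof.
move=> r0; have dF t := expcos_derive z s t r0.
rewrite (ge0_continuous_FTC2y _ _ (expcos_cvg z s r0)).
- by rewrite sub0e !mulr0 oppr0 expR0 mul1r add0r -EFinN opprD opprK.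
- by move=> x _; rewrite mulr_ge0 ?expR_ge0// -lerBlDl sub0r cos_geN1.
- apply: continuous_subspaceT => t.
  apply: cvgM.
    apply: continuous_comp; last exact: continuous_expR.
    by apply: cvgN; apply: cvgM; [exact: cvg_cst|exact: cvg_id].
  apply: cvgD; first exact: cvg_cst.
  apply: continuous_comp; last exact: continuous_cos.
  by apply: cvgD; [apply: cvgM; [exact: cvg_cst|exact: cvg_id]|exact: cvg_cst].
- by move=> x _; exact: ex_derive.
- apply: cvg_at_right_filter.
  by have /derivable1_diffP/differentiable_continuous := @ex_derive _ _ _ _ _ _ _ (dF 0).
- by move=> x _; rewrite derive1E derive_val.
Qed.

Lemma measurable_expcos (r z s : R) :
  measurable_fun setT (fun t : R => expR (- (r * `|t|)) * (1 + cos (z * t + s))).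
Proof.
apply: measurable_funM.
  apply: measurableT_comp => //; apply: measurable_funN; exact: measurable_funM.
apply: measurable_funD => //; apply: measurableT_comp.
  by apply: continuous_measurable_fun; exact: continuous_cos.
by apply: measurable_funD => //; exact: measurable_funM.
Qed.

Lemma expcos_full (r z s : R) : 0 < r ->
  (\int[leb1]_t (expR (- (r * `|t|)) * (1 + cos (z * t + s)))%:E =
  (2 / r + 2 * r * cos s / (r ^+ 2 + z ^+ 2))%:E)%E.
Proof.
move=> r0; set f := fun t : R => _.
have f0 t : (0 <= f t)%E.
  by rewrite lee_fin mulr_ge0 ?expR_ge0// -lerBlDl sub0r cos_geN1.
have mf : measurable_fun setT f by apply/measurable_EFinP; exact: measurable_expcos.
have -> : [set: R] = `]-oo, 0%R] `|` `]0%R, +oo[.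
  by rewrite -setCitvl setUv.
rewrite ge0_integral_setU//=; last 2 first.
- exact: measurable_funS mf.
- by rewrite -setCitvl disj_set2E; apply/eqP; rewrite setICr.
rewrite integral_itv_obnd_cbnd; last exact: measurable_funS mf.
have -> : (\int[leb1]_(t in `[0%R, +oo[) f t = (r^-1 - (z * sin s - r * cos s) / (r ^+ 2 + z ^+ 2))%:E)%E.
  rewrite -expcos_half//; apply: eq_integral => t; rewrite inE/= in_itv/= andbT => t0.
  by rewrite /f ger0_norm.
have -> : (\int[leb1]_(t in `]-oo, 0%R]) f t = (r^-1 - (- z * sin s - r * cos s) / (r ^+ 2 + (- z) ^+ 2))%:E)%E.
  rewrite -expcos_half//.
  transitivity (\int[leb1]_(t in `[0%R, +oo[) (expR (- (r * `|t|)) * (1 + cos (- z * t + s)))%:E)%E; last first.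
    by apply: eq_integral => t; rewrite inE/= in_itv/= andbT => t0; rewrite ger0_norm.
  rewrite ge0_integration_by_substitution0; first by apply: eq_integral => t _; rewrite /f normrN mulrNN.
    by apply/measurable_EFinP; exact: measurable_expcos.
  by move=> t; rewrite lee_fin mulr_ge0 ?expR_ge0// -lerBlDl sub0r cos_geN1.
have D0 : r ^+ 2 + z ^+ 2 != 0.
  by rewrite gt_eqF// ltr_wpDr ?sqr_ge0// exprn_gt0.
by rewrite -EFinD sqrrN; congr (_%:E); field; rewrite D0 gt_eqF.
Qed.

Lemma exp_full (r : R) : 0 < r ->
  (\int[leb1]_t (expR (- (r * `|t|)))%:E = (2 / r)%:E)%E.
Proof.
(* With z = 0 and s = pi/2 the cosine is identically 0. *)
move=> r0; have := expcos_full 0 (pi / 2) r0; rewrite cos_pihalf mulr0 mul0r addr0 => <-.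
by apply: eq_integral => t _; rewrite mul0r add0r cos_pihalf addr0 mulr1.
Qed.

Lemma exp_L1 (r : R) : 0 < r -> L1 leb1 (fun t => expR (- (r * `|t|))).
Proof.
move=> r0; apply: L1_lty.
  apply: measurableT_comp => //; apply: measurable_funN; exact: measurable_funM.
under eq_integral do rewrite ger0_norm ?expR_ge0//.
by rewrite exp_full// ltry.
Qed.

Lemma expcos_L1 (r z s : R) : 0 < r -> L1 leb1 (fun t => expR (- (r * `|t|)) * cos (z * t + s)).
Proof.
move=> r0; apply: (L1_eq (L1_mulb (M := 1) _ _ (exp_L1 r0))); last by move=> x; exact: mulrC.
  apply: measurableT_comp; first by apply: continuous_measurable_fun; exact: continuous_cos.
  by apply: measurable_funD => //; exact: measurable_funM.
by move=> x; exact: cos_max.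
Qed.

Lemma expcos_int (r z s : R) : 0 < r ->
  \int[leb1]_t (expR (- (r * `|t|)) * cos (z * t + s)) = 2 * r / (r ^+ 2 + z ^+ 2) * cos s.
Proof.
move=> r0.
have -> : \int[leb1]_t (expR (- (r * `|t|)) * cos (z * t + s)) =
  \int[leb1]_t (expR (- (r * `|t|)) * (1 + cos (z * t + s)) - expR (- (r * `|t|))).
  by apply: eq_Rintegral => t _; lra.
rewrite RintB; last 2 first.
- apply: (L1_eq (L1D (exp_L1 r0) (expcos_L1 z s r0))) => t; lra.
- exact: exp_L1.
by rewrite /Rintegral expcos_full// exp_full//=; lra.
Qed.

End OneDim.

(** * Tensor products and translations on R^n *)

Section LebN.
Variable R : realType.
Local Notation leb1 := (@lebesgue_measure R).

Lemma meas_prod d (X : measurableType d) I (s : seq I) (f : I -> X -> R) :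
  (forall i, measurable_fun setT (f i)) ->
  measurable_fun setT (fun x => \prod_(i <- s) f i x).
Proof.
move=> mf; elim: s => [|i s IH]; first by under eq_fun do rewrite big_nil; exact: measurable_cst.
by under eq_fun do rewrite big_cons; exact: measurable_funM.
Qed.

Lemma meas_sum d (X : measurableType d) I (s : seq I) (f : I -> X -> R) :
  (forall i, measurable_fun setT (f i)) ->
  measurable_fun setT (fun x => \sum_(i <- s) f i x).
Proof.
move=> mf; elim: s => [|i s IH]; first by under eq_fun do rewrite big_nil; exact: measurable_cst.
by under eq_fun do rewrite big_cons; exact: measurable_funD.
Qed.

Lemma meas_cos d (X : measurableType d) (f : X -> R) : measurable_fun setT f ->
  measurable_fun setT (fun x => cos (f x)).
Proof.
by move=> mf; apply: measurableT_comp => //; apply: continuous_measurable_fun; exact: continuous_cos.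
Qed.

Lemma meas_coord d (X : measurableType d) n (f : X -> Esp R n) i : measurable_fun setT f ->
  measurable_fun setT (fun x => (f x : 'rV[R]_n) 0 i).
Proof. by move=> mf; exact: (measurableT_comp (measurable_coord i) mf). Qed.

Lemma meas_sin d (X : measurableType d) (f : X -> R) : measurable_fun setT f ->
  measurable_fun setT (fun x => sin (f x)).
Proof.
by move=> mf; apply: measurableT_comp => //; apply: continuous_measurable_fun; exact: continuous_sin.
Qed.

Lemma meas_sub d (X : measurableType d) n (f g : X -> Esp R n) :
  measurable_fun setT f -> measurable_fun setT g ->
  measurable_fun setT (fun x => ((f x : 'rV[R]_n) - g x)%R : Esp R n).
Proof.
move=> mf mg; apply: measurable_to_Esp => i; under eq_fun do rewrite !mxE.
by apply: measurable_funB; exact: meas_coord.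
Qed.

Lemma meas_dotR d (X : measurableType d) n (f g : X -> Esp R n) :
  measurable_fun setT f -> measurable_fun setT g ->
  measurable_fun setT (fun x => dotR (f x) (g x)).
Proof.
by move=> mf mg; apply: meas_sum => i; apply: measurable_funM; exact: meas_coord.
Qed.

Lemma int_cons n (f : Esp R n.+1 -> R) : measurable_fun setT f ->
  L1 (prod_meas leb1 (leb R n)) (f \o @uconsR R n) ->
  (forall t, L1 (leb R n) (fun x => f (consR t x))) ->
  L1 (leb R n.+1) f /\
  \int[leb R n.+1]_x f x = \int[leb1]_t \int[leb R n]_x f (consR t x).
Proof.
move=> mf If Ift.
have If' : (prod_meas leb1 (leb R n)).-integrable (@uconsR R n @^-1` setT) ((EFin \o f) \o @uconsR R n).
  by rewrite preimage_setT.
split.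
  apply: (integrable_pushforward (@measurable_uconsR R n) _ If') => //.
  exact/measurable_EFinP.
have [_ <-] := Rfubini1 If Ift.
by rewrite {1}/Rintegral /= (integral_pushforward (@measurable_uconsR R n) _ If')// ?preimage_setT//; exact/measurable_EFinP.
Qed.

Lemma int_leb0 (f : Esp R 0 -> \bar R) : measurable_fun setT f ->
  (\int[leb R 0]_x f x = f 0%R)%E.
Proof. by move=> mf; rewrite /= integral_dirac// diracT mul1e. Qed.

Lemma prod_int n (F : 'I_n -> R -> R) (c : 'I_n -> R) :
  (forall i, measurable_fun setT (F i)) -> (forall i t, 0 <= F i t) ->
  (forall i, (\int[leb1]_t (F i t)%:E = (c i)%:E)%E) ->
  (\int[leb R n]_x (\prod_(i < n) F i ((x : 'rV[R]_n) 0 i))%:E = (\prod_(i < n) c i)%:E)%E.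
Proof.
elim: n F c => [|n IH] F c mF F0 Fc.
  rewrite int_leb0 ?big_ord0//; apply/measurable_EFinP.
  by under eq_fun do rewrite big_ord0; exact: measurable_cst.
have mp m (G : 'I_m -> R -> R) : (forall i, measurable_fun setT (G i)) ->
    measurable_fun setT (fun x : Esp R m => \prod_(i < m) G i ((x : 'rV[R]_m) 0 i)).
  move=> mG; apply: meas_prod => i; apply: measurableT_comp => //; exact: measurable_coord.
rewrite /= integral_cons_measure; last 2 first.
- by apply/measurable_EFinP; exact: mp.
- by move=> x; rewrite lee_fin prodr_ge0.
have c0 i : 0 <= c i by rewrite -lee_fin -Fc; apply: integral_ge0 => t _; rewrite lee_fin.
transitivity (\int[leb1]_t ((F ord0 t)%:E * (\prod_(i < n) c (lift ord0 i))%:E))%E; last first.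
  rewrite ge0_integralZr//.
  - by rewrite Fc -EFinM big_ord_recl.
  - by apply/measurable_EFinP; exact: mF.
  - by move=> t _; rewrite lee_fin.
  - by rewrite lee_fin prodr_ge0.
apply: eq_integral => t _.
rewrite -(IH (fun i => F (lift ord0 i)))// -ge0_integralZl//; last 3 first.
- by apply/measurable_EFinP; apply: (mp n (fun i => F (lift ord0 i))).
- by move=> x _; rewrite lee_fin prodr_ge0.
- by rewrite lee_fin.
apply: eq_integral => x _; rewrite big_ord_recl consR0 EFinM; congr (_ * (_)%:E)%E.
by apply: eq_bigr => i _; rewrite consRS.
Qed.

Lemma leb_box n (A : 'I_n -> set R) (c : 'I_n -> R) :
  (forall i, measurable (A i)) -> (forall i, leb1 (A i) = (c i)%:E) ->
  measurable ([set x : 'rV[R]_n | forall i, A i (x 0 i)] : set (Esp R n)) /\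
  leb R n [set x : 'rV[R]_n | forall i, A i (x 0 i)] = (\prod_(i < n) c i)%:E.
Proof.
move=> mA Ac; set B := [set x : 'rV_n | _].
have mB : measurable (B : set (Esp R n)).
  have -> : B = \bigcap_(i : 'I_n) ((fun x : 'rV[R]_n => x 0 i) @^-1` A i).
    by apply/seteqP; split => x /= H i; [move=> _; exact: H|exact: (H i Logic.I)].
  apply: fin_bigcap_measurable => // i _.
  rewrite -[X in measurable X]setTI; exact: (measurable_coord i measurableT (mA i)).
split => //.
rewrite -(prod_int (F := fun i => \1_(A i))); last 3 first.
- by move=> i; exact: measurable_indic.
- by [].
- move=> i; transitivity (leb1 (A i `&` setT)); first exact: (@integral_indic _ _ _ leb1 setT measurableT _ (mA i)).
  by rewrite setIT Ac.
transitivity (leb R n (B `&` setT)); first by rewrite setIT.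
rewrite -integral_indic//; apply: eq_integral => x _; congr (_%:E).
rewrite indicE; case: (boolP (x \in B)) => [/set_mem Bx|].
  by rewrite big1// => i _; rewrite indicE mem_set//; exact: Bx.
rewrite notin_setE => /existsNP[i Ai].
by apply/esym/eqP/prodf_eq0; exists i => //; rewrite indicE memNset.
Qed.

Definition rho n (r : R) (x : 'rV[R]_n) : R := \prod_(i < n) expR (- (r * `|x 0 i|)).

Lemma measurable_rho n r : measurable_fun setT (@rho n r : Esp R n -> R).
Proof.
apply: meas_prod => i; apply: measurableT_comp => //; apply: measurable_funN.
by apply: measurable_funM => //; apply: measurableT_comp => //; exact: measurable_coord.
Qed.

Lemma rho_ge0 n r (x : 'rV[R]_n) : 0 <= rho r x.
Proof. by apply: prodr_ge0 => i _; exact: expR_ge0. Qed.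

Lemma rho_int n (r : R) : 0 < r -> (\int[leb R n]_x (rho r x)%:E = ((2 / r) ^+ n)%:E)%E.
Proof.
move=> r0; rewrite (@prod_int n (fun _ t => expR (- (r * `|t|))) (fun=> 2 / r)).
- by rewrite prodr_const card_ord.
- by move=> i; exact: (L1_meas (exp_L1 r0)).
- by move=> i t; exact: expR_ge0.
- by move=> i; exact: exp_full.
Qed.

Lemma rho_L1 n r : 0 < r -> L1 (leb R n) (@rho n r).
Proof.
move=> r0; apply: L1_lty; first exact: measurable_rho.
under eq_integral do rewrite ger0_norm ?rho_ge0//.
by rewrite rho_int// ltry.
Qed.

Lemma rho_cons n r t (x : 'rV[R]_n) : rho r (consR t x) = expR (- (r * `|t|)) * rho r x.
Proof.
rewrite /rho big_ord_recl consR0; congr (_ * _).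
by apply: eq_bigr => i _; rewrite consRS.
Qed.

Lemma dotR_cons n t u (x y : 'rV[R]_n) : dotR (consR t x) (consR u y) = t * u + dotR x y.
Proof.
rewrite /dotR big_ord_recl !consR0; congr (_ + _).
by apply: eq_bigr => i _; rewrite !consRS.
Qed.

(** The free phase [s] closes the induction on the dimension: for a fixed first coordinate t, its
    contribution z_0 t is absorbed in the phase of the integral over the other coordinates. *)
Lemma rho_cos n r (z : 'rV[R]_n) s : 0 < r ->
  \int[leb R n]_x (rho r x * cos (dotR z x + s)) =
  (\prod_(i < n) (2 * r / (r ^+ 2 + z 0 i ^+ 2))) * cos s.
Proof.
move=> r0; elim: n z s => [|n IH] z s.
  rewrite /Rintegral int_leb0 /=; first by rewrite /rho /dotR !big_ord0 add0r.
  apply/measurable_EFinP; apply: measurable_funM; first exact: measurable_rho.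
  by apply: meas_cos; apply: measurable_funD => //; exact: meas_dotR.
have mcos m (w : 'rV[R]_m) (a : R) : measurable_fun setT (fun x : Esp R m => cos (dotR w x + a)).
  by apply: meas_cos; apply: measurable_funD => //; exact: meas_dotR.
have Irc m (w : 'rV[R]_m) (a : R) : L1 (leb R m) (fun x => rho r x * cos (dotR w x + a)).
  apply: (L1_eq (L1_mulb (M := 1) _ _ (rho_L1 m r0))); last by move=> x; exact: mulrC.
    exact: mcos.
  by move=> x; exact: cos_max.
have [_ ->] : L1 (leb R n.+1) (fun x => rho r x * cos (dotR z x + s)) /\
  \int[leb R n.+1]_x (rho r x * cos (dotR z x + s)) =
   \int[leb1]_t \int[leb R n]_x (rho r (consR t x) * cos (dotR z (consR t x) + s)).
  apply: (@int_cons n (fun x => rho r x * cos (dotR z x + s))).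
  - by apply: measurable_funM; [exact: measurable_rho|exact: mcos].
  - apply: (L1_dom _ (L1_tensor (exp_L1 r0) (rho_L1 n r0))).
      apply: measurableT_comp; last exact: measurable_uconsR.
      by apply: measurable_funM; [exact: measurable_rho|exact: mcos].
    move=> [t x] /=; rewrite /uconsR rho_cons normrM ger0_norm ?mulr_ge0 ?expR_ge0 ?rho_ge0//.
    by rewrite ler_piMr ?mulr_ge0 ?expR_ge0 ?rho_ge0 ?cos_max.
  - move=> t; rewrite (consR_surj z).
    apply: (L1_eq (L1Z (expR (- (r * `|t|))) (Irc n (\row_i z 0 (lift ord0 i)) (z 0 ord0 * t + s)))) => x.
    by rewrite rho_cons dotR_cons -mulrA -[in RHS]addrA [in RHS]addrCA.
rewrite (consR_surj z); set z0 := z 0 ord0; set z' := \row_i _.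
transitivity (\int[leb1]_t ((\prod_(i < n) (2 * r / (r ^+ 2 + z' 0 i ^+ 2))) * (expR (- (r * `|t|)) * cos (z0 * t + s)))).
  apply: eq_Rintegral => t _; rewrite mulrCA -IH -RintZ//.
  by apply: eq_Rintegral => x _; rewrite rho_cons dotR_cons -mulrA -addrA addrCA.
rewrite RintZ; last exact: expcos_L1.
rewrite expcos_int// big_ord_recl consR0 mulrCA mulrA; congr (_ * _ * _).
by apply: eq_bigr => i _; rewrite consRS.
Qed.

(** The translated measure agrees with Lebesgue measure on half-open intervals, which determine
    it. *)
Lemma leb1_shift (h : R) (f : R -> \bar R) : measurable_fun setT f -> (forall t, 0 <= f t)%E ->
  (\int[leb1]_t f (t + h)%R = \int[leb1]_t f t)%E.
Proof.
move=> mf f0.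
have ms : measurable_fun setT (fun t : R => t + h : measurableTypeR R) by apply: measurable_funD.
transitivity (\int[pushforward leb1 (fun t : R => (t + h)%R : measurableTypeR R)]_t f t)%E.
  by rewrite ge0_integral_pushforward// preimage_setT.
apply: eq_measure_integral => A mA _.
have H := @lebesgue_measure_unique R
  (measure_function_pushforward__canonical__measure_function_Measure leb1 ms).
apply/esym; apply: H => // _ [[a b]] _ <-; rewrite /= /pushforward.
have -> : (fun t : R => t + h : measurableTypeR R) @^-1` `]a, b]%classic = `]a - h, b - h]%classic.
  by apply/seteqP; split => t /=; rewrite !in_itv/= ltrBlDr lerBrDr.
rewrite !lebesgue_measure_itv/= !lte_fin ltrD2r; case: ifP => // _.
by rewrite -!EFinB; congr (_%:E); lra.
Qed.

Lemma leb_shift n (h : 'rV[R]_n) (f : Esp R n -> \bar R) : measurable_fun setT f ->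
  (forall t, 0 <= f t)%E ->
  (\int[leb R n]_x f (x + h)%R = \int[leb R n]_x f x)%E.
Proof.
elim: n h f => [|n IH] h f mf f0.
  by apply: eq_integral => x _; congr f; apply/rowP => -[].
have ms m (w : 'rV[R]_m) : measurable_fun setT (fun x : Esp R m => ((x : 'rV[R]_m) + w)%R : Esp R m).
  apply: measurable_to_Esp => i; under eq_fun do rewrite mxE.
  by apply: measurable_funD => //; exact: measurable_coord.
rewrite /= !integral_cons_measure//; last by apply: measurableT_comp mf _; exact: ms.
pose G (t : R) := (\int[leb R n]_x f (consR t x))%E.
transitivity (\int[leb1]_t G (t + h 0 ord0)%R)%E; last first.
  rewrite leb1_shift//; last by move=> t; exact: integral_ge0.
  have := @measurable_fun_fubini_tonelli_F _ _ _ _ R (leb R n) (f \o @uconsR R n).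
  apply; last by move=> x; exact: f0.
  exact: (measurableT_comp mf (@measurable_uconsR R n)).
apply: eq_integral => t _; rewrite /G -(IH (\row_i h 0 (lift ord0 i)) (fun x => f (consR (t + h 0%R ord0)%R x))) => [|//|//]; last first.
  by apply: (measurableT_comp mf); exact: measurable_consR.
apply: eq_integral => x _; congr f.
rewrite {1}(consR_surj h); apply/rowP => i; rewrite mxE.
by case: (unliftP ord0 i) => [j ->|->]; rewrite ?consRS ?consR0// !mxE.
Qed.

Lemma measurable_shift n (h : 'rV[R]_n) d (V : measurableType d) (f : Esp R n -> V) :
  measurable_fun setT f -> measurable_fun setT (fun x : Esp R n => f ((x : 'rV[R]_n) + h)).
Proof.
move=> mf; apply: measurableT_comp mf _; apply: measurable_to_Esp => i.
under eq_fun do rewrite mxE.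
by apply: measurable_funD => //; exact: measurable_coord.
Qed.

Lemma L1_shift n (h : 'rV[R]_n) (f : Esp R n -> R) : L1 (leb R n) f ->
  L1 (leb R n) (fun x => f ((x : 'rV[R]_n) + h)).
Proof.
move=> If; apply: L1_lty; first exact: (measurable_shift h (L1_meas If)).
rewrite (leb_shift h (f := fun x => `|f x|%:E)) => [||x]; rewrite ?lee_fin//.
  exact: L1_fin.
by apply/measurable_EFinP; exact: (L1_meas (L1_norm If)).
Qed.

Lemma int_shift n (h : 'rV[R]_n) (f : Esp R n -> R) : measurable_fun setT f ->
  \int[leb R n]_x f (x + h) = \int[leb R n]_x f x.
Proof.
move=> mf; rewrite /Rintegral; congr fine; rewrite integralE [in RHS]integralE.
rewrite -(leb_shift h (f := (fun x => (f x)%:E)^\+%E))//; last first.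
  by apply: measurable_funepos; exact/measurable_EFinP.
rewrite -(leb_shift h (f := (fun x => (f x)%:E)^\-%E))//.
  by congr (_ - _)%E; apply: eq_integral => x _; rewrite ?funeposE ?funenegE.
by apply: measurable_funeneg; exact/measurable_EFinP.
Qed.

End LebN.

(** * Fourier bounds on dyadic annuli *)

Section Swap.
Context d1 d2 (X : measurableType d1) (P : measurableType d2) (R : realType).
Variables (mx : {sigma_finite_measure set X -> \bar R})
  (mp : {sigma_finite_measure set P -> \bar R}).
Variables (g : X -> R) (f : P -> R) (c : X * P -> R).
Hypotheses (Ig : L1 mx g) (If : L1 mp f) (mc : measurable_fun setT c)
  (c1 : forall z, `|c z| <= 1).

Lemma L1_kerx x : L1 mp (fun p => f p * c (x, p)).
Proof.
apply: (L1_eq (L1_mulb (M := 1) _ _ If)); last by move=> p; exact: mulrC.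
  exact: (measurableT_comp mc (measurable_pair1 x)).
by move=> p; exact: c1.
Qed.

Lemma L1_kerp p : L1 mx (fun x => g x * c (x, p)).
Proof.
apply: (L1_eq (L1_mulb (M := 1) _ _ Ig)); last by move=> x; exact: mulrC.
  exact: (measurableT_comp mc (measurable_pair2 p)).
by move=> x; exact: c1.
Qed.

Lemma L1_ker : L1 (prod_meas mx mp) (fun z => g z.1 * f z.2 * c z).
Proof.
apply: (L1_eq (L1_mulb (M := 1) mc c1 (L1_tensor Ig If))) => z.
by rewrite mulrC.
Qed.

Lemma measurable_kerx : measurable_fun setT (fun x => \int[mp]_p (f p * c (x, p))).
Proof.
apply: (measurable_Rint (f := fun z => f z.2 * c z)); last exact: L1_kerx.
apply: measurable_funM => //.
exact: (measurableT_comp (L1_meas If) measurable_snd).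
Qed.

(** Fubini with a bounded kernel, dominated by the tensor product of [g] and [f]. This is the form
    in which Parseval's identity is used, for the energy and for the pairing with [vk]. *)
Lemma swap_int : [/\ L1 mx (fun x => g x * \int[mp]_p (f p * c (x, p))),
  L1 mp (fun p => f p * \int[mx]_x (g x * c (x, p))) &
  \int[mx]_x (g x * \int[mp]_p (f p * c (x, p))) =
  \int[mp]_p (f p * \int[mx]_x (g x * c (x, p)))].
Proof.
have E1 x : \int[mp]_p (g x * f p * c (x, p)) = g x * \int[mp]_p (f p * c (x, p)).
  rewrite -RintZ; last exact: L1_kerx.
  by apply: eq_Rintegral => p _; rewrite mulrA.
have E2 p : \int[mx]_x (g x * f p * c (x, p)) = f p * \int[mx]_x (g x * c (x, p)).
  rewrite -RintZ; last exact: L1_kerp.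
  by apply: eq_Rintegral => x _; rewrite mulrA (mulrC (f p)).
have [I1 D1] := Rfubini1 L1_ker (fun x => L1_eq (L1Z (g x) (L1_kerx x)) (fun p => mulrA _ _ _)).
have [|I2 D2] := Rfubini2 L1_ker _.
  move=> p; apply: (L1_eq (L1Z (f p) (L1_kerp p))) => x /=.
  by rewrite mulrA (mulrC (f p)).
split; first exact: (L1_eq I1).
  exact: (L1_eq I2).
transitivity (\int[mx]_x \int[mp]_p (g x * f p * c (x, p))).
  by apply: eq_Rintegral => x _; rewrite E1.
rewrite -[LHS]D1 D2; apply: eq_Rintegral => p _; exact: E2.
Qed.

End Swap.

Section Energy.
Variables (R : realType) (n : nat).
Local Notation E := (Esp R n).
Local Notation mu := (leb R n).
Implicit Types (psi : E -> R).

(* [kappa r] is the Fourier transform of [rho r], see [rho_cos]. *)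
Definition kappa (r : R) (z : 'rV[R]_n) : R := \prod_(i < n) (2 * r / (r ^+ 2 + z 0 i ^+ 2)).

(* The phase [s] covers both the cosine ([s = 0]) and the sine transform ([s = - (pi / 2)]). *)
Definition Fc psi (s : R) (xi : 'rV[R]_n) : R := \int[mu]_x (psi x * cos (dotR x xi + s)).

Definition energy psi xi : R := Fc psi 0 xi ^+ 2 + Fc psi (- (pi / 2)) xi ^+ 2.

Lemma meas_phase (s : R) : measurable_fun setT (fun z : E * E => cos (dotR z.1 z.2 + s)).
Proof. by apply: meas_cos; apply: measurable_funD => //; exact: meas_dotR. Qed.

Lemma cosBpihalf (t : R) : cos (t - pi / 2) = sin t.
Proof. by rewrite cosB cos_pihalf sin_pihalf mulr0 mulr1 add0r. Qed.

Lemma L1_cosx psi s (xi : 'rV[R]_n) : L1 mu psi -> L1 mu (fun x => psi x * cos (dotR x xi + s)).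
Proof.
move=> Ip; exact: (L1_kerp (c := fun z : E * E => cos (dotR z.1 z.2 + s)) Ip (meas_phase s) (fun z => cos_max _)).
Qed.

Lemma FcE psi s xi : L1 mu psi ->
  Fc psi s xi = cos s * Fc psi 0 xi - sin s * Fc psi (- (pi / 2)) xi.
Proof.
move=> Ip; rewrite /Fc -!RintZ; [|exact: L1_cosx|exact: L1_cosx].
rewrite -RintB; [|exact: L1Z (L1_cosx _ _ Ip)|exact: L1Z (L1_cosx _ _ Ip)].
by apply: eq_Rintegral => x _; rewrite addr0 cosBpihalf cosD; ring.
Qed.

(** [energy] is the squared modulus of the Fourier transform, and [Fc psi s] is the real part of the
    transform rotated by [s]; the two sides differ by the square of the imaginary part. *)
Lemma Fc_energy psi s xi : L1 mu psi -> Fc psi s xi ^+ 2 <= energy psi xi.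
Proof.
move=> Ip; rewrite (FcE s xi Ip) /energy; set a := Fc psi 0 xi; set b := Fc psi _ xi.
have := cos2Dsin2 s; set u := cos s; set v := sin s => uv.
rewrite -subr_ge0 (_ : _ - _ = (u * b + v * a) ^+ 2) ?sqr_ge0//.
rewrite -[X in X + _ - _]mul1r -[X in _ * _ + X - _]mul1r -uv; ring.
Qed.

Lemma measurable_Fc psi s : L1 mu psi -> measurable_fun setT (Fc psi s : E -> R).
Proof.
move=> Ip; have := @measurable_kerx _ _ E E R mu psi
  (fun z : E * E => cos (dotR z.2 z.1 + s)) Ip.
apply; last by move=> z; exact: cos_max.
by apply: meas_cos; apply: measurable_funD => //; exact: meas_dotR.
Qed.

Lemma Fc_bound psi s xi : L1 mu psi -> `|Fc psi s xi| <= \int[mu]_x `|psi x|.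
Proof.
move=> Ip; apply: Rint_norm_le; [exact: L1_cosx|exact: L1_norm|move=> x].
by rewrite normrM ler_piMr// cos_max.
Qed.

(** The addition formula turns the square into a double integral with the cosine of (x - y).xi. The
    summand 0 keeps the slot for the phase in [rho_cos]. *)
Lemma energyE psi xi : L1 mu psi ->
  energy psi xi = \int[prod_meas mu mu]_p (psi p.1 * psi p.2 * cos (dotR (p.1 - p.2 : 'rV[R]_n) xi + 0)).
Proof.
move=> Ip.
have mcp : measurable_fun setT (fun p : E * E => cos (dotR ((p.1 : 'rV[R]_n) - (p.2 : 'rV[R]_n)) xi + 0)).
  by apply: meas_cos; apply: measurable_funD => //; apply: meas_dotR => //; exact: meas_sub.
have [] := @swap_int _ _ E E R mu mu psi psi
  (fun p : E * E => cos (dotR ((p.1 : 'rV[R]_n) - (p.2 : 'rV[R]_n)) xi + 0)) Ip Ip mcp (fun z => cos_max _).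
move=> I1 _ _.
have [_ ->] := @Rfubini1 _ _ E E R mu mu _ (L1_ker Ip Ip mcp (fun z => cos_max _))
  (fun x => L1_eq (L1Z (psi x) (L1_kerx Ip mcp (fun z => cos_max _) x)) (fun p => mulrA _ _ _)).
rewrite /energy !expr2 /Fc.
transitivity (\int[mu]_x (psi x * (cos (dotR x xi + 0) * Fc psi 0 xi + sin (dotR x xi) * Fc psi (- (pi / 2)) xi))); last first.
  apply: eq_Rintegral => x _.
  have -> : \int[mu]_y (psi (x, y).1 * psi (x, y).2 * cos (dotR ((x, y).1 - (x, y).2) xi + 0)) =
     psi x * \int[mu]_y (psi y * (cos (dotR x xi + 0) * cos (dotR y xi + 0) + sin (dotR x xi) * cos (dotR y xi - pi / 2))).
    rewrite -RintZ.
      apply: eq_Rintegral => y _ /=; rewrite -mulrA; congr (_ * (_ * _)).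
      rewrite !addr0 cosBpihalf -cosB; congr cos.
      rewrite /dotR -sumrB; apply: eq_bigr => i _; rewrite !mxE; ring.
    apply: (L1_eq (L1D (L1Z (cos (dotR x xi + 0)) (L1_cosx 0 xi Ip))
       (L1Z (sin (dotR x xi)) (L1_cosx (- (pi / 2)) xi Ip)))) => y; ring.
  rewrite /Fc -(RintZ (cos _) (L1_cosx 0 xi Ip)) -(RintZ (sin _) (L1_cosx (- (pi / 2)) xi Ip)) -RintD.
    by congr (_ * _); apply: eq_Rintegral => y _; ring.
  exact: L1Z (L1_cosx 0 xi Ip).
  exact: L1Z (L1_cosx _ xi Ip).
have -> : \int[mu]_x (psi x * (cos (dotR x xi + 0) * Fc psi 0 xi + sin (dotR x xi) * Fc psi (- (pi / 2)) xi)) =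
  \int[mu]_x (Fc psi 0 xi * (psi x * cos (dotR x xi + 0)) + Fc psi (- (pi / 2)) xi * (psi x * cos (dotR x xi - pi / 2))).
  by apply: eq_Rintegral => x _; rewrite cosBpihalf; ring.
rewrite RintD ?RintZ//; try exact: L1_cosx.
  exact: L1Z (L1_cosx 0 xi Ip).
exact: L1Z (L1_cosx _ xi Ip).
Qed.

Lemma kappa_ge0 r z : 0 < r -> 0 <= kappa r z.
Proof.
move=> r0; apply: prodr_ge0 => i _; apply: divr_ge0; first by rewrite mulr_ge0// ltW.
by rewrite addr_ge0 ?sqr_ge0.
Qed.

Lemma kappa_le r z : 0 < r -> kappa r z <= (2 / r) ^+ n.
Proof.
move=> r0; have -> : (2 / r) ^+ n = \prod_(i < n) (2 / r) by rewrite prodr_const card_ord.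
apply: ler_prod => i _.
have D : 0 < r ^+ 2 + z 0 i ^+ 2 by rewrite ltr_wpDr ?sqr_ge0// exprn_gt0.
apply/andP; split; first by rewrite divr_ge0 ?mulr_ge0 ?(ltW r0) ?(ltW D).
rewrite ler_pdivrMr// mulrAC ler_pdivlMr// -mulrA -expr2 ler_pM2l// lerDl sqr_ge0//.
Qed.

Lemma meas_kappa r d (X : measurableType d) (f : X -> E) : 0 < r -> measurable_fun setT f ->
  measurable_fun setT (fun x => kappa r (f x : 'rV[R]_n)).
Proof.
move=> r0 mf; apply: meas_prod => i.
have mg : measurable_fun setT (fun t : R => 2 * r / (r ^+ 2 + t ^+ 2)).
  apply: continuous_measurable_fun => t; apply: cvgM; first exact: cvg_cst.
  apply: cvgV; first by rewrite gt_eqF// ltr_wpDr ?sqr_ge0// exprn_gt0.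
  by apply: cvgD; [exact: cvg_cst|exact: exprn_continuous].
exact: (measurableT_comp mg (meas_coord i mf)).
Qed.

(** Integrating in xi first leaves the kernel [kappa r (x - y)]. Because it is nonnegative, [psi]
    may be replaced by its absolute value, and a bound on the rows suffices, as in Schur's test.
    Rows with psi x = 0 contribute nothing, which is why the row bound is asked only on the support
    of [psi]. *)
Lemma energy_int psi r D : 0 < r -> L1 mu psi ->
  (forall x, psi x != 0 -> \int[mu]_y (`|psi y| * kappa r (x - y)) <= D) ->
  L1 mu (fun xi => rho r xi * energy psi xi) /\
  \int[mu]_xi (rho r xi * energy psi xi) <= D * \int[mu]_x `|psi x|.
Proof.
move=> r0 Ip HD.
have mcp : measurable_fun setT (fun q : E * (E * E) => cos (dotR ((q.2.1 : 'rV[R]_n) - (q.2.2 : 'rV[R]_n)) q.1 + 0)).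
  apply: meas_cos; apply: measurable_funD => //; apply: meas_dotR => //.
  by apply: meas_sub; exact: measurableT_comp.
have [I1 I2 ES] := @swap_int _ _ E (E * E)%type R mu (prod_meas mu mu) (@rho R n r) (fun p => psi p.1 * psi p.2)
  (fun q : E * (E * E) => cos (dotR ((q.2.1 : 'rV[R]_n) - (q.2.2 : 'rV[R]_n)) q.1 + 0))
  (rho_L1 n r0) (L1_tensor Ip Ip) mcp (fun z => cos_max _).
have mk : measurable_fun setT (fun p : E * E => kappa r ((p.1 : 'rV[R]_n) - p.2)).
  by apply: (@meas_kappa r _ _ (fun p : E * E => ((p.1 : 'rV[R]_n) - p.2) : E)) => //; exact: meas_sub.
split.
  by apply: (L1_eq I1) => xi; rewrite energyE.
have -> : \int[mu]_xi (rho r xi * energy psi xi) = \int[mu]_xi (rho r xi *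
    \int[prod_meas mu mu]_p (psi p.1 * psi p.2 * cos (dotR (p.1 - p.2 : 'rV[R]_n) xi + 0))).
  by apply: eq_Rintegral => xi _; rewrite energyE.
rewrite [leLHS]ES.
have kb (p : E * E) : `|kappa r ((p.1 : 'rV[R]_n) - p.2)| <= (2 / r) ^+ n.
  by rewrite ger0_norm ?kappa_ge0// kappa_le.
have Iap : L1 (prod_meas mu mu) (fun p => kappa r ((p.1 : 'rV[R]_n) - p.2) * (`|psi p.1| * `|psi p.2|)).
  by apply: (L1_mulb (M := (2 / r) ^+ n)) => //; exact: (L1_tensor (L1_norm Ip) (L1_norm Ip)).
apply: (@le_trans _ _ (\int[prod_meas mu mu]_p (kappa r ((p.1 : 'rV[R]_n) - p.2) * (`|psi p.1| * `|psi p.2|)))).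
  apply: Rint_le => //.
  move=> p /=; rewrite rho_cos// cos0 mulr1 -/(kappa r (p.1 - p.2)) mulrC.
  by rewrite ler_wpM2l ?kappa_ge0// -normrM ler_norm.
have Ixp (x : E) : L1 mu (fun y => `|psi y| * kappa r ((x : 'rV[R]_n) - y)).
  apply: (L1_eq (L1_mulb (M := (2 / r) ^+ n) (h := fun y : E => kappa r ((x : 'rV[R]_n) - (y : 'rV[R]_n))) _ _ (L1_norm Ip))).
  - exact: (measurableT_comp mk (measurable_pair1 x)).
  - by move=> y; exact: (kb (x, y)).
  - by move=> y; rewrite mulrC.
have Ixy x : L1 mu (fun y => kappa r ((x : 'rV[R]_n) - y) * (`|psi x| * `|psi y|)).
  by apply: (L1_eq (L1Z `|psi x| (Ixp x))) => y; rewrite mulrA mulrC.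
have [I3 ->] := Rfubini1 Iap Ixy.
rewrite -RintZ; last exact: L1_norm.
apply: Rint_le => //; first exact: (L1Z _ (L1_norm Ip)).
move=> x /=.
have -> : \int[mu]_y (kappa r ((x : 'rV[R]_n) - y) * (`|psi x| * `|psi y|)) =
    `|psi x| * \int[mu]_y (`|psi y| * kappa r ((x : 'rV[R]_n) - y)).
  by rewrite -RintZ//; apply: eq_Rintegral => y _; rewrite mulrC mulrA.
have [->|px] := eqVneq (psi x) 0; first by rewrite normr0 mul0r mulr0.
by rewrite mulrC ler_wpM2r// HD.
Qed.

Definition inb (t : R) (z : 'rV[R]_n) : bool := [forall i, `|z 0 i| <= t].

Lemma meas_inb t d (X : measurableType d) (f : X -> E) : measurable_fun setT f ->
  measurable_fun setT (fun y => (inb t (f y : 'rV[R]_n))%:R : R).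
Proof.
move=> mf.
have -> : (fun y => (inb t (f y : 'rV[R]_n))%:R : R) =
    \1_(\bigcap_(i : 'I_n) [set y | `|(f y : 'rV[R]_n) 0 i| <= t]).
  apply/funext => y; rewrite indicE; congr (_%:R); congr nat_of_bool.
  apply/idP/idP => [/forallP H|/set_mem H]; first by apply/mem_set => i _; exact: H.
  by apply/forallP => i; exact: (H i Logic.I).
apply: measurable_indic; apply: fin_bigcap_measurable => // i _.
rewrite -[X in measurable X]setTI.
apply: (measurable_fun_le (f := fun y => `|(f y : 'rV[R]_n) 0 i|) (g := cst t)) => //.
by apply: measurableT_comp => //; exact: meas_coord.
Qed.

Lemma normr_inb t z : `|(inb t z)%:R : R| <= 1.
Proof. by case: inb; rewrite ?normr1 ?normr0. Qed.

Lemma meas_inbB t (x : 'rV[R]_n) :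
  measurable_fun setT (fun y : E => (inb t (x - (y : 'rV[R]_n)))%:R : R).
Proof. by apply: meas_inb; exact: meas_sub. Qed.

Lemma L1_inb (psi : E -> R) t (x : 'rV[R]_n) : L1 mu psi ->
  L1 mu (fun y : E => psi y * (inb t (x - (y : 'rV[R]_n)))%:R).
Proof.
move=> Ip; apply: (L1_eq (L1_mulb (meas_inbB t x) (fun y => normr_inb _ _) Ip)) => y.
exact: mulrC.
Qed.

(** The factor of the large coordinate gains (r/t)^2 over its maximum 2/r and the other factors stay
    below 2/r; decay in a single coordinate is enough for the dyadic layers. *)
Lemma kappa_far r t (z : 'rV[R]_n) i : 0 < r -> 0 < t -> t < `|z 0 i| ->
  kappa r z <= (2 / r) ^+ n * (r / t) ^+ 2.
Proof.
move=> r0 t0 tz; have -> : (2 / r) ^+ n = \prod_(i < n) (2 / r) by rewrite prodr_const card_ord.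
have r2 : 0 <= 2 / r by rewrite divr_ge0// ltW.
have D j : 0 < r ^+ 2 + z 0 j ^+ 2 by rewrite ltr_wpDr ?sqr_ge0// exprn_gt0.
rewrite /kappa (bigD1 i)//= [in leRHS](bigD1 i)//= [leRHS]mulrAC; apply: ler_pM.
- by rewrite divr_ge0 ?mulr_ge0 ?(ltW r0) ?(ltW (D _)).
- by apply: prodr_ge0 => j _; rewrite divr_ge0 ?mulr_ge0 ?(ltW r0) ?(ltW (D _)).
- have tz2 : t ^+ 2 <= z 0 i ^+ 2 by rewrite -(real_normK (num_real (z 0 i))) ler_sqr ?nnegrE ?(ltW t0)// ltW.
  have -> : 2 / r * (r / t) ^+ 2 = 2 * r / t ^+ 2 by field; rewrite !gt_eqF.
  rewrite ler_wpM2l ?mulr_ge0 ?(ltW r0)// lef_pV2 ?posrE ?exprn_gt0//.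
  by rewrite (le_trans tz2)// lerDr sqr_ge0.
- apply: ler_prod => j _; apply/andP; split; first by rewrite divr_ge0 ?mulr_ge0 ?(ltW r0) ?(ltW (D _)).
  rewrite ler_pdivrMr// mulrAC ler_pdivlMr// -mulrA -expr2 ler_pM2l// lerDl sqr_ge0//.
Qed.

(** If the cube of radius 2^-k contains z, the layer l = k suffices. Otherwise let l be the first
    index whose cube misses z. For l = 0 the last summand 4^-k covers z; for l > 0 the cube of
    radius 2^-(l-1) still contains z, and the factor 4 pays for using the layer l - 1 in place of
    l. *)
Lemma kappa_layers k (z : 'rV[R]_n) : kappa (2 ^- k) z <=
  (2 * 2 ^+ k) ^+ n * (\sum_(l < k.+1) 4 * (4^-1) ^+ (k - l) * (inb (2 ^- l) z)%:R + (4^-1) ^+ k).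
Proof.
have r0 m : 0 < 2 ^- m :> R by rewrite invr_gt0 exprn_gt0.
have E2 : (2 * 2 ^+ k) = 2 / 2 ^- k :> R by rewrite invrK.
have S0 : 0 <= \sum_(l < k.+1) 4 * (4^-1) ^+ (k - l) * (inb (2 ^- l) z)%:R :> R.
  by apply: sumr_ge0 => l _; rewrite !mulr_ge0 ?exprn_ge0 ?invr_ge0.
have q0 : 0 <= (4^-1) ^+ k :> R by rewrite exprn_ge0 ?invr_ge0.
have C0 : 0 <= (2 * 2 ^+ k) ^+ n :> R by rewrite exprn_ge0// mulr_ge0 ?exprn_ge0.
have term (l : nat) : (l <= k)%N -> inb (2 ^- l) z -> 4 * (4^-1) ^+ (k - l) <=
   \sum_(l < k.+1) 4 * (4^-1) ^+ (k - l) * (inb (2 ^- l) z)%:R + (4^-1) ^+ k :> R.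
  move=> lk zl; rewrite (bigD1 (Ordinal (lk : (l < k.+1)%N)))//= zl mulr1 -addrA lerDl addr_ge0//.
  by apply: sumr_ge0 => l' _; rewrite !mulr_ge0 ?exprn_ge0 ?invr_ge0.
have [zk|zk] := boolP (inb (2 ^- k) z).
  apply: (le_trans (kappa_le z (r0 k))); rewrite -E2 ler_peMr//.
  by apply: le_trans (term k (leqnn k) zk); rewrite subnn expr0 mulr1; lra.
have ex : exists l, ~~ inb (2 ^- l) z by exists k.
have [l zl lmin] := ex_minnP ex.
have lk : (l <= k)%N by exact: lmin.
have [i zi] : exists i, 2 ^- l < `|z 0 i|.
  by move: zl; rewrite negb_forall => /existsP[i]; rewrite -ltNge; exists i.
apply: (le_trans (kappa_far (r0 k) (r0 l) zi)); rewrite -E2 ler_wpM2l//.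
have -> : (2 ^- k / 2 ^- l) ^+ 2 = (4^-1) ^+ (k - l) :> R.
  rewrite -[in LHS](subnK lk) exprD invfM invrK -mulrA mulVf ?expf_neq0// mulr1.
  by rewrite -exprVn -exprM mulnC exprM; congr (_ ^+ _); rewrite exprVn; congr (_^-1); ring.
case: l zl lmin lk zi => [|l] zl lmin lk zi; first by rewrite subn0 lerDr.
have zl' : inb (2 ^- l) z.
  by apply: contraT => /lmin; rewrite ltnn.
apply: le_trans (term l (ltnW lk) zl').
rewrite -(subnSK lk) exprS.
by rewrite mulrA divff// mul1r.
Qed.

Lemma sum_half k : \sum_(l < k.+1) (2^-1 : R) ^+ (k - l) <= 2.
Proof.
suff -> : \sum_(l < k.+1) (2^-1 : R) ^+ (k - l) = 2 - 2^-1 ^+ k.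
  by rewrite gerBl exprn_ge0// invr_ge0.
elim: k => [|k IH]; first by rewrite big_ord1 subnn expr0; lra.
rewrite big_ord_recr/= subnn expr0.
rewrite (eq_bigr (fun l : 'I_k.+1 => 2^-1 * 2^-1 ^+ (k - l))); last first.
  by move=> l _; rewrite subSn ?exprS// -ltnS.
rewrite -mulr_sumr IH exprS; lra.
Qed.

(** As th >= 1/2, 1/4 is at most th/2, and layer l contributes at most 4 th^k 2^-(k-l) B. The layers
    sum up to 8 th^k B and the last summand of [kappa_layers] adds th^k B, whence the 9. *)
Lemma kappa_int psi th B k (x : 'rV[R]_n) : L1 mu psi -> 2^-1 <= th ->
  \int[mu]_y `|psi y| <= B ->
  (forall l, \int[mu]_y (`|psi y| * (inb (2 ^- l) (x - y))%:R) <= th ^+ l * B) ->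
  \int[mu]_y (`|psi y| * kappa (2 ^- k) (x - y)) <= 9 * (2 * 2 ^+ k) ^+ n * th ^+ k * B.
Proof.
move=> Ip th2 pB gr.
have th0 : 0 < th by apply: lt_le_trans th2; rewrite invr_gt0.
have B0 : 0 <= B by apply: le_trans pB; apply: Rint_ge0.
have r0 : 0 < 2 ^- k :> R by rewrite invr_gt0 exprn_gt0.
have I1 : L1 mu (fun y => `|psi y| * kappa (2 ^- k) (x - y)).
  apply: (L1_eq (L1_mulb (M := (2 / 2 ^- k) ^+ n) (h := fun y : E => kappa (2 ^- k) (x - (y : 'rV[R]_n))) _ _ (L1_norm Ip))).
  - by apply: meas_kappa => //; exact: meas_sub.
  - by move=> y; rewrite ger0_norm ?kappa_ge0// kappa_le.
  - by move=> y; rewrite mulrC.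
have I2 l := L1_inb (2 ^- l) x (L1_norm Ip).
pose F (y : E) := (2 * 2 ^+ k) ^+ n * (\sum_(l < k.+1) 4 * (4^-1) ^+ (k - l) * (`|psi y| * (inb (2 ^- l) (x - (y : 'rV[R]_n)))%:R) + (4^-1) ^+ k * `|psi y|).
have I3 : L1 mu (fun y => \sum_(l < k.+1) 4 * (4^-1) ^+ (k - l) * (`|psi y| * (inb (2 ^- l) (x - (y : 'rV[R]_n)))%:R)).
  by apply: L1_sum => l; exact: L1Z.
have I4 : L1 mu (fun y => (4^-1) ^+ k * `|psi y|) by apply: L1Z; exact: L1_norm.
have IF : L1 mu F by apply: L1Z; exact: L1D.
apply: (@le_trans _ _ (\int[mu]_y F y)).
  apply: Rint_le => // y; rewrite /F mulrC.
  apply: (le_trans (ler_wpM2r (normr_ge0 _) (kappa_layers k (x - y)))).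
  rewrite -mulrA ler_wpM2l ?exprn_ge0 ?mulr_ge0 ?exprn_ge0// mulrDl lerD2r mulr_suml.
  by apply: ler_sum => l _; rewrite [in leRHS](mulrC `|psi y|) mulrA.
rewrite /F RintZ ?RintD//; last exact: L1D.
rewrite RintZ; last exact: L1_norm.
rewrite Rint_sum; last by move=> l; exact: L1Z.
rewrite [leRHS](_ : _ = (2 * 2 ^+ k) ^+ n * (9 * th ^+ k * B)); last by ring.
rewrite ler_wpM2l ?exprn_ge0 ?mulr_ge0 ?exprn_ge0//.
have q4 : (4^-1) ^+ k <= th ^+ k.
  by rewrite lerXn2r ?nnegrE ?invr_ge0 ?(ltW th0)//; lra.
have -> : 9 * th ^+ k * B = 8 * th ^+ k * B + th ^+ k * B by ring.
apply: lerD; last first.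
  by apply: ler_pM => //; exact: Rint_ge0.
apply: (@le_trans _ _ (\sum_(l < k.+1) 4 * th ^+ k * B * (2^-1) ^+ (k - l))); last first.
  rewrite -mulr_sumr (_ : 8 * th ^+ k * B = 4 * th ^+ k * B * 2); last by ring.
  by rewrite ler_wpM2l ?sum_half// !mulr_ge0 ?exprn_ge0 ?(ltW th0).
apply: ler_sum => l _; have lk : (l <= k)%N by rewrite -ltnS.
rewrite RintZ//.
apply: (@le_trans _ _ (4 * (4^-1) ^+ (k - l) * (th ^+ l * B))).
  by rewrite ler_wpM2l ?gr// mulr_ge0 ?exprn_ge0 ?invr_ge0.
have {}lk := lk; move: (nat_of_ord l) lk => m lk.
have -> : th ^+ k = th ^+ m * th ^+ (k - m) by rewrite -exprD subnKC.
rewrite [leLHS](_ : _ = 4 * (th ^+ m * B) * (4^-1) ^+ (k - m)); last by ring.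
rewrite [leRHS](_ : _ = 4 * (th ^+ m * B) * (th ^+ (k - m) * (2^-1) ^+ (k - m))); last by ring.
rewrite ler_wpM2l ?mulr_ge0 ?exprn_ge0 ?(ltW th0)//.
by rewrite -exprMn lerXn2r ?nnegrE ?invr_ge0 ?mulr_ge0 ?invr_ge0 ?(ltW th0)//; lra.
Qed.

(* Dyadic annuli for the sup norm. *)
Definition chi (k : nat) (xi : 'rV[R]_n) : R :=
  (inb (2 ^+ k) xi && ((k == 0)%N || ~~ inb (2 ^+ k.-1) xi))%:R.

Lemma chi_ge0 k xi : 0 <= chi k xi. Proof. exact: ler0n. Qed.

Lemma chi_le1 k xi : chi k xi <= 1. Proof. by rewrite /chi lern1 leq_b1. Qed.

Lemma measurable_chi k : measurable_fun setT (chi k : E -> R).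
Proof.
have -> : chi k = fun xi => (inb (2 ^+ k) xi)%:R * (if k == 0%N then 1 else 1 - (inb (2 ^+ k.-1) xi)%:R).
  apply/funext => xi; rewrite /chi; case: inb => /=; last by rewrite mul0r.
  by rewrite mul1r; case: (k == 0%N) => //=; case: inb; rewrite /= ?subrr ?subr0.
apply: measurable_funM; first exact: meas_inb.
by case: (k == 0%N) => //; apply: measurable_funB => //; exact: meas_inb.
Qed.

Lemma jb_ge1 (xi : 'rV[R]_n) : 1 <= jb xi.
Proof.
by rewrite /jb -[leLHS]sqrtr1 ler_wsqrtr// lerDl sumr_ge0// => i _; rewrite -expr2 sqr_ge0.
Qed.

Lemma jb_ge_coord (xi : 'rV[R]_n) i : `|xi 0 i| <= jb xi.
Proof.
rewrite /jb -sqrtr_sqr ler_wsqrtr// /dotR (bigD1 i)//= -expr2 addrCA lerDl addr_ge0//.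
by apply: sumr_ge0 => j _; rewrite -expr2 sqr_ge0.
Qed.

Definition jbV (xi : 'rV[R]_n) : R := (jb xi ^+ n)^-1.

Lemma jbV_ge0 xi : 0 <= jbV xi.
Proof. by rewrite invr_ge0 exprn_ge0// (le_trans ler01 (jb_ge1 xi)). Qed.

Lemma cont_dotR : continuous (fun xi : 'rV[R]_n => dotR xi xi).
Proof.
have H (r : seq 'I_n) : continuous (fun xi : 'rV[R]_n => \sum_(i <- r) xi 0 i * xi 0 i).
  elim: r => [|i r IH] xi.
    have -> : (fun z : 'rV[R]_n => \sum_(i <- [::]) z 0 i * z 0 i) = cst 0.
      by apply/funext => z; rewrite big_nil.
    by apply: cst_continuous.
  have c1 : continuous (fun z : 'rV[R]_n => z 0 i) by move=> z; exact: coord_continuous.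
  have cM : continuous (fun z : 'rV[R]_n => z 0 i * z 0 i).
    by move=> z; exact: (continuousM (c1 z) (c1 z)).
  under eq_fun do rewrite big_cons.
  exact: (continuousD (cM xi) (IH xi)).
exact: H.
Qed.

Lemma cont_jbV : continuous jbV.
Proof.
have cj : continuous (fun t : R => (Num.sqrt (1 + `|t|) ^+ n)^-1).
  move=> t; apply: cvgV.
    by rewrite expf_neq0// gt_eqF// sqrtr_gt0 ltr_wpDr.
  apply: (@cvg_comp _ _ _ (fun t : R => Num.sqrt (1 + `|t|)) (fun u => u ^+ n)); last exact: exprn_continuous.
  apply: (@cvg_comp _ _ _ (fun t : R => 1 + `|t|) Num.sqrt); last exact: sqrt_continuous.
  by apply: cvgD; [exact: cvg_cst|exact: norm_continuous].
have -> : jbV = (fun t : R => (Num.sqrt (1 + `|t|) ^+ n)^-1) \o (fun xi => dotR xi xi).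
  apply/funext => xi; rewrite /jbV /jb /= ger0_norm// sumr_ge0// => i _.
  by rewrite -expr2 sqr_ge0.
by move=> xi; apply: continuous_comp; [exact: cont_dotR|exact: cj].
Qed.

Lemma meas_jbV : measurable_fun setT (jbV : E -> R).
Proof. exact: (measurable_cont_Esp cont_jbV). Qed.

(** Trades the sharp cutoff for [rho], whose Fourier transform is explicit and positive. On the
    annulus <xi> is at least 2^(k-1), and each of the n factors of [rho] is at least e^-1. *)
Lemma chi_jb k (xi : 'rV[R]_n) : chi k xi * jbV xi <=
  (2 * 2 ^- k) ^+ n * expR 1 ^+ n * rho (2 ^- k) xi.
Proof.
have j1 := jb_ge1 xi; have j0 : 0 < jb xi := lt_le_trans ltr01 j1.
have RHS0 : 0 <= (2 * 2 ^- k) ^+ n * expR 1 ^+ n * rho (2 ^- k) xi.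
  by rewrite !mulr_ge0 ?rho_ge0 ?exprn_ge0 ?mulr_ge0 ?invr_ge0 ?exprn_ge0 ?expR_ge0.
rewrite {1}/chi; case: (boolP (_ && _)) => [/andP[xk xk']|_]; last by rewrite mul0r.
rewrite mul1r -mulrA -[leLHS]mulr1; apply: ler_pM => //.
- exact: jbV_ge0.
- apply: (@le_trans _ _ ((jb xi)^-1 ^+ n)); first by rewrite /jbV exprVn.
  apply: lerXn2r; rewrite ?nnegrE ?invr_ge0 ?(ltW j0) ?mulr_ge0 ?invr_ge0 ?exprn_ge0//.
  have -> : 2 * 2 ^- k = (2 ^+ k / 2)^-1 :> R by rewrite invfM invrK mulrC.
  rewrite lef_pV2 ?posrE ?divr_gt0 ?exprn_gt0//.
  case: k xk xk' {RHS0} => [|k] xk xk'; first by rewrite expr0; lra.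
  move: xk' => /=; rewrite negb_forall => /existsP[i]; rewrite -ltNge => xi2.
  rewrite exprS mulrAC divff// mul1r (le_trans (ltW xi2))//; exact: jb_ge_coord.
- have -> : expR 1 ^+ n = \prod_(i < n) expR 1 :> R by rewrite prodr_const card_ord.
  rewrite /rho -big_split/=; rewrite -[leLHS](_ : \prod_(i < n) (1 : R) = 1); last by rewrite big1.
  apply: ler_prod => i _; rewrite ler01/= -expRD -[leLHS]expR0 ler_expR subr_ge0 mulrC ler_pdivrMr ?exprn_gt0// mul1r.
  by move/forallP : xk.
Qed.

(** The energy is of size 2^(kn) eta^(2k) B^2 and the mass of [rho] of size 2^(kn). In their
    geometric mean the power 2^(kn) is cancelled by <xi>^-n and eta^k remains: the rate eta^2 for
    the mass in space becomes the rate eta in frequency. The two halves of the splitting add up to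
    1/2 + 9/2 = 5. The phase may vary with xi, in order to include a recentring at y. *)
Lemma dyadic_fourier_bound psi eta B k (s : E -> R) : L1 mu psi -> 0 < B -> 0 < eta -> 2^-1 <= eta ^+ 2 ->
  \int[mu]_y `|psi y| <= B ->
  (forall x, psi x != 0 -> forall l,
     \int[mu]_y (`|psi y| * (inb (2 ^- l) (x - y : 'rV[R]_n))%:R) <= (eta ^+ 2) ^+ l * B) ->
  measurable_fun setT s ->
  L1 mu (fun xi => chi k xi * jbV xi * `|Fc psi (s xi) xi|) /\
  \int[mu]_xi (chi k xi * jbV xi * `|Fc psi (s xi) xi|) <=
    5 * (4 * expR 1) ^+ n * eta ^+ k * B.
Proof.
move=> Ip B0 e0 e2 pB gr ms.
have r0 : 0 < 2 ^- k :> R by rewrite invr_gt0 exprn_gt0.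
have [IE EL] := energy_int r0 Ip (fun x px => kappa_int k Ip e2 pB (gr x px)).
(* AM-GM with the weight [tau] in place of Cauchy-Schwarz: |F| <= tau / 2 + F^2 / (2 tau). *)
pose tau := eta ^+ k * B.
have tau0 : 0 < tau by rewrite mulr_gt0 ?exprn_gt0.
pose A := (2 * 2 ^- k) ^+ n * expR 1 ^+ n : R.
have A0 : 0 <= A by rewrite mulr_ge0 ?exprn_ge0 ?mulr_ge0 ?invr_ge0 ?exprn_ge0 ?expR_ge0.
pose G xi := A * (tau / 2 * rho (2 ^- k) xi + (2 * tau)^-1 * (rho (2 ^- k) xi * energy psi xi)).
have I1 : L1 mu (fun xi => tau / 2 * rho (2 ^- k) xi) by apply: L1Z; exact: rho_L1.
have I2 : L1 mu (fun xi => (2 * tau)^-1 * (rho (2 ^- k) xi * energy psi xi)) by exact: L1Z.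
have IG : L1 mu G by apply: L1Z; exact: L1D.
have HG xi : chi k xi * jbV xi * `|Fc psi (s xi) xi| <= G xi.
  have am : `|Fc psi (s xi) xi| <= tau / 2 + (2 * tau)^-1 * energy psi xi.
    apply: (@le_trans _ _ (tau / 2 + (2 * tau)^-1 * Fc psi (s xi) xi ^+ 2)); last first.
      by rewrite lerD2l ler_wpM2l ?Fc_energy// invr_ge0 mulr_ge0// ltW.
    rewrite -(real_normK (num_real (Fc _ _ _))); set a := `|_|.
    rewrite -subr_ge0 (_ : _ - _ = (2 * tau)^-1 * (tau - a) ^+ 2); last by field; rewrite gt_eqF.
    by rewrite mulr_ge0 ?sqr_ge0// invr_ge0 mulr_ge0// ltW.
  rewrite /G; apply: (le_trans (ler_pM _ _ (chi_jb k xi) am)) => //.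
    by rewrite mulr_ge0 ?chi_ge0 ?jbV_ge0.
  by rewrite le_eqVlt; apply/orP; left; apply/eqP; rewrite /A; ring.
have mF : measurable_fun setT (fun xi : E => chi k xi * jbV xi * `|Fc psi (s xi) xi|).
  apply: measurable_funM.
    by apply: measurable_funM; [exact: measurable_chi|exact: meas_jbV].
  apply: measurableT_comp => //.
  under eq_fun do rewrite FcE//.
  by apply: measurable_funB; apply: measurable_funM; try exact: measurable_Fc; [exact: meas_cos|exact: meas_sin].
have IL : L1 mu (fun xi => chi k xi * jbV xi * `|Fc psi (s xi) xi|).
  apply: (L1_dom mF IG) => xi; rewrite ger0_norm// mulr_ge0// mulr_ge0 ?chi_ge0 ?jbV_ge0//.
split => //; apply: (le_trans (Rint_le IL IG HG)).
rewrite /G RintZ ?RintD//; last exact: L1D.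
rewrite RintZ; last exact: rho_L1.
rewrite RintZ//.
have -> : \int[mu]_xi rho (2 ^- k) xi = (2 * 2 ^+ k) ^+ n by rewrite /Rintegral rho_int// invrK.
set W := (2 * 2 ^+ k) ^+ n.
have W0 : 0 <= W by rewrite exprn_ge0// mulr_ge0 ?exprn_ge0.
have EL' : \int[mu]_xi (rho (2 ^- k) xi * energy psi xi) <= 9 * W * (eta ^+ 2) ^+ k * B * B.
  by apply: (le_trans EL); rewrite ler_wpM2l// !mulr_ge0 ?exprn_ge0 ?sqr_ge0// ltW.
apply: (@le_trans _ _ (A * (tau / 2 * W + (2 * tau)^-1 * (9 * W * (eta ^+ 2) ^+ k * B * B)))).
  by rewrite ler_wpM2l// lerD2l ler_wpM2l// invr_ge0 mulr_ge0// ltW.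
have -> : (2 * tau)^-1 * (9 * W * (eta ^+ 2) ^+ k * B * B) = 9 / 2 * tau * W.
  rewrite /tau -exprM mulnC exprM; field.
  by rewrite !gt_eqF// exprn_gt0.
have -> : A * (tau / 2 * W + 9 / 2 * tau * W) = 5 * (A * W) * tau by field.
have -> : A * W = (4 * expR 1) ^+ n.
  rewrite /A /W -!exprMn; congr (_ ^+ _).
  by field; rewrite expf_neq0.
by rewrite /tau mulrA.
Qed.

End Energy.

(** * Monotone limits and the sum over all annuli *)

Section MoreInt.
Context d (X : measurableType d) (R : realType) (mu : {measure set X -> \bar R}).

Lemma Rint_ae_eq (f g : X -> R) : L1 mu f -> measurable_fun setT g ->
  {ae mu, forall x, f x = g x} -> L1 mu g /\ \int[mu]_x f x = \int[mu]_x g x.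
Proof.
move=> If mg fg.
have fg' : ae_eq mu setT (EFin \o f) (EFin \o g).
  by apply: negligibleS fg => x /= nH H; apply: nH => _; rewrite H.
have fgn : ae_eq mu setT (fun x => `|f x|%:E) (fun x => `|g x|%:E).
  by apply: negligibleS fg => x /= nH H; apply: nH => _; rewrite H.
split.
  apply: L1_lty => //; rewrite -(ge0_ae_eq_integral measurableT _ _ _ _ fgn)//.
  - exact: L1_fin.
  - by apply/measurable_EFinP; exact: L1_meas (L1_norm If).
  - by apply/measurable_EFinP; exact: measurableT_comp.
rewrite /Rintegral; congr fine; apply: ae_eq_integral => //.
  by apply/measurable_EFinP; exact: L1_meas If.
exact/measurable_EFinP.
Qed.

(** The minimum of both functions lies below [g] everywhere and equals [f] almost everywhere. *)
Lemma Rint_le_ae (f g : X -> R) : L1 mu f -> L1 mu g ->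
  {ae mu, forall x, f x <= g x} -> \int[mu]_x f x <= \int[mu]_x g x.
Proof.
move=> If Ig fg.
have mm : measurable_fun setT (fun x => Num.min (f x) (g x)).
  by apply: measurable_minr; [exact: L1_meas If|exact: L1_meas Ig].
have [|Im ->] := Rint_ae_eq If mm.
  by apply: negligibleS fg => x /= nH H; apply: nH; rewrite min_l.
by apply: Rint_le => // x; rewrite ge_min lexx orbT.
Qed.

Lemma L1_mono (g_ : nat -> X -> R) (g : X -> R) B :
  (forall k, L1 mu (g_ k)) -> (forall k x, 0 <= g_ k x) ->
  (forall x, {homo g_ ^~ x : k l / (k <= l)%N >-> k <= l}) ->
  (forall x, (g_ ^~ x) @ \oo --> g x) ->
  (forall k, \int[mu]_x g_ k x <= B) ->
  L1 mu g /\ \int[mu]_x g x <= B.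
Proof.
move=> Ig g0 nd cv gB.
have mg : measurable_fun setT g.
  by apply: (measurable_fun_cvg (fun k => L1_meas (Ig k))) => // x _; exact: cv.
have gx0 x : 0 <= g x by apply: (cvgr_to_ge (cv x)); exact: nearW.
have E : (\int[mu]_x (g x)%:E <= B%:E)%E.
  have cvi := @cvg_monotone_convergence _ _ _ mu setT measurableT (fun k x => (g_ k x)%:E)
    (fun k => (measurable_EFinP _ _).2 (L1_meas (Ig k))) _ _.
  have -> : (\int[mu]_x (g x)%:E = \int[mu]_x limn (fun k => (g_ k x)%:E))%E.
    apply: eq_integral => x _; apply/esym/cvg_lim => //.
    by apply: cvg_EFin; [exact: nearW|exact: cv].
  apply: (cvge_to_le (cvi _ _)).
  - by move=> k x _; rewrite lee_fin.
  - by move=> x _ k l kl; rewrite lee_fin; exact: nd.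
  - by apply: nearW => k; rewrite -EFin_int// lee_fin.
have Igg : L1 mu g.
  apply: L1_lty => //; apply: le_lt_trans (ltry B); apply: le_trans E.
  by apply: ge0_le_integral => // [||x _]; rewrite ?lee_fin ?ger0_norm//;
   apply/measurable_EFinP => //; exact: measurableT_comp.
by split => //; rewrite -lee_fin EFin_int.
Qed.

End MoreInt.

Section MasterSum.
Variables (R : realType) (n : nat).
Local Notation E := (Esp R n).
Local Notation mu := (leb R n).

Lemma inb_le t u (z : 'rV[R]_n) : t <= u -> inb t z -> inb u z.
Proof. by move=> tu /forallP H; apply/forallP => i; exact: le_trans (H i) tu. Qed.

Lemma chi_sum K (xi : 'rV[R]_n) : \sum_(k < K.+1) chi k xi = (inb (2 ^+ K) xi)%:R.
Proof.
elim: K => [|K IH]; first by rewrite big_ord1 /chi/= andbT.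
rewrite big_ord_recr/= IH /chi/=.
have [H|H] := boolP (inb (2 ^+ K) xi); last by rewrite andbT add0r.
rewrite andbF addr0 (inb_le _ H)//.
by rewrite exprS ler_peMl ?exprn_ge0// ler1n.
Qed.

Lemma inb_ev (xi : 'rV[R]_n) : exists K0, forall K, (K0 <= K)%N -> inb (2 ^+ K) xi.
Proof.
pose M := \sum_i `|xi 0 i|.
exists (Num.truncn M).+1 => K MK; apply/forallP => i.
have xM : `|xi 0 i| <= M.
  by rewrite /M (bigD1 i)//= lerDl sumr_ge0.
apply: (le_trans xM); apply: (@le_trans _ _ K%:R).
  by rewrite (le_trans (ltW (truncnS_gt M)))// ler_nat.
by rewrite -natrX ler_nat ltnW// ltn_expl.
Qed.

(** The first K + 1 annuli fill the cube of radius 2^K, so the partial sums increase to the whole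
    integrand, and the geometric series gives 1 / (1 - eta). *)
Lemma fourier_jbV_bound (psi : E -> R) eta B (s : E -> R) : L1 mu psi -> 0 < B -> 0 < eta < 1 ->
  2^-1 <= eta ^+ 2 -> \int[mu]_y `|psi y| <= B ->
  (forall x, psi x != 0 -> forall l,
     \int[mu]_y (`|psi y| * (inb (2 ^- l) (x - y : 'rV[R]_n))%:R) <= (eta ^+ 2) ^+ l * B) ->
  measurable_fun setT s ->
  L1 mu (fun xi => jbV xi * `|Fc psi (s xi) xi|) /\
  \int[mu]_xi (jbV xi * `|Fc psi (s xi) xi|) <=
    5 * (4 * expR 1) ^+ n / (1 - eta) * B.
Proof.
move=> Ip B0 /andP[e0 e1] e2 pB gr ms.
pose h (xi : E) := jbV xi * `|Fc psi (s xi) xi|.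
pose g k (xi : E) := chi k xi * jbV xi * `|Fc psi (s xi) xi|.
have h0 xi : 0 <= h xi by rewrite mulr_ge0// jbV_ge0.
have [Ig gB] : (forall k, L1 mu (g k)) /\
    forall k, \int[mu]_xi g k xi <= 5 * (4 * expR 1) ^+ n * eta ^+ k * B.
  by split => k; have [] := dyadic_fourier_bound k Ip B0 e0 e2 pB gr ms.
pose G K (xi : E) := \sum_(k < K.+1) g k xi.
have GE K xi : G K xi = (inb (2 ^+ K) xi)%:R * h xi.
  by rewrite -chi_sum mulr_suml; apply: eq_bigr => k _; rewrite mulrA.
have IG K : L1 mu (G K) by apply: L1_sum.
apply: (L1_mono IG).
- by move=> k xi; rewrite GE mulr_ge0.
- move=> xi k l kl; rewrite !GE ler_wpM2r// ler_nat.
  have [H|//] := boolP (inb (2 ^+ k) xi); rewrite (inb_le _ H)//.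
  by rewrite ler_eXn2l// ltr1n.
- move=> xi; have [K0 HK] := inb_ev xi; apply: cvg_near_cst.
  by exists K0 => // K /= /HK H; rewrite GE H mul1r.
- move=> K; rewrite /G Rint_sum//.
  apply: (@le_trans _ _ (\sum_(k < K.+1) 5 * (4 * expR 1) ^+ n * B * eta ^+ k)).
    by apply: ler_sum => k _; rewrite mulrAC.
  rewrite -mulr_sumr [leRHS]mulrAC [leRHS]mulrAC -!mulrA ler_wpM2l// ler_wpM2l ?exprn_ge0 ?mulr_ge0 ?expR_ge0//.
  rewrite [leRHS]mulrC ler_wpM2l ?(ltW B0)// -[leRHS]mul1r ler_pdivlMr ?subr_gt0//.
  have -> : (\sum_(i < K.+1) eta ^+ i) * (1 - eta) = 1 - eta ^+ K.+1.
    by rewrite -[in RHS](expr1n _ K.+1) subrXX mulrC; congr (_ * _); apply: eq_bigr => i _; rewrite expr1n mul1r.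
  by rewrite gerBl exprn_ge0// ltW.
Qed.

End MasterSum.

(** * Mass of an A_1 weight on shrinking cubes *)

Section A1growth.
Variables (R : realType) (n : nat) (n_gt0 : (0 < n)%N).
Local Notation E := (Esp R n).
Local Notation mu := (leb R n).
Variables (w : E -> R) (C : R).
Hypotheses (w0 : forall x, 0 <= w x) (C1 : 1 <= C)
  (wloc : forall x t, L1 mu (fun y => w y * (inb t (x - y : 'rV[R]_n))%:R)).

Definition Wb (x : 'rV[R]_n) (t : R) : R := \int[mu]_y (w y * (inb t (x - y))%:R).

(** The A_1 inequality at one point, for all cubes that contain it; cubes are given by centre and
    radius, so (2 t)^n is the volume. It is a property of y alone because the estimates below use it
    at a single y. *)
Definition goodA1 (y : 'rV[R]_n) := forall x t, 0 < t -> inb t (x - y) ->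
  Wb x t <= C * (2 * t) ^+ n * w y.

Hypothesis wA1 : {ae mu, forall y, goodA1 y}.

(** For n > 0 the shell between a cube and its half has at least half of the volume, so by A_1 it
    carries at least the fraction 1 / (2 C) of the mass. From 1 <= C comes the lower bound 1/2 that
    the sum over layers requires. *)
Definition thA1 : R := 1 - (2 * C)^-1.

Lemma thA1_ge : 2^-1 <= thA1.
Proof.
have : (2 * C)^-1 <= 2^-1 by rewrite lef_pV2 ?posrE ?mulr_gt0 ?ler_peMr// (lt_le_trans _ C1).
by rewrite /thA1; lra.
Qed.

Lemma thA1_lt1 : thA1 < 1.
Proof. by rewrite /thA1 gtrBl invr_gt0 mulr_gt0// (lt_le_trans _ C1). Qed.

Lemma Wb_ge0 x t : 0 <= Wb x t.
Proof. by apply: Rint_ge0 => y; rewrite mulr_ge0. Qed.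

Lemma inb_int (x : 'rV[R]_n) t : 0 <= t ->
  L1 mu (fun y => (inb t (x - y : 'rV[R]_n))%:R : R) /\
  \int[mu]_y ((inb t (x - y : 'rV[R]_n))%:R : R) = (2 * t) ^+ n.
Proof.
move=> t0.
have [] := @leb_box R n (fun i => `[x 0 i - t, x 0 i + t]%classic) (fun=> 2 * t).
- by move=> i; exact: measurable_itv.
- move=> i; rewrite lebesgue_measure_itv/= lte_fin.
  case: ltP => h; first by rewrite -EFinB; congr (_%:E); lra.
  by congr (_%:E); lra.
rewrite prodr_const card_ord; set A := [set _ | _] => mA Av.
have -> : (fun y : E => (inb t (x - y : 'rV[R]_n))%:R : R) = \1_A.
  apply/funext => y; rewrite indicE; congr (_%:R); congr nat_of_bool.
  apply/forallP/idP => [H|/set_mem H i].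
    apply/mem_set => i; rewrite /= in_itv/=; have := H i; rewrite !mxE ler_norml => /andP[? ?].
    by apply/andP; split; lra.
  have := H i; rewrite /= in_itv/= !mxE ler_norml => /andP[? ?].
  by apply/andP; split; lra.
split.
  apply: L1_lty; first exact: measurable_indic.
  rewrite (eq_integral (fun x : E => (\1_A x)%:E)); last by move=> z _; rewrite ger0_norm.
  by apply: le_lt_trans (ltry ((2 * t) ^+ n)); rewrite -Av integral_indic// setIT.
rewrite /Rintegral integral_indic// setIT -[RHS]/(fine ((2 * t) ^+ n)%:E) -Av //.
Qed.

(* Integrate [Wb x t <= C (2 t)^n w y] over the cube of radius [t] minus the one of radius [t / 2]. *)
Lemma Wb_half x t : 0 < t -> Wb x (t / 2) <= thA1 * Wb x t.
Proof.
move=> t0; have t20 : 0 < t / 2 by rewrite divr_gt0.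
have [I1 V1] := inb_int x (ltW t0); have [I2 V2] := inb_int x (ltW t20).
have CC : 0 < C by rewrite (lt_le_trans _ C1).
have D0 : 0 < (2 * t) ^+ n by rewrite exprn_gt0// mulr_gt0.
have sub y : inb (t / 2) (x - y) -> inb t (x - y) by apply: inb_le; lra.
have H : \int[mu]_y (Wb x t * ((inb t (x - y : 'rV[R]_n))%:R - (inb (t / 2) (x - y : 'rV[R]_n))%:R)) <=
   \int[mu]_y (C * (2 * t) ^+ n * (w y * (inb t (x - y : 'rV[R]_n))%:R - w y * (inb (t / 2) (x - y : 'rV[R]_n))%:R)).
  apply: Rint_le_ae.
  - by apply: L1Z; exact: L1B.
  - by apply: L1Z; exact: L1B.
  apply: (aeS wA1) => y gy; have := gy x t t0.
  case: (boolP (inb (t / 2) _)) => [/sub ->|_]; first by rewrite !subrr !mulr0.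
  case: (inb t _) => [/(_ isT)|_]; last by rewrite !mulr0 !subr0 !mulr0.
  by rewrite !mulr1 mulr0 !subr0 mulr1.
move: H; rewrite !RintZ ?RintB//; try exact: L1B.
rewrite V1 V2 -/(Wb x t) -/(Wb x (t / 2)) => H.
have tn : (2 * (t / 2)) ^+ n <= (2 * t) ^+ n / 2.
  have -> : 2 * (t / 2) = 2 * t * 2^-1 by field.
  rewrite exprMn ler_wpM2l ?(ltW D0)//.
  by rewrite -(prednK n_gt0) exprS ler_piMr ?invr_ge0// exprn_ile1// ?invr_ge0// invf_le1// ler1n.
have H2 : Wb x t * ((2 * t) ^+ n / 2) <= C * (2 * t) ^+ n * (Wb x t - Wb x (t / 2)).
  apply: le_trans H; rewrite ler_wpM2l ?Wb_ge0//; lra.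
have H3 : Wb x t / 2 <= C * (Wb x t - Wb x (t / 2)).
  rewrite -(ler_pM2r D0); apply: le_trans (le_trans _ H2) _; rewrite le_eqVlt; apply/orP; left; apply/eqP; ring.
have H4 : Wb x t / (2 * C) <= Wb x t - Wb x (t / 2).
  by rewrite invfM mulrA ler_pdivrMr// [leRHS]mulrC.
have -> : thA1 * Wb x t = Wb x t - Wb x t / (2 * C) by rewrite /thA1 mulrBl mul1r (mulrC (_^-1)).
lra.
Qed.

Lemma Wb_growth x l : Wb x (2 ^- l) <= thA1 ^+ l * Wb x 1.
Proof.
elim: l => [|l IH]; first by rewrite !expr0 invr1 mul1r.
have -> : 2 ^- l.+1 = 2 ^- l / 2 :> R by rewrite exprSr invfM mulrC.
have th0 : 0 <= thA1 by apply: le_trans thA1_ge; rewrite invr_ge0.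
apply: (le_trans (Wb_half x _)); first by rewrite invr_gt0 exprn_gt0.
by rewrite exprS -mulrA ler_wpM2l.
Qed.

Lemma Wb_le x t u : t <= u -> Wb x t <= Wb x u.
Proof.
move=> tu; apply: Rint_le => // y; rewrite ler_wpM2l// ler_nat.
by have [H|//] := boolP (inb t (x - y)); rewrite (inb_le tu H).
Qed.

(** The constant of [fourier_jbV_bound] for eta = sqrt thA1, times the part C 2^n of the A_1 bound
    on a cube of radius 2^j; the power (2^j)^n is kept apart. *)
Definition cA1 : R := 5 * (4 * expR 1) ^+ n / (1 - Num.sqrt thA1) * (C * 2 ^+ n).

Lemma cA1_ge0 : 0 <= cA1.
Proof.
rewrite /cA1 !mulr_ge0 ?exprn_ge0 ?mulr_ge0 ?expR_ge0 ?invr_ge0 ?subr_ge0 ?(le_trans ler01 C1)//.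
by rewrite -[leRHS]sqrtr1 ler_wsqrtr// ltW// thA1_lt1.
Qed.

(** The halving starts at radius 1 about a point x of the support. The unit cube about x lies in the
    one of radius 2^j, which contains y, so the A_1 inequality at y bounds the starting mass for all
    x at once. *)
Lemma A1_fourier_bound (psi : E -> R) M j (y : 'rV[R]_n) (s : E -> R) e :
  measurable_fun setT psi -> 0 < M -> (forall x, `|psi x| <= M * w x) ->
  (forall x, psi x != 0 -> inb (2 ^+ j) (y - x : 'rV[R]_n)) ->
  goodA1 y -> 0 < e -> measurable_fun setT s ->
  L1 mu psi /\ L1 mu (fun xi => jbV xi * `|Fc psi (s xi) xi|) /\
  \int[mu]_xi (jbV xi * `|Fc psi (s xi) xi|) <=
    cA1 * M * (2 ^+ j) ^+ n * (w y + e).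
Proof.
move=> mp M0 pw sp gy e0 ms.
have J0 : 0 < 2 ^+ j :> R by rewrite exprn_gt0.
have CC : 0 < C by rewrite (lt_le_trans _ C1).
have pw' x : `|psi x| <= M * (w x * (inb (2 ^+ j) (y - x : 'rV[R]_n))%:R).
  have [->|/sp ->] := eqVneq (psi x) 0; last by rewrite mulr1.
  by rewrite normr0 !mulr_ge0// ltW.
have Ip : L1 mu psi by apply: (L1_dom mp (L1Z M (wloc y (2 ^+ j)))).
split => //.
(* The summand e > 0 keeps [B] positive where w y = 0; it is sent to 0 in [symbol_A1_bound]. *)
pose B := M * (C * (2 * (2 ^+ j)) ^+ n * (w y + e)).
have we : 0 < w y + e by rewrite ltr_wpDl.
have B0 : 0 < B by rewrite !mulr_gt0// exprn_gt0// mulr_gt0.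
have th0 : 0 <= thA1 by apply: le_trans thA1_ge; rewrite invr_ge0.
have eB x : inb (2 ^+ j) (x - y) -> M * Wb x (2 ^+ j) <= B.
  move=> xy; rewrite /B ler_wpM2l ?(ltW M0)// (le_trans (gy x _ J0 xy))//.
  by rewrite ler_wpM2l ?lerDl ?(ltW e0)// mulr_ge0 ?exprn_ge0 ?mulr_ge0 ?(ltW CC) ?(ltW J0).
have inbN z : inb (2 ^+ j) (- z) = inb (2 ^+ j) z :> bool.
  by apply: eq_forallb => i; rewrite mxE normrN.
have [|||||H1 H2] := @fourier_jbV_bound R n psi (Num.sqrt thA1) B s Ip B0.
- apply/andP; split; first by rewrite sqrtr_gt0 (lt_le_trans _ thA1_ge)// invr_gt0.
  by rewrite -[ltRHS]sqrtr1 ltr_sqrt// thA1_lt1.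
- by rewrite sqr_sqrtr// thA1_ge.
- apply: (@le_trans _ _ (M * Wb y (2 ^+ j))).
    by rewrite -RintZ//; apply: Rint_le => //; [exact: L1_norm|exact: L1Z].
  by apply: eB; rewrite subrr; apply/forallP => i; rewrite mxE normr0 ltW.
- move=> x px l; rewrite sqr_sqrtr//.
  apply: (@le_trans _ _ (M * Wb x (2 ^- l))).
    rewrite -RintZ//; apply: Rint_le.
    - exact: L1_inb (L1_norm Ip).
    - exact: L1Z.
    - by move=> z; rewrite mulrA ler_wpM2r.
  apply: (@le_trans _ _ (thA1 ^+ l * (M * Wb x 1))).
    by rewrite mulrCA ler_wpM2l ?(ltW M0)// Wb_growth.
  rewrite ler_wpM2l ?exprn_ge0//.
  apply: (@le_trans _ _ (M * Wb x (2 ^+ j))).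
    by rewrite ler_wpM2l ?(ltW M0)// Wb_le// exprn_ege1// ler1n.
  by apply: eB; rewrite -inbN opprB; exact: sp.
- exact: ms.
- split; [exact: H1|apply: (le_trans H2)].
  rewrite /B /cA1 le_eqVlt; apply/orP; left; apply/eqP.
  rewrite (exprMn n 2 (2 ^+ j)); ring.
Qed.

End A1growth.

(** * Central differences *)

Lemma meas_inv (R : realType) d (X : measurableType d) (f : X -> R) :
  measurable_fun setT f -> measurable_fun setT (fun x => (f x)^-1).
Proof.
(* The identity holds at the zeros of [f] as well, where both sides are 0. *)
move=> mf; rewrite (_ : (fun x => _) = fun x => f x * (f x ^+ 2) `^ (-1)).
  apply: measurable_funM => //; apply: (measurableT_comp (@measurable_powR R (-1))).
  exact: measurable_funX.
apply/funext => x; rewrite powR_inv1 ?sqr_ge0//.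
have [->|f0] := eqVneq (f x) 0; first by rewrite invr0 mul0r.
by field.
Qed.

(** Sine increases on [1/2, 1] by the mean value theorem, since cosine is nonnegative up to pi/2 and
    1 <= pi/2. *)
Lemma sin_half_le (R : realType) (t : R) : 2^-1 <= `|t| <= 1 -> sin 2^-1 <= `|sin t|.
Proof.
wlog t0 : t / 0 <= t.
  move=> H /andP[t1 t2]; have [/H|/ltW t0] := leP 0 t; first by apply; rewrite t1.
  by rewrite -normrN -sinN; apply: H; rewrite ?oppr_ge0// normrN t1.
rewrite ger0_norm// => /andP[t1 t2]; apply: le_trans (ler_norm _).
have [|c] := @MVT_segment R sin cos 2^-1 t t1 (fun x _ => is_derive_sin x).
  by apply: continuous_subspaceT => x; exact: continuous_sin.
rewrite in_itv/= => /andP[c1 c2] E; rewrite -subr_ge0 E mulr_ge0 ?subr_ge0//.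
apply: cos_ge0_pihalf; have := pihalf_ge1 R => p1; apply/andP; split; lra.
Qed.

Lemma sin_half_gt0 (R : realType) : 0 < sin (2^-1 : R).
Proof. apply: sin_gt0_pihalf; have := pihalf_ge1 R => p1; apply/andP; split; lra. Qed.

Section Differences.
Variables (R : realType) (n : nat) (i : 'I_n).
Local Notation E := (Esp R n).
Local Notation mu := (leb R n).
Local Notation e := (delta_mx 0 i : 'rV[R]_n).
Implicit Types (f : 'rV[R]_n -> R).

(** Successive derivatives in the direction [e], given as data: the notion then passes directly to
    differences ([chain_Dl]) and to the zero symbol put at exceptional points. *)
Definition chain (be : nat -> 'rV[R]_n -> R) :=
  forall m x, is_derive x e (be m) (be m.+1 x).

Definition Dl (h : R) f (xi : 'rV[R]_n) : R := f (xi + (h / 2) *: e) - f (xi - (h / 2) *: e).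

Lemma line_derive f d (x : 'rV[R]_n) t : is_derive (x + t *: e) e f d ->
  is_derive t (1:R) (fun t => f (x + t *: e)) d.
Proof.
case=> fd fE.
have H : (fun h : R => h^-1 *: (((fun t => f (x + t *: e)) \o shift t) (h *: 1) - f (x + t *: e))) =
    (fun h : R => h^-1 *: ((f \o shift (x + t *: e)) (h *: e) - f (x + t *: e))).
  apply/funext => h /=; congr (_ *: (f _ - _)).
  by rewrite /shift /= [h *: 1]mulr1 scalerDl addrCA.
by split; [rewrite /derivable H|rewrite -fE /derive H].
Qed.

Lemma chain_Dl be h : chain be -> chain (fun m => Dl h (be m)).
Proof.
move=> cb m x; rewrite /Dl.
have sh (v : 'rV[R]_n) : is_derive x e (fun xi => be m (xi + v)) (be m.+1 (x + v)).
  have [fd fE] := cb m (x + v).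
  have H : (fun h : R => h^-1 *: (((fun xi => be m (xi + v)) \o shift x) (h *: e) - be m (x + v))) =
    (fun h : R => h^-1 *: ((be m \o shift (x + v)) (h *: e) - be m (x + v))).
    by apply/funext => k /=; rewrite addrA.
  by split; [rewrite /derivable H|rewrite -fE /derive H].
exact: (is_deriveB (sh _) (sh _)).
Qed.

Lemma Dl_mvt be h (xi : 'rV[R]_n) K m : chain be -> 0 < h ->
  (forall t, `|t| <= h / 2 -> `|be m.+1 (xi + t *: e)| <= K) -> `|Dl h (be m) xi| <= h * K.
Proof.
move=> cb h0 HK; rewrite /Dl -scaleNr.
have dl t := line_derive (cb m (xi + t *: e)).
have hh : - (h / 2) <= h / 2 by lra.
have [|c] := @MVT_segment R (fun t => be m (xi + t *: e)) (fun t => be m.+1 (xi + t *: e)) (- (h / 2)) (h / 2) hh (fun x _ => dl x).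
  apply: continuous_subspaceT => t; apply: differentiable_continuous.
  by apply/derivable1_diffP; exact: ex_derive.
rewrite in_itv/= => /andP[c1 c2] ->.
rewrite normrM mulrC (_ : h / 2 - - (h / 2) = h); last by field.
by rewrite gtr0_norm// ler_wpM2l ?(ltW h0)// HK// ler_norml c1.
Qed.

Lemma jb_shift (xi : 'rV[R]_n) t : `|t| <= 1 -> jb xi <= 2 * jb (xi + t *: e).
Proof.
move=> t1; rewrite /jb.
have -> : 2 = Num.sqrt (2 ^+ 2) :> R by rewrite sqrtr_sqr ger0_norm.
rewrite -sqrtrM ?sqr_ge0// ler_wsqrtr//.
have t2 : t ^+ 2 <= 1 by rewrite -(real_normK (num_real t)) exprn_ile1.
have S0 (u : 'rV[R]_n) : 0 <= \sum_(j < n | j != i) u 0 j * u 0 j.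
  by apply: sumr_ge0 => j _; rewrite -expr2 sqr_ge0.
rewrite /dotR (bigD1 i)//= [in leRHS](bigD1 i)//= !mxE !eqxx /= mulr1.
have -> : \sum_(j < n | j != i) (xi + t *: e) 0 j * (xi + t *: e) 0 j = \sum_(j < n | j != i) xi 0 j * xi 0 j.
  by apply: eq_bigr => j ji; rewrite !mxE eqxx (negbTE ji) /= mulr0 addr0.
set S := \sum_(j < n | _) _; have := S0 xi; rewrite -/S => S1.
move: (xi 0 i) S S1 t2 => a b b0 t2.
(* Completing the square: 4 (1 + (a + t)^2 + b) - (1 + a^2 + b) = 3 (a + 4t/3)^2 + 3 + 3b -
   4t^2/3. *)
have h1 : 0 <= (a + 4 / 3 * t) ^+ 2 by exact: sqr_ge0.
have h2 : 0 <= t ^+ 2 by exact: sqr_ge0.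
lra.
Qed.

Lemma jbV_shift (xi : 'rV[R]_n) t : `|t| <= 1 -> jbV (xi + t *: e) <= 2 ^+ n * jbV xi.
Proof.
move=> t1; have j0 (u : 'rV[R]_n) : 0 < jb u := lt_le_trans ltr01 (jb_ge1 u).
rewrite /jbV -[X in X * _]invrK -invfM lef_pV2 ?posrE ?mulr_gt0 ?invr_gt0 ?exprn_gt0//.
rewrite -exprVn -exprMn lerXn2r ?nnegrE ?mulr_ge0 ?invr_ge0 ?(ltW (j0 _))//.
by rewrite ler_pdivrMl//; exact: jb_shift.
Qed.

(** The transform recentred at y, that is, with kernel cos ((x - y).xi + s). *)
Definition Fy (psi : E -> R) (y : 'rV[R]_n) (s : R) (xi : 'rV[R]_n) : R :=
  Fc psi (s - dotR y xi) xi.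

Lemma measurable_Fy psi y s : L1 mu psi -> measurable_fun setT (Fy psi y s : E -> R).
Proof.
move=> Ip.
have mph : measurable_fun setT (fun xi : E => s - dotR y xi).
  by apply: measurable_funB => //; exact: meas_dotR.
rewrite (_ : (Fy psi y s : E -> R) = fun xi => cos (s - dotR y xi) * Fc psi 0 xi - sin (s - dotR y xi) * Fc psi (- (pi / 2)) xi).
  by apply: measurable_funB; apply: measurable_funM; try exact: measurable_Fc; [exact: meas_cos|exact: meas_sin].
by apply/funext => xi; rewrite /Fy FcE.
Qed.

Definition smul (h : R) (y : 'rV[R]_n) (m : nat) (psi : E -> R) (x : E) : R :=
  psi x * (2 * sin (h * ((x : 'rV[R]_n) 0 i - y 0 i) / 2)) ^+ m.

(* A factor [2 sin (h (x_i - y_i) / 2)] on [psi] is a central difference of step [h] of its transform. *)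
Lemma Fy_step h y m psi s (xi : 'rV[R]_n) : L1 mu (smul h y m psi) ->
  Fy (smul h y m.+1 psi) y s xi =
  Fy (smul h y m psi) y (s - pi / 2) (xi + (h / 2) *: e) -
  Fy (smul h y m psi) y (s - pi / 2) (xi - (h / 2) *: e).
Proof.
move=> Ip; rewrite /Fy /Fc -RintB; [|exact: L1_cosx|exact: L1_cosx].
apply: eq_Rintegral => x _; rewrite {1}/smul exprSr mulrA -/(smul h y m psi x).
rewrite -mulrBr -mulrA; congr (_ * _).
have dl (u v : 'rV[R]_n) t : dotR u (v + t *: e) = dotR u v + t * u 0 i.
  rewrite /dotR (bigD1 i)//= [in RHS](bigD1 i)//= !mxE !eqxx /= mulr1.
  rewrite (eq_bigr (fun j => u 0 j * v 0 j)); first by ring.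
  by move=> j ji; rewrite !mxE eqxx (negbTE ji) /= mulr0 addr0.
have -> : xi - (h / 2) *: e = xi + (- (h / 2)) *: e by rewrite scaleNr.
rewrite !dl.
set a := dotR x xi - dotR y xi + s; set b := h * (x 0 i - y 0 i) / 2.
have -> : dotR x xi + (s - dotR y xi) = a by rewrite /a; ring.
have -> : dotR x xi + h / 2 * (x : 'rV[R]_n) 0 i + (s - pi / 2 - (dotR y xi + h / 2 * y 0 i)) = a + b - pi / 2.
  by rewrite /a /b; field.
have -> : dotR x xi + - (h / 2) * (x : 'rV[R]_n) 0 i + (s - pi / 2 - (dotR y xi + - (h / 2) * y 0 i)) = a - b - pi / 2.
  by rewrite /a /b; field.
by rewrite !cosBpihalf sinD sinB; ring.
Qed.

(** By translation invariance each of the N steps moves one difference from the transform to the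
    symbol. It costs h, by the mean value theorem, times 2^n for shifting <xi>^-n by at most 1. The
    phase drops by pi/2 each time, so [K] has to bound all phases. [A0] secures the integrability of
    the products; the estimate itself uses the bound [A] on the N-th derivative. *)
Lemma diff_int N be A0 A s K h psi y : 0 < h <= 1 -> chain be ->
  (forall m, measurable_fun setT (be m : E -> R)) ->
  (forall xi, `|be 0%N xi| <= A0 * jbV xi) -> (forall xi, `|be N xi| <= A * jbV xi) ->
  (forall m, L1 mu (smul h y m psi)) ->
  (forall m s, L1 mu (fun xi => jbV xi * `|Fy (smul h y m psi) y s xi|)) ->
  (forall s, \int[mu]_xi (jbV xi * `|Fy psi y s xi|) <= K) ->
  `|\int[mu]_xi (be 0%N xi * Fy (smul h y N psi) y s xi)| <= (2 ^+ n * h) ^+ N * A * K.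
Proof.
move=> /andP[h0 h1] cb mb b0 bN Is If HK.
have jV0 (xi : 'rV[R]_n) : 0 < jbV xi by rewrite invr_gt0 exprn_gt0// (lt_le_trans ltr01 (jb_ge1 xi)).
have Ib (f : E -> R) A1 m s' : measurable_fun setT f -> (forall xi, `|f xi| <= A1 * jbV xi) ->
    L1 mu (fun xi => f xi * Fy (smul h y m psi) y s' xi).
  move=> mf fA; apply: (L1_dom _ (L1Z A1 (If m s'))).
    by apply: measurable_funM => //; exact: measurable_Fy.
  by move=> xi; rewrite normrM mulrA ler_wpM2r.
elim: N be A0 A s cb mb b0 bN => [|N IH] be A0 A s cb mb b0 bN.
  have sm0 : smul h y 0 psi = psi by apply/funext => x; rewrite /smul expr0 mulr1.
  have A_ge0 : 0 <= A.
    by rewrite -(pmulr_lge0 _ (jV0 0)); exact: le_trans (normr_ge0 _) (bN 0).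
  rewrite expr0 mul1r; apply: (@le_trans _ _ (\int[mu]_xi (A * (jbV xi * `|Fy psi y s xi|)))).
    apply: Rint_norm_le; first exact: (Ib _ A0).
      by apply: L1Z; rewrite -sm0.
    by move=> xi; rewrite sm0 normrM mulrA ler_wpM2r.
  by rewrite RintZ ?ler_wpM2l// -sm0.
pose G := Fy (smul h y N psi) y (s - pi / 2).
have mG : measurable_fun setT (G : E -> R) by exact: measurable_Fy.
pose v := (h / 2) *: e.
have hv : `|h / 2| <= 1 by rewrite ger0_norm; lra.
have hvN : `|- (h / 2)| <= 1 by rewrite normrN.
have A00 : 0 <= A0.
  by rewrite -(pmulr_lge0 _ (jV0 0)); exact: le_trans (normr_ge0 _) (b0 0).
have bs (xi : 'rV[R]_n) t : `|t| <= 1 -> `|be 0%N (xi + t *: e)| <= A0 * 2 ^+ n * jbV xi.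
  by move=> t1; rewrite (le_trans (b0 _))// -mulrA ler_wpM2l// jbV_shift.
have I1 : L1 mu (fun xi => be 0%N (xi - v) * G xi).
  apply: (Ib (fun xi => be 0%N ((xi : 'rV[R]_n) - v)) (A0 * 2 ^+ n)); first exact: (measurable_shift (- v) (mb 0%N)).
  by move=> xi; rewrite /v -scaleNr; exact: bs.
have I2 : L1 mu (fun xi => be 0%N (xi + v) * G xi).
  apply: (Ib (fun xi => be 0%N ((xi : 'rV[R]_n) + v)) (A0 * 2 ^+ n)); first exact: (measurable_shift v (mb 0%N)).
  by move=> xi; exact: bs.
have E1 : \int[mu]_xi (be 0%N xi * G (xi + v)) = \int[mu]_xi (be 0%N (xi - v) * G xi).
  rewrite -(int_shift v (L1_meas I1)); apply: eq_Rintegral => xi _.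
  by rewrite addrK.
have E2 : \int[mu]_xi (be 0%N xi * G (xi - v)) = \int[mu]_xi (be 0%N (xi + v) * G xi).
  rewrite -(int_shift (- v) (L1_meas I2)); apply: eq_Rintegral => xi _.
  by rewrite subrK.
have J1 : L1 mu (fun xi => be 0%N xi * G (xi + v)).
  by apply: (L1_eq (L1_shift v I1)) => xi; rewrite addrK.
have J2 : L1 mu (fun xi => be 0%N xi * G (xi - v)).
  by apply: (L1_eq (L1_shift (- v) I2)) => xi; rewrite subrK.
have -> : \int[mu]_xi (be 0%N xi * Fy (smul h y N.+1 psi) y s xi) = - \int[mu]_xi (Dl h (be 0%N) xi * G xi).
  transitivity (\int[mu]_xi (be 0%N xi * G (xi + v) - be 0%N xi * G (xi - v))).
    by apply: eq_Rintegral => xi _; rewrite (Fy_step s xi (Is N)) mulrBr.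
  rewrite (RintB J1 J2) E1 E2 -(RintB I1 I2).
  transitivity (\int[mu]_xi ((-1) * (Dl h (be 0%N) xi * G xi))).
    by apply: eq_Rintegral => xi _; rewrite /Dl -/v; ring.
  rewrite RintZ ?mulN1r; first by [].
  by apply: (L1_eq (L1B I2 I1)) => xi; rewrite /Dl -/v; ring.
rewrite normrN.
have := IH (fun m => Dl h (be m)) (A0 * 2 ^+ n * 2) (2 ^+ n * h * A) (s - pi / 2) (chain_Dl h cb).
have -> : (2 ^+ n * h) ^+ N.+1 * A * K = (2 ^+ n * h) ^+ N * (2 ^+ n * h * A) * K.
  by rewrite exprSr; ring.
apply.
- move=> m; apply: measurable_funB; first exact: (measurable_shift v (mb m)).
  exact: (measurable_shift (- v) (mb m)).
- move=> xi; rewrite /Dl (le_trans (ler_normB _ _))//.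
  rewrite (_ : A0 * 2 ^+ n * 2 * jbV xi = A0 * 2 ^+ n * jbV xi + A0 * 2 ^+ n * jbV xi); last by ring.
  by rewrite lerD ?bs// -scaleNr bs.
- move=> xi; rewrite (_ : 2 ^+ n * h * A * jbV xi = h * (A * (2 ^+ n * jbV xi))); last by ring.
  have A_ge0 : 0 <= A.
    by rewrite -(pmulr_lge0 _ (jV0 0)); exact: le_trans (normr_ge0 _) (bN 0).
  apply: (@Dl_mvt be h xi _ N cb h0) => t th; apply: (le_trans (bN _)).
  have t1 : `|t| <= 1 := le_trans th (le_trans (ler_norm _) hv).
  exact: (ler_wpM2l A_ge0 (jbV_shift xi t1)).
Qed.

End Differences.

(** * The a priori bound *)

Section Apriori.
Variables (R : realType) (n : nat) (n_gt0 : (0 < n)%N).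
Local Notation E := (Esp R n).
Local Notation mu := (leb R n).
Variables (w : E -> R) (C : R).
Hypotheses (w0 : forall x, 0 <= w x) (C1 : 1 <= C)
  (wloc : forall x t, L1 mu (fun y => w y * (inb t (x - y : 'rV[R]_n))%:R))
  (wA1 : {ae mu, forall y, goodA1 w C y}).

(* The [pcell j i] split the annulus [chi j.+1] according to a coordinate that is large on it. *)
Definition pcount j (z : 'rV[R]_n) : R := \sum_(i < n) (2 ^+ j < `|z 0 i|)%R%:R.

Definition pcell j (i : 'I_n) (z : 'rV[R]_n) : R :=
  chi j.+1 z * ((2 ^+ j < `|z 0 i|)%R%:R / pcount j z).

Lemma pcell_sum j z : \sum_(i < n) pcell j i z = chi j.+1 z.
Proof.
rewrite /pcell -mulr_sumr -mulr_suml -/(pcount j z) /chi /=.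
case: (boolP (inb (2 ^+ j.+1) z)) => _ /=; last by rewrite mul0r.
case: (boolP (inb (2 ^+ j) z)) => /= [_|]; first by rewrite mul0r.
rewrite negb_forall => /existsP[i]; rewrite -ltNge => zi.
rewrite divff ?mulr1// gt_eqF// /pcount (bigD1 i)//= zi ltr_wpDr//.
by apply: sumr_ge0 => k _; exact: ler0n.
Qed.

Lemma pcell_ge0 j i z : 0 <= pcell j i z.
Proof.
rewrite /pcell mulr_ge0 ?chi_ge0// divr_ge0 ?ler0n//.
by apply: sumr_ge0 => k _; exact: ler0n.
Qed.

Lemma pcell_le1 j i z : pcell j i z <= 1.
Proof.
apply: le_trans (chi_le1 j.+1 z); rewrite -pcell_sum (bigD1 i)//= lerDl.
by apply: sumr_ge0 => k _; exact: pcell_ge0.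
Qed.

Lemma pcell_supp j i z : pcell j i z != 0 -> inb (2 ^+ j.+1) z /\ 2 ^+ j < `|z 0 i|.
Proof.
rewrite /pcell /chi; case: (boolP (inb _ z)) => /= [_|_]; last by rewrite mul0r eqxx.
by case: (ltP (2 ^+ j) `|z 0 i|) => // _; rewrite mul0r mulr0 eqxx.
Qed.

Lemma meas_pcell j i d (X : measurableType d) (f : X -> E) : measurable_fun setT f ->
  measurable_fun setT (fun x => pcell j i (f x : 'rV[R]_n)).
Proof.
move=> mf.
have mlt k : measurable_fun setT (fun x => (2 ^+ j < `|(f x : 'rV[R]_n) 0 k|)%R%:R : R).
  have -> : (fun x => (2 ^+ j < `|(f x : 'rV[R]_n) 0 k|)%R%:R : R) =
    \1_[set x | 2 ^+ j < `|(f x : 'rV[R]_n) 0 k|].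
    by apply/funext => x; rewrite indicE; congr (_%:R); congr nat_of_bool; apply/idP/idP; [move/mem_set|move/set_mem].
  apply: measurable_indic.
  have mg : measurable_fun setT (fun x => `|(f x : 'rV[R]_n) 0 k|).
    by apply: measurableT_comp => //; exact: meas_coord.
  rewrite (_ : [set x | _] = setT `&` (fun x => `|(f x : 'rV[R]_n) 0 k|) @^-1` `]2 ^+ j, +oo[%classic).
    by apply: mg.
  by apply/seteqP; split => x /=; rewrite in_itv/= andbT; [|case].
apply: measurable_funM; first exact: (measurableT_comp (@measurable_chi R n j.+1) mf).
apply: measurable_funM; first exact: mlt.
by apply: meas_inv; apply: meas_sum => k; exact: mlt.
Qed.

(** On a cell of scale 2^j, with h = 2^-j, the number h |x_i - y_i| / 2 lies in [1/2, 1], so each of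
    the n + 1 factors divided out is at least 2 sin (1/2) in absolute value. *)
Definition Msig : R := (2 * sin 2^-1) ^- n.+1.

Lemma Msig_gt0 : 0 < Msig.
Proof. by rewrite invr_gt0 exprn_gt0// mulr_gt0// sin_half_gt0. Qed.

(** The 1 is the near piece. For the far pieces n directions and the sum of 2^-j give 2 n, the n + 1
    differences give (2^n)^(n+1), and the radius 2^(j+1) in place of 2^j gives one more 2^n. *)
Definition Kap : R := cA1 n C * (1 + 2 * n%:R * Msig * (2 ^+ n) ^+ n.+2).

Lemma Kap_ge0 : 0 <= Kap.
Proof.
have P : 0 <= (2 ^+ n) ^+ n.+2 :> R by apply: exprn_ge0; apply: exprn_ge0.
have Q : 0 <= 2 * n%:R * Msig by rewrite !mulr_ge0// ltW// Msig_gt0.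
by rewrite /Kap mulr_ge0 ?cA1_ge0// addr_ge0// mulr_ge0.
Qed.

Lemma meas_phaseFy y s : measurable_fun setT (fun xi : E => s - dotR y xi).
Proof. by apply: measurable_funB => //; exact: meas_dotR. Qed.

Lemma near_piece (b : 'rV[R]_n -> R) A (psi : E -> R) (y : 'rV[R]_n) s e :
  measurable_fun setT (b : E -> R) -> 0 <= A -> (forall xi, `|b xi| <= A * jbV xi) ->
  measurable_fun setT psi -> (forall x, `|psi x| <= w x) ->
  (forall x, psi x != 0 -> inb 1 (y - x : 'rV[R]_n)) ->
  goodA1 w C y -> 0 < e ->
  [/\ L1 mu psi, L1 mu (fun xi => b xi * Fy psi y s xi) &
  `|\int[mu]_xi (b xi * Fy psi y s xi)| <= A * (cA1 n C * (w y + e))].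
Proof.
move=> mb A0 bA mp pw sp gy e0.
have pw' x : `|psi x| <= 1 * w x by rewrite mul1r.
have sp' x : psi x != 0 -> inb (2 ^+ 0) (y - x : 'rV[R]_n) by exact: sp.
have [Ip [I1 B1]] := A1_fourier_bound n_gt0 w0 C1 wloc wA1 mp ltr01 pw' sp' gy e0 (meas_phaseFy y s).
have I2 : L1 mu (fun xi => A * (jbV xi * `|Fy psi y s xi|)) by exact: (L1Z A I1).
have bd xi : `|b xi * Fy psi y s xi| <= A * (jbV xi * `|Fy psi y s xi|).
  by rewrite normrM mulrA ler_wpM2r.
have I3 : L1 mu (fun xi => b xi * Fy psi y s xi).
  by apply: (L1_dom _ I2 bd); apply: measurable_funM => //; exact: measurable_Fy.
split; [exact: Ip|exact: I3|].
apply: (le_trans (Rint_norm_le I3 I2 bd)); rewrite (RintZ A I1) ler_wpM2l//.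
by move: B1; rewrite expr0 expr1n !mulr1.
Qed.

Lemma far_piece (b : 'rV[R]_n -> R) i be A0 A j (psi : E -> R) (y : 'rV[R]_n) s e :
  chain i be -> be 0%N = b ->
  (forall m, measurable_fun setT (be m : E -> R)) ->
  0 <= A0 -> 0 <= A -> (forall xi, `|b xi| <= A0 * jbV xi) ->
  (forall xi, `|be n.+1 xi| <= A * jbV xi) ->
  measurable_fun setT psi -> (forall x, `|psi x| <= w x) ->
  (forall x, psi x != 0 -> inb (2 ^+ j.+1) (y - x : 'rV[R]_n) /\ 2 ^+ j < `|(y - x : 'rV[R]_n) 0 i|) ->
  goodA1 w C y -> 0 < e ->
  [/\ L1 mu psi, L1 mu (fun xi => b xi * Fy psi y s xi) &
  `|\int[mu]_xi (b xi * Fy psi y s xi)| <=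
    A * (cA1 n C * Msig * (2 ^+ n) ^+ n.+2 * (2^-1) ^+ j * (w y + e))].
Proof.
move=> cb beb mb A00 A_0 bA bN mp pw sp gy e0.
pose h : R := 2 ^- j.
have J0 : 0 < 2 ^+ j :> R by rewrite exprn_gt0.
have h0 : 0 < h by rewrite invr_gt0.
have h1 : h <= 1 by rewrite invf_le1// exprn_ege1// ler1n.
pose sn (x : E) : R := 2 * sin (h * ((x : 'rV[R]_n) 0 i - y 0 i) / 2).
have msn : measurable_fun setT sn.
  apply: measurable_funM => //; apply: meas_sin.
  apply: measurable_funM => //; apply: measurable_funM => //.
  by apply: measurable_funB => //; exact: measurable_coord.
have snb x : psi x != 0 -> 2 * sin 2^-1 <= `|sn x|.
  move=> /sp[/forallP /(_ i) z2 z1]; rewrite /sn normrM ger0_norm// ler_wpM2l//.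
  apply: sin_half_le.
  have zE : `|h * ((x : 'rV[R]_n) 0 i - y 0 i) / 2| = h / 2 * `|(y - x : 'rV[R]_n) 0 i|.
    rewrite !mxE distrC !normrM (gtr0_norm h0) normfV (@ger0_norm _ 2)//.
    by rewrite mulrAC.
  have hJ : h * 2 ^+ j = 1 by rewrite mulVf// gt_eqF.
  rewrite zE; apply/andP; split.
    have : h * 2 ^+ j <= h * `|(y - x : 'rV[R]_n) 0 i| by rewrite ler_wpM2l ?(ltW z1)// ltW.
    by rewrite hJ; lra.
  apply: (@le_trans _ _ (h / 2 * 2 ^+ j.+1)); first by rewrite ler_wpM2l// divr_ge0// ltW.
  by rewrite exprS mulrA divfK// hJ.
have s0 : 0 < 2 * sin 2^-1 :> R by rewrite mulr_gt0// sin_half_gt0.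
have sn_le x : `|sn x| <= 2 by rewrite /sn normrM ger0_norm// ler_piMr// sin_max.
(* [psi] is [smul] of order n + 1 applied to [psi']: where [sn] vanishes, so does [psi], by
   [snb]. *)
pose psi' (x : E) : R := psi x * (sn x ^+ n.+1)^-1.
have mp' : measurable_fun setT psi'.
  by apply: measurable_funM => //; apply: meas_inv; exact: measurable_funX.
have p'b x : `|psi' x| <= Msig * w x.
  have [p0|px] := eqVneq (psi x) 0.
    by rewrite /psi' p0 mul0r normr0 mulr_ge0// ltW// Msig_gt0.
  rewrite /psi' normrM mulrC; apply: ler_pM => //.
  rewrite normfV normrX /Msig lef_pV2 ?posrE ?exprn_gt0//; last by rewrite (lt_le_trans s0)// snb.
  by rewrite lerXn2r ?nnegrE ?(ltW s0)// snb.
have smE m : smul i h y m psi' = fun x => psi' x * sn x ^+ m by [].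
have msm m : measurable_fun setT (smul i h y m psi').
  by rewrite smE; apply: measurable_funM => //; exact: measurable_funX.
have smb m x : `|smul i h y m psi' x| <= 2 ^+ m * Msig * w x.
  rewrite smE normrM mulrC -mulrA; apply: ler_pM => //.
  by rewrite normrX lerXn2r ?nnegrE.
have sms m x : smul i h y m psi' x != 0 -> inb (2 ^+ j.+1) (y - x : 'rV[R]_n).
  move=> H; have /sp[] // : psi x != 0.
  by apply: contraNneq H => p0; rewrite smE /psi' p0 !mul0r.
have M0 m : 0 < 2 ^+ m * Msig by rewrite mulr_gt0 ?exprn_gt0// Msig_gt0.
have P m s' := A1_fourier_bound n_gt0 w0 C1 wloc wA1 (msm m) (M0 m) (smb m) (sms m) gy e0 (meas_phaseFy y s').
have psiE : smul i h y n.+1 psi' = psi.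
  rewrite smE; apply/funext => x; have [p0|px] := eqVneq (psi x) 0.
    by rewrite /psi' p0 !mul0r.
  rewrite /psi' mulfVK// expf_neq0//.
  by rewrite -normr_gt0 (lt_le_trans s0)// snb.
have psi'E : smul i h y 0 psi' = psi'.
  by rewrite smE; apply/funext => x; rewrite expr0 mulr1.
have Ip : L1 mu psi by rewrite -psiE; have [] := P n.+1 s.
have I1 : L1 mu (fun xi => jbV xi * `|Fy psi y s xi|).
  by rewrite -psiE; have [_ []] := P n.+1 s.
have I3 : L1 mu (fun xi => b xi * Fy psi y s xi).
  apply: (L1_dom _ (L1Z A0 I1)).
    by apply: measurable_funM; [rewrite -beb|exact: measurable_Fy].
  by move=> xi; rewrite normrM mulrA ler_wpM2r.
split; [exact: Ip|exact: I3|].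
have K s' : \int[mu]_xi (jbV xi * `|Fy psi' y s' xi|) <= cA1 n C * Msig * (2 ^+ j.+1) ^+ n * (w y + e).
  have [_ [_]] := P 0%N s'; rewrite psi'E expr0 mul1r; exact.
have hh : 0 < h <= 1 by rewrite h0.
have b0' xi : `|be 0%N xi| <= A0 * jbV xi by rewrite beb.
have := diff_int s hh cb mb b0' bN (fun m => (P m 0).1) (fun m s' => (P m s').2.1) K.
rewrite psiE beb => /le_trans; apply.
rewrite le_eqVlt; apply/orP; left; apply/eqP.
have hE : h = 2^-1 ^+ j by rewrite exprVn.
rewrite (exprS 2 j) (exprMn n 2) (exprMn n.+1 (2 ^+ n) h).
have -> : h ^+ n.+1 = h * h ^+ n by rewrite exprS.
have -> : (2 ^+ n) ^+ n.+2 = 2 ^+ n * (2 ^+ n) ^+ n.+1 :> R by rewrite exprS.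
(* Of the n + 1 factors h, n cancel the volume (2^j)^n and the last one is the summable 2^-j. *)
have hJ : h ^+ n * (2 ^+ j) ^+ n = 1 by rewrite -exprMn mulVf ?expr1n// gt_eqF.
rewrite -hE.
transitivity (A * (cA1 n C * Msig * (2 ^+ n * (2 ^+ n) ^+ n.+1) * h * (w y + e)) * (h ^+ n * (2 ^+ j) ^+ n)).
  by ring.
by rewrite hJ mulr1.
Qed.

Lemma Fy_sum I (r : seq I) (psis : I -> E -> R) y s (xi : 'rV[R]_n) :
  (forall k, L1 mu (psis k)) ->
  Fy (fun x => \sum_(k <- r) psis k x) y s xi = \sum_(k <- r) Fy (psis k) y s xi.
Proof.
move=> Ip; rewrite /Fy /Fc -Rint_sum; last by move=> k; exact: L1_cosx.
by apply: eq_Rintegral => x _; rewrite mulr_suml.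
Qed.

(** Thanks to the factor 2^-j of the far pieces the number [J] of scales is absent from the bound,
    so the support of [psi] may be arbitrarily large. *)
Lemma symbol_A1_bound (b : 'rV[R]_n -> R) A (psi : E -> R) (y : 'rV[R]_n) s J :
  (forall i, exists be, [/\ chain i be, be 0%N = b,
     (forall m, measurable_fun setT (be m : E -> R)) &
     forall xi, `|be n.+1 xi| <= A * jbV xi]) ->
  0 <= A -> (forall xi, `|b xi| <= A * jbV xi) ->
  measurable_fun setT psi -> (forall x, `|psi x| <= w x) ->
  (forall x, psi x != 0 -> inb (2 ^+ J) (y - x : 'rV[R]_n)) ->
  goodA1 w C y ->
  L1 mu (fun xi => b xi * Fy psi y s xi) /\
  `|\int[mu]_xi (b xi * Fy psi y s xi)| <= A * Kap * w y.
Proof.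
move=> ch A_0 bA mp pw sp gy.
have mb : measurable_fun setT (b : E -> R).
  by have [be [_ <- mb _]] := ch (Ordinal n_gt0); exact: mb.
have msub : measurable_fun setT (fun x : E => (y - (x : 'rV[R]_n))%R : E).
  exact: meas_sub.
pose q0 (x : E) : R := chi 0 (y - (x : 'rV[R]_n)) * psi x.
pose q j i (x : E) : R := pcell j i (y - (x : 'rV[R]_n)) * psi x.
have mq0 : measurable_fun setT q0.
  rewrite /q0; apply: measurable_funM; last exact: mp.
  exact: (measurableT_comp (@measurable_chi R n 0%N) msub).
have mq j i : measurable_fun setT (q j i).
  by apply: measurable_funM => //; exact: meas_pcell.
have q0w x : `|q0 x| <= w x.
  by rewrite normrM ger0_norm ?chi_ge0// (le_trans _ (pw x))// ler_piMl// chi_le1.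
have qw j i x : `|q j i x| <= w x.
  by rewrite normrM ger0_norm ?pcell_ge0// (le_trans _ (pw x))// ler_piMl// pcell_le1.
have q0s x : q0 x != 0 -> inb 1 (y - x : 'rV[R]_n).
  by rewrite /q0 /chi /= andbT expr0; case: (inb 1 _) => //; rewrite mul0r eqxx.
have qs j i x : q j i x != 0 -> inb (2 ^+ j.+1) (y - x : 'rV[R]_n) /\ 2 ^+ j < `|(y - x : 'rV[R]_n) 0 i|.
  move=> H; apply: pcell_supp; apply: contraNneq H => p0.
  by rewrite /q p0 mul0r.
have dec x : psi x = q0 x + \sum_(p <- index_enum ('I_J * 'I_n)%type) q p.1 p.2 x.
  transitivity (\sum_(k < J.+1) chi k (y - (x : 'rV[R]_n)) * psi x).
    rewrite -mulr_suml chi_sum; have [->|/sp ->] := eqVneq (psi x) 0; first by rewrite mulr0.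
    by rewrite mul1r.
  rewrite big_ord_recl; congr (_ + _).
  rewrite -(pair_bigA _ (fun (j : 'I_J) i => q j i x)) /=; apply: eq_bigr => j _.
  by rewrite /q -mulr_suml pcell_sum.
have main e : 0 < e -> L1 mu (fun xi => b xi * Fy psi y s xi) /\
    `|\int[mu]_xi (b xi * Fy psi y s xi)| <= A * Kap * (w y + e).
  move=> e0.
  have [N1 N2 N3] := near_piece s mb A_0 bA mq0 q0w q0s gy e0.
  have F (p : 'I_J * 'I_n) : [/\ L1 mu (q p.1 p.2), L1 mu (fun xi => b xi * Fy (q p.1 p.2) y s xi) &
    `|\int[mu]_xi (b xi * Fy (q p.1 p.2) y s xi)| <=
    A * (cA1 n C * Msig * (2 ^+ n) ^+ n.+2 * (2^-1) ^+ p.1 * (w y + e))].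
    have [be [cb beb mbe beN]] := ch p.2.
    exact: (far_piece s cb beb mbe A_0 A_0 bA beN (mq _ _) (qw _ _) (qs _ _) gy e0).
  have FE (xi : 'rV[R]_n) : b xi * Fy psi y s xi = b xi * Fy q0 y s xi +
      \sum_(p <- index_enum ('I_J * 'I_n)%type) b xi * Fy (q p.1 p.2) y s xi.
    rewrite -mulr_sumr -mulrDr -Fy_sum; last by move=> p; have [] := F p.
    congr (_ * _); rewrite /Fy /Fc -RintD; last 2 first.
    - exact: L1_cosx.
    - by apply: L1_cosx; apply: L1_sum => p; have [] := F p.
    by apply: eq_Rintegral => x _; rewrite dec mulrDl.
  have IS : L1 mu (fun xi => \sum_(p <- index_enum ('I_J * 'I_n)%type) b xi * Fy (q p.1 p.2) y s xi).
    by apply: L1_sum => p; have [] := F p.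
  have I0 : L1 mu (fun xi => b xi * Fy psi y s xi).
    by apply: (L1_eq (L1D N2 IS)) => xi; rewrite FE.
  split; first exact: I0.
  have -> : \int[mu]_xi (b xi * Fy psi y s xi) = \int[mu]_xi (b xi * Fy q0 y s xi) +
      \sum_(p <- index_enum ('I_J * 'I_n)%type) \int[mu]_xi (b xi * Fy (q p.1 p.2) y s xi).
    rewrite -Rint_sum; last by move=> p; have [] := F p.
    by rewrite -(RintD N2 IS); apply: eq_Rintegral => xi _; rewrite FE.
  apply: (le_trans (ler_normD _ _)).
  have we : 0 <= w y + e by rewrite addr_ge0// ltW.
  set T := A * (cA1 n C * Msig * (2 ^+ n) ^+ n.+2 * (w y + e)).
  have T0 : 0 <= T.
    have P : 0 <= (2 ^+ n) ^+ n.+2 :> R by apply: exprn_ge0; apply: exprn_ge0.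
    apply: mulr_ge0; first exact: A_0.
    apply: mulr_ge0; last exact: we.
    apply: mulr_ge0; last exact: P.
    by apply: mulr_ge0; [exact: cA1_ge0|exact: (ltW Msig_gt0)].
  have S2 : `|\sum_(p <- index_enum ('I_J * 'I_n)%type) \int[mu]_xi (b xi * Fy (q p.1 p.2) y s xi)| <= 2 * n%:R * T.
    apply: (le_trans (ler_norm_sum _ _ _)).
    apply: (@le_trans _ _ (\sum_(p <- index_enum ('I_J * 'I_n)%type) T * (2^-1) ^+ p.1)).
      apply: ler_sum => p _; have [_ _ H] := F p; apply: (le_trans H).
      by rewrite /T le_eqVlt; apply/orP; left; apply/eqP; ring.
    rewrite -(pair_bigA _ (fun (j : 'I_J) (i : 'I_n) => T * (2^-1) ^+ j)) /=.
    under eq_bigr do rewrite sumr_const card_ord.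
    rewrite sumrMnl -mulr_sumr.
    rewrite [leRHS](_ : _ = (T * 2) *+ n); last by rewrite -[RHS]mulr_natr; ring.
    rewrite lerMn2r; apply/orP; right; apply: ler_wpM2l; first exact: T0.
    have -> : \sum_(i < J) (2^-1 : R) ^+ i = 2 * (1 - 2^-1 ^+ J).
      elim: J {q0s sp dec F FE IS I0} => [|J' IH]; first by rewrite big_ord0 expr0; ring.
      by rewrite big_ord_recr/= IH exprS; field.
    by rewrite ler_piMr// gerBl exprn_ge0// invr_ge0.
  apply: (le_trans (lerD N3 S2)); rewrite /T /Kap le_eqVlt; apply/orP; left; apply/eqP; ring.
split; first by have [] := main 1 ltr01.
have Ac0 : 0 <= A * Kap by rewrite mulr_ge0// Kap_ge0.
apply/ler_addgt0Pr => e e0.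
(* A Kap times this number is at most e; the summand 1 excludes a division by 0. *)
have e'0 : 0 < e / (A * Kap + 1) by rewrite divr_gt0// ltr_wpDl.
have [_] := main _ e'0 => /le_trans; apply.
rewrite mulrDr lerD2l mulrA ler_pdivrMr ?ltr_wpDl//.
rewrite mulrDr mulr1 [leLHS]mulrC lerDl ltW//.
Qed.

End Apriori.

(** * An integrable majorant for all test functions *)

Section Weight.
Variables (R : realType) (n : nat).
Local Notation E := (Esp R n).
Local Notation mu := (leb R n).
Local Notation leb1 := (@lebesgue_measure R).

(** Stands in for w when the representative is constructed: it is integrable, at most 1, and
    multiples of it dominate every Schwartz function as well as every bounded function of bounded
    support. *)
Definition Phi (x : 'rV[R]_n) : R := \prod_(i < n) (1 + x 0 i ^+ 2)^-1.

Lemma Phi_gt0 x : 0 < Phi x.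
Proof. by apply: prodr_gt0 => i _; rewrite invr_gt0 ltr_wpDr ?sqr_ge0. Qed.

Lemma Phi_le1 x : Phi x <= 1.
Proof.
apply: prodr_ile1 => i _; rewrite invr_ge0 addr_ge0 ?sqr_ge0//=.
by rewrite invf_le1 ?lerDl ?sqr_ge0// ltr_wpDr ?sqr_ge0.
Qed.

Lemma measurable_Phi : measurable_fun setT (Phi : E -> R).
Proof.
apply: meas_prod => i; apply: meas_inv; apply: measurable_funD => //.
by apply: measurable_funX; exact: measurable_coord.
Qed.

Lemma oneDsqrV_int : (\int[leb1]_t ((1 + t ^+ 2)^-1)%:E = pi%:E)%E.
Proof.
rewrite (@ge0_symfun_integralT R (fun t => (1 + t ^+ 2)^-1)).
- rewrite (_ : [set x | _] = `[0, +oo[%classic); last first.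
    by apply/seteqP; split => x/=; rewrite in_itv/= andbT.
  have := @integral0y_oneDsqr R; rewrite /= => ->.
  by rewrite -EFinM; congr (_%:E); field.
- by move=> t; rewrite invr_ge0 addr_ge0 ?sqr_ge0.
- exact: continuous_oneDsqrV.
- by move=> t /=; rewrite sqrrN.
Qed.

Lemma Phi_L1 : L1 mu Phi.
Proof.
apply: L1_lty; first exact: measurable_Phi.
under eq_integral do rewrite (gtr0_norm (Phi_gt0 _)).
rewrite (@prod_int R n (fun _ t => (1 + t ^+ 2)^-1) (fun=> pi)) ?ltry//.
- by move=> i; apply: meas_inv; apply: measurable_funD.
- by move=> i t; rewrite invr_ge0 addr_ge0 ?sqr_ge0.
- by move=> i; exact: oneDsqrV_int.
Qed.

(** Its square 1/2 is the smallest rate that [dyadic_fourier_bound] admits. *)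
Definition etaV : R := Num.sqrt 2^-1.

Lemma etaV2 : etaV ^+ 2 = 2^-1. Proof. by rewrite sqr_sqrtr// invr_ge0. Qed.
Lemma etaV01 : 0 < etaV < 1.
Proof.
rewrite sqrtr_gt0 invr_gt0 ltr0n/= -sqrtr1 ltr_sqrt// invf_lt1// ltr1n//.
Qed.

Definition PhiB : R := 2 ^+ n + \int[mu]_x Phi x.

Lemma PhiB_gt0 : 0 < PhiB.
Proof. by rewrite ltr_pwDl ?exprn_gt0// Rint_ge0// => x; rewrite ltW// Phi_gt0. Qed.

(** As [Phi] is at most 1, the mass on a cube of radius 2^-l about any centre is at most D 2^n
    2^(-ln), hence at most D 2^n 2^-l for n > 0. [PhiB] majorizes both 2^n and the total mass of
    [Phi]. *)
Lemma Phi_growth (n_gt0 : (0 < n)%N) (psi : E -> R) D : 0 < D ->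
  measurable_fun setT psi -> (forall x, `|psi x| <= D * Phi x) ->
  [/\ L1 mu psi, \int[mu]_y `|psi y| <= D * PhiB &
   forall x l, \int[mu]_y (`|psi y| * (inb (2 ^- l) (x - y : 'rV[R]_n))%:R) <= (etaV ^+ 2) ^+ l * (D * PhiB)].
Proof.
move=> D0 mp pD; have I := L1_dom mp (L1Z D Phi_L1) pD.
split; first exact: I.
  apply: (le_trans (Rint_le (L1_norm I) (L1Z D Phi_L1) pD)).
  rewrite (RintZ D Phi_L1); apply: ler_wpM2l; first exact: ltW.
  by rewrite lerDr exprn_ge0.
move=> x l; have l0 : 0 <= 2 ^- l :> R by rewrite invr_ge0 exprn_ge0.
have [I1 V1] := inb_int x l0.
have I2 := L1_inb (2 ^- l) x (L1_norm I).
apply: (@le_trans _ _ (\int[mu]_y (D * (inb (2 ^- l) (x - (y : 'rV[R]_n)))%:R))).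
  apply: (Rint_le I2 (L1Z D I1)) => y; apply: ler_wpM2r; first exact: ler0n.
  by apply: (le_trans (pD y)); rewrite ler_piMr ?Phi_le1// ltW.
rewrite (RintZ D I1) V1 etaV2 mulrCA; apply: ler_wpM2l; first exact: ltW.
rewrite exprMn [leLHS]mulrC; apply: ler_pM.
- by apply: exprn_ge0.
- by apply: exprn_ge0.
- rewrite -exprVn; apply: ler_iXnr => //.
  by apply: exprn_ile1; rewrite ?invr_ge0// invf_le1// ler1n.
- by rewrite lerDl Rint_ge0// => y; rewrite ltW// Phi_gt0.
Qed.

End Weight.

(** * Construction of the representing functions *)

Lemma meas_sg (R : realType) d (X : measurableType d) (f : X -> R) :
  measurable_fun setT f -> measurable_fun setT (fun x => Num.sg (f x)).
Proof.
move=> mf; rewrite /Num.sg; apply: measurable_fun_ifT => //.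
  exact: measurable_fun_eqr.
by apply: measurable_fun_ifT => //; exact: measurable_fun_ltr.
Qed.

Section AeBound.
Context d (X : measurableType d) (R : realType).
Variable mu : {measure set X -> \bar R}.

(** Beppo Levi: the increasing limit has a finite integral, so it is finite off a null set. [G] is
    the set where it is finite and [H] its real-valued version. *)
Lemma ae_bounded_mono (S : nat -> X -> R) M :
  (forall K, L1 mu (S K)) -> (forall K x, 0 <= S K x) ->
  (forall x, {homo S ^~ x : k l / (k <= l)%N >-> k <= l}) ->
  (forall K, \int[mu]_x S K x <= M) ->
  exists (G : set X) (H : X -> R), [/\ measurable G, mu.-negligible (~` G), L1 mu H &
    (forall x, 0 <= H x) /\ forall K x, G x -> S K x <= H x].
Proof.
move=> IS S0 nd SM.
pose F x := limn (fun K => (S K x)%:E).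
have cF x : (fun K => (S K x)%:E) @ \oo --> F x.
  by apply: ereal_nondecreasing_is_cvgn => k l kl; rewrite lee_fin; exact: nd.
have SF K x : ((S K x)%:E <= F x)%E.
  apply: (cvge_to_ge (cF x)); exists K => // l Kl /=; rewrite lee_fin; exact: nd.
have F0 x : (0 <= F x)%E by apply: le_trans (SF 0%N x); rewrite lee_fin.
have mF : measurable_fun setT F.
  apply: (emeasurable_fun_cvg (fun k x => (S k x)%:E)) => [k|x _]; last exact: cF.
  by apply/measurable_EFinP; exact: L1_meas.
have FM : (\int[mu]_x F x <= M%:E)%E.
  rewrite /F monotone_convergence//.
  - apply: lime_le.
      apply: ereal_nondecreasing_is_cvgn => k l kl; rewrite -!EFin_int// lee_fin.
      by apply: Rint_le => // x; exact: nd.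
    by apply: nearW => K; rewrite -EFin_int// lee_fin.
  - by move=> k; apply/measurable_EFinP; exact: L1_meas.
  - by move=> k x _; rewrite lee_fin.
  - by move=> x _ k l kl; rewrite lee_fin; exact: nd.
have IF : mu.-integrable setT F.
  apply/integrableP; split => //.
  under eq_integral do rewrite gee0_abs//.
  exact: le_lt_trans FM (ltry _).
have mfF : measurable_fun setT (fine \o F) by exact: measurableT_comp.
exists (F @^-1` [set y | y \is a fin_num]), (fine \o F); split.
- by rewrite -[X in measurable X]setTI; exact: emeasurable_fin_num.
- have := integrable_ae measurableT IF; apply: negligibleS => x /= nx H.
  by apply: nx; exact: H.
- rewrite /L1; apply: (le_integrable measurableT _ _ IF); first exact/measurable_EFinP.
  move=> x _ /=; rewrite gee0_abs ?lee_fin ?normr_ge0//.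
  by rewrite ger0_norm ?fine_ge0//; case: (F x) (F0 x) => //= *; rewrite leey.
- split=> [x|K x /= Fx]; first by rewrite /= fine_ge0.
  by rewrite -lee_fin fineK.
Qed.

End AeBound.

Section Construct.
Variables (R : realType) (n : nat) (n_gt0 : (0 < n)%N).
Local Notation E := (Esp R n).
Local Notation mu := (leb R n).
Local Notation eta := (etaV R).
Local Notation K0 := (5 * (4 * expR 1) ^+ n : R).
Local Notation PB := (PhiB R n).

Lemma Fy_chi (psi : E -> R) D (y : 'rV[R]_n) s : 0 < D -> measurable_fun setT psi ->
  (forall x, `|psi x| <= D * Phi x) ->
  (forall k, L1 mu (fun xi => chi k xi * jbV xi * `|Fy psi y s xi|) /\
    \int[mu]_xi (chi k xi * jbV xi * `|Fy psi y s xi|) <= K0 * eta ^+ k * (D * PB)) /\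
  L1 mu (fun xi => jbV xi * `|Fy psi y s xi|) /\
    \int[mu]_xi (jbV xi * `|Fy psi y s xi|) <= K0 / (1 - eta) * (D * PB).
Proof.
move=> D0 mp pD; have [Ip pB gr] := Phi_growth n_gt0 D0 mp pD.
have DB0 : 0 < D * PB by rewrite mulr_gt0// PhiB_gt0.
have e2 : 2^-1 <= eta ^+ 2 by rewrite etaV2.
have /andP[e0 e1] := etaV01 R.
have mph := meas_phaseFy y s.
split=> [k|]; first exact: (dyadic_fourier_bound k Ip DB0 e0 e2 pB (fun x _ l => gr x l) mph).
exact: (fourier_jbV_bound Ip DB0 (etaV01 R) e2 pB (fun x _ l => gr x l) mph).
Qed.

Variables (b : E * E -> R) (q : E -> R) (A s : R).
Hypotheses (mb : measurable_fun setT b) (A0 : 0 <= A)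
  (bA : forall y xi, `|b (y, xi)| <= A * jbV xi) (Iq : L1 mu q).

Definition ck (z : E * (E * E)) : R := cos (dotR z.1 z.2.2 + (s - dotR z.2.1 z.2.2)).
Definition fk k (p : E * E) : R := chi k p.2 * b p * q p.1.
(** The frequency piece of one component of the operator, up to the factor (2 pi)^-n: on a bounded
    annulus the oscillatory integral converges absolutely. *)
Definition vk k (x : E) : R := \int[prod_meas mu mu]_p (fk k p * ck (x, p)).

Lemma measurable_ck : measurable_fun setT ck.
Proof.
apply: meas_cos; apply: measurable_funD; first by apply: meas_dotR => //; exact: measurableT_comp.
by apply: measurable_funB => //; apply: meas_dotR; exact: measurableT_comp.
Qed.

Lemma chi_jbV_L1 k : L1 mu (fun xi => chi k xi * jbV xi).
Proof.
have r0 : 0 < 2 ^- k :> R by rewrite invr_gt0 exprn_gt0.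
apply: (@L1_dom _ _ _ _ (fun xi : E => (2 * 2 ^- k) ^+ n * expR 1 ^+ n * rho (2 ^- k) xi)).
- apply: measurable_funM; first exact: measurable_chi.
  exact: meas_jbV.
- exact: (L1Z _ (rho_L1 n r0)).
- move=> xi; rewrite ger0_norm; first exact: chi_jb.
  by rewrite mulr_ge0 ?chi_ge0 ?jbV_ge0.
Qed.

Lemma mbchi k : measurable_fun setT (fun p : E * E => chi k p.2 * b p).
Proof.
apply: measurable_funM => //.
exact: (measurableT_comp (@measurable_chi R n k) measurable_snd).
Qed.

Lemma bchi_le k y xi : `|chi k xi * b (y, xi)| <= A * (chi k xi * jbV xi).
Proof.
by rewrite normrM ger0_norm ?chi_ge0// mulrCA; apply: ler_wpM2l; [exact: chi_ge0|exact: bA].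
Qed.

Lemma L1_fk k : L1 (prod_meas mu mu) (fk k).
Proof.
apply: (L1_dom _ (L1_tensor (L1_norm Iq) (L1Z A (chi_jbV_L1 k)))).
  apply: measurable_funM; first exact: mbchi.
  exact: (measurableT_comp (L1_meas Iq) measurable_fst).
case=> y xi; rewrite /fk /= normrM mulrC; apply: ler_wpM2l => //; exact: bchi_le.
Qed.

Lemma meas_vk k : measurable_fun setT (vk k).
Proof. exact: (measurable_kerx (L1_fk k) measurable_ck (fun z => cos_max _)). Qed.

Lemma L1_bF k (g : E -> R) y : L1 mu g -> L1 mu (fun xi => chi k xi * b (y, xi) * Fy g y s xi).
Proof.
move=> Ig; apply: (L1_dom _ (L1Z (\int[mu]_x `|g x|) (L1Z A (chi_jbV_L1 k)))).
  apply: measurable_funM; last exact: measurable_Fy.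
  exact: (measurableT_comp (mbchi k) (measurable_pair1 y)).
by move=> xi; rewrite normrM mulrC; apply: ler_pM => //; [exact: Fc_bound|exact: bchi_le].
Qed.

Lemma vk_pair k (g : E -> R) : L1 mu g ->
  [/\ L1 mu (fun x => g x * vk k x),
   L1 mu (fun y => q y * \int[mu]_xi (chi k xi * b (y, xi) * Fy g y s xi)) &
   \int[mu]_x (g x * vk k x) = \int[mu]_y (q y * \int[mu]_xi (chi k xi * b (y, xi) * Fy g y s xi))].
Proof.
move=> Ig; have [I1 I2 ->] := swap_int Ig (L1_fk k) measurable_ck (fun z => cos_max _).
have IE y xi : q y * (chi k xi * b (y, xi) * Fy g y s xi) = fk k (y, xi) * \int[mu]_x (g x * ck (x, (y, xi))).
  by rewrite /fk /=; set F := \int[mu]_x _; rewrite -/(Fy g y s xi) -/F; rewrite mulrA mulrC [q y * _]mulrC mulrC.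
have Iy y : L1 mu (fun xi => fk k (y, xi) * \int[mu]_x (g x * ck (x, (y, xi)))).
  exact: (L1_eq (L1Z (q y) (L1_bF k y Ig)) (IE y)).
have [I3 ->] := Rfubini1 I2 Iy.
have qE y : q y * \int[mu]_xi (chi k xi * b (y, xi) * Fy g y s xi) =
   \int[mu]_xi (fk k (y, xi) * \int[mu]_x (g x * ck (x, (y, xi)))).
  by rewrite -(RintZ (q y) (L1_bF k y Ig)); apply: eq_Rintegral => xi _; exact: IE.
split; [exact: I1|exact: (L1_eq I3 (fun y => esym (qE y)))|].
by apply: eq_Rintegral => y _; rewrite qE.
Qed.

Local Notation Q := (\int[mu]_y `|q y|).

(** By duality: the test function sgn(vk) Phi turns the L^1(Phi) norm into a pairing, and after
    Fubini the annulus estimate applies for each y. The factor eta^k makes the pieces summable in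
    L^1(Phi). *)
Lemma vk_Phi k : L1 mu (fun x => `|vk k x| * Phi x) /\
  \int[mu]_x (`|vk k x| * Phi x) <= Q * (A * (K0 * PB)) * eta ^+ k.
Proof.
pose g (x : E) : R := Num.sg (vk k x) * Phi x.
have mg : measurable_fun setT g.
  by apply: measurable_funM; [exact: meas_sg (meas_vk k)|exact: measurable_Phi].
have gP x : `|g x| <= 1 * Phi x.
  rewrite normrM normr_sg mul1r (gtr0_norm (Phi_gt0 _)).
  by case: eqP => _ /=; rewrite ?mul0r ?mul1r// ltW// Phi_gt0.
have gE x : g x * vk k x = `|vk k x| * Phi x by rewrite /g mulrAC -normrEsg.
have Ig := L1_dom mg (L1Z 1 (@Phi_L1 R n)) gP.
have [I1 I2 E1] := vk_pair k Ig.
split; first exact: (L1_eq I1 gE).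
under eq_Rintegral do rewrite -gE.
rewrite E1; apply: le_trans (ler_norm _) _.
have /andP[e0 _] := etaV01 R.
apply: (@le_trans _ _ (\int[mu]_y ((A * (K0 * eta ^+ k * (1 * PB))) * `|q y|))).
  apply: (Rint_norm_le I2 (L1Z _ (L1_norm Iq))) => y.
  rewrite normrM mulrC; apply: ler_wpM2r => //.
  have [H _] := Fy_chi y s ltr01 mg gP; have [I3 B3] := H k.
  apply: (@le_trans _ _ (\int[mu]_xi (A * (chi k xi * jbV xi * `|Fy g y s xi|)))).
    apply: (Rint_norm_le (L1_bF k y Ig) (L1Z A I3)) => xi.
    by rewrite normrM mulrA; apply: ler_wpM2r => //; exact: bchi_le.
  by rewrite (RintZ A I3); apply: ler_wpM2l.
rewrite (RintZ _ (L1_norm Iq)) le_eqVlt; apply/orP; left; apply/eqP; ring.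
Qed.

Lemma representative : exists v : E -> R, measurable_fun setT v /\
  forall (g : E -> R) (D : R), 0 < D -> measurable_fun setT g -> (forall x, `|g x| <= D * Phi x) ->
  [/\ L1 mu (fun x => v x * g x),
   forall y, L1 mu (fun xi => b (y, xi) * Fy g y s xi),
   L1 mu (fun y => q y * \int[mu]_xi (b (y, xi) * Fy g y s xi)) &
   \int[mu]_x (v x * g x) = \int[mu]_y (q y * \int[mu]_xi (b (y, xi) * Fy g y s xi))].
Proof.
have /andP[e0 e1] := etaV01 R.
pose S K (x : E) : R := \sum_(k < K) (`|vk k x| * Phi x).
have P0 x k : 0 <= `|vk k x| * Phi x by rewrite mulr_ge0// ltW// Phi_gt0.
have IS K : L1 mu (S K) by apply: L1_sum => k; exact: (vk_Phi k).1.
have C0 : 0 <= Q * (A * (K0 * PB)).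
  apply: mulr_ge0; first by apply: Rint_ge0.
  apply: mulr_ge0 => //; apply: mulr_ge0; last exact: ltW (PhiB_gt0 R n).
  by apply: mulr_ge0 => //; apply: exprn_ge0; apply: mulr_ge0 => //; exact: expR_ge0.
have SB K : \int[mu]_x S K x <= Q * (A * (K0 * PB)) / (1 - eta).
  rewrite /S Rint_sum; last by move=> k; exact: (vk_Phi k).1.
  apply: (@le_trans _ _ (\sum_(k < K) Q * (A * (K0 * PB)) * eta ^+ k)).
    by apply: ler_sum => k _; exact: (vk_Phi k).2.
  rewrite -mulr_sumr; apply: ler_wpM2l => //.
  have e1' : 0 < 1 - eta by rewrite subr_gt0.
  rewrite -[(1 - eta)^-1]mul1r ler_pdivlMr// mulrC.
  have -> : (1 - eta) * \sum_(i < K) eta ^+ i = 1 - eta ^+ K.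
    by rewrite -[in RHS](expr1n R K) subrXX; congr (_ * _); apply: eq_bigr => i _; rewrite expr1n mul1r.
  by rewrite gerBl exprn_ge0// ltW.
have S0 K x : 0 <= S K x by apply: sumr_ge0 => k _; exact: P0.
have Snd x : {homo S ^~ x : k l / (k <= l)%N >-> k <= l}.
  apply: homo_leq => [//|y z t|k]; first exact: le_trans.
  by rewrite /S big_ord_recr/= lerDl; exact: P0.
have [G [H [mG nG IH [H0 SH]]]] := ae_bounded_mono IS S0 Snd SB.
(* Cutting the terms off outside [G] makes the series converge at every point. *)
pose vS K (x : E) : R := \sum_(k < K) vk k x * \1_G x.
pose v (x : E) : R := limn (vS ^~ x).
have S_norm K x : `|vS K x| * Phi x <= H x.
  rewrite /vS indicE; case: (boolP (x \in G)) => [/set_mem Gx|_] /=; last first.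
    by rewrite big1 ?normr0 ?mul0r// => k _; rewrite mulr0.
  apply: le_trans (SH K x Gx); rewrite /S -[leRHS]mulr_suml; apply: ler_wpM2r.
    exact: ltW (Phi_gt0 _).
  by apply: (le_trans (ler_norm_sum _ _ _)); apply: ler_sum => k _; rewrite mulr1.
have cv x : (vS ^~ x) @ \oo --> v x.
  have vE : vS ^~ x = series (fun k => vk k x * \1_G x).
    by apply/funext => K; rewrite /series/= big_mkord.
  suff : cvgn (vS ^~ x) by exact.
  rewrite vE; apply: normed_cvg; apply: nondecreasing_is_cvgn.
    apply/nondecreasing_seqP => K; rewrite /= /series/= big_nat_recr//= lerDl//.
  exists (H x / Phi x) => _ [K _ <-]; rewrite ler_pdivlMr ?Phi_gt0//=.
  rewrite /series/= big_mkord indicE; case: (boolP (x \in G)) => [/set_mem Gx|_] /=; last first.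
    by rewrite big1 ?mul0r// => k _; rewrite mulr0 normr0.
  apply: le_trans (SH K x Gx); rewrite /S -[leRHS]mulr_suml; apply: ler_wpM2r.
    exact: ltW (Phi_gt0 _).
  by apply: ler_sum => k _; rewrite mulr1.
have mvS K : measurable_fun setT (vS K).
  apply: meas_sum => k; apply: measurable_funM; first exact: meas_vk.
  exact: measurable_indic.
have mv : measurable_fun setT v by apply: (measurable_fun_cvg mvS) => x _; exact: cv.
exists v; split; first exact: mv.
move=> g D D0 mg gD.
have [Ig _ _] := Phi_growth n_gt0 D0 mg gD.
have vSgD K x : `|vS K x * g x| <= D * H x.
  rewrite normrM; apply: (@le_trans _ _ (`|vS K x| * (D * Phi x))); first exact: ler_wpM2l.
  by rewrite mulrCA; apply: ler_wpM2l; [exact: ltW|exact: S_norm].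
have mvSg K : measurable_fun setT (fun x => vS K x * g x) by apply: measurable_funM; [exact: mvS|exact: mg].
have mvg : measurable_fun setT (fun x => v x * g x) by apply: measurable_funM; [exact: mv|exact: mg].
have cvg0 x : (fun K => vS K x * g x) @ \oo --> v x * g x by apply: cvgM; [exact: cv|exact: cvg_cst].
have [Ivg cvg1] := Rint_dcvg mvSg mvg cvg0 (L1Z D IH) vSgD.
have Iy y : L1 mu (fun xi => b (y, xi) * Fy g y s xi).
  have [_ [IF _]] := Fy_chi y s D0 mg gD.
  apply: (L1_dom _ (L1Z A IF)); last first.
    by move=> xi; rewrite normrM mulrA; apply: ler_wpM2r.
  apply: measurable_funM; last exact: measurable_Fy.
  exact: (measurableT_comp mb (measurable_pair1 y)).
pose h (y : E) : R := \int[mu]_xi (b (y, xi) * Fy g y s xi).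
pose hK K (y : E) : R := \int[mu]_xi ((inb (2 ^+ K) xi)%:R * (b (y, xi) * Fy g y s xi)).
pose B := A * (K0 / (1 - eta) * (D * PB)).
have minb K : measurable_fun setT (fun xi : E => (inb (2 ^+ K) xi)%:R : R) by exact: meas_inb.
have hKcv y : hK ^~ y @ \oo --> h y.
  have [_ [IF _]] := Fy_chi y s D0 mg gD.
  apply: (@Rint_dcvg _ _ _ mu _ _ (fun xi => A * (jbV xi * `|Fy g y s xi|)) _ (L1_meas (Iy y)) _ (L1Z A IF) _).2.
  - by move=> K; apply: measurable_funM; [exact: minb|exact: (L1_meas (Iy y))].
  - move=> xi; apply: cvg_near_cst; have [N0 HN] := inb_ev xi.
    by exists N0 => // K /= NK; rewrite (HN _ NK) mul1r.
  - move=> K xi; rewrite normrM normrM mulrA; apply: (@le_trans _ _ (`|b (y, xi)| * `|Fy g y s xi|)).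
      by apply: ler_wpM2r => //; rewrite ler_piMl ?normr_inb.
    by rewrite mulrA; apply: ler_wpM2r.
have hKB K y : `|hK K y| <= B.
  have [_ [IF FB]] := Fy_chi y s D0 mg gD.
  apply: (@le_trans _ _ (\int[mu]_xi (A * (jbV xi * `|Fy g y s xi|)))).
    have IK : L1 mu (fun xi => (inb (2 ^+ K) xi)%:R * (b (y, xi) * Fy g y s xi)).
      by apply: (@L1_mulb _ _ _ _ 1); [exact: minb|exact: normr_inb|exact: Iy].
    apply: (Rint_norm_le IK (L1Z A IF)) => xi.
    rewrite normrM normrM; apply: (@le_trans _ _ (`|b (y, xi)| * `|Fy g y s xi|)).
      by rewrite ler_piMl ?normr_inb// mulr_ge0.
    by rewrite mulrA; apply: ler_wpM2r.
  by rewrite (RintZ A IF); apply: ler_wpM2l.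
have hKE K y : q y * hK K y = \sum_(k < K.+1) q y * \int[mu]_xi (chi k xi * b (y, xi) * Fy g y s xi).
  rewrite -mulr_sumr; congr (_ * _); rewrite -Rint_sum; last by move=> k; exact: L1_bF.
  by apply: eq_Rintegral => xi _; rewrite -chi_sum mulr_suml; apply: eq_bigr => k _; rewrite mulrA.
have IqK k : L1 mu (fun y => q y * \int[mu]_xi (chi k xi * b (y, xi) * Fy g y s xi)).
  by have [] := vk_pair k Ig.
have IhK K : L1 mu (fun y => q y * hK K y).
  exact: (L1_eq (L1_sum _ _ (fun k : 'I_K.+1 => IqK k)) (fun y => esym (hKE K y))).
have qcv y : (fun K => q y * hK K y) @ \oo --> q y * h y by apply: cvgM; [exact: cvg_cst|exact: hKcv].
have mqh : measurable_fun setT (fun y => q y * h y).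
  by apply: (measurable_fun_cvg (fun K => L1_meas (IhK K))) => y _; exact: qcv.
have qhB K y : `|q y * hK K y| <= B * `|q y|.
  by rewrite normrM mulrC; apply: ler_wpM2r => //; exact: hKB.
have [Iqh cvg2] := Rint_dcvg (fun K => L1_meas (IhK K)) mqh qcv (L1Z B (L1_norm Iq)) qhB.
split; [exact: Ivg|exact: Iy|exact: Iqh|].
(* K + 1 annuli fill the cube of radius 2^K, hence the shift of the index. *)
have EK K : \int[mu]_x (vS K.+1 x * g x) = \int[mu]_y (q y * hK K y).
  have I1 : L1 mu (fun x => \sum_(k < K.+1) g x * vk k x).
    by apply: L1_sum => k; have [] := vk_pair k Ig.
  have [|_ <-] := Rint_ae_eq I1 (measurable_funM (mvS K.+1) mg).
    apply: negligibleS nG => x /= nx Gx; apply: nx.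
    rewrite /vS mulr_suml; apply: eq_bigr => k _.
    by rewrite indicE (mem_set Gx) mulr1 mulrC.
  rewrite Rint_sum; last by move=> k; have [] := vk_pair k Ig.
  under [RHS]eq_Rintegral do rewrite hKE.
  by rewrite Rint_sum//; apply: eq_bigr => k _; have [] := vk_pair k Ig.
have cvg1' : (fun K => \int[mu]_y (q y * hK K y)) @ \oo --> \int[mu]_x (v x * g x).
  under eq_fun do rewrite -EK.
  by rewrite -cvg_shiftS in cvg1.
exact: (cvg_unique _ cvg1' cvg2).
Qed.

End Construct.

(** * Duality with the truncated weight *)

Section Weighted.
Variables (R : realType) (n : nat) (n_gt0 : (0 < n)%N).
Local Notation E := (Esp R n).
Local Notation mu := (leb R n).
Variables (w : E -> R) (C : R).
Hypotheses (w0 : forall x, 0 <= w x) (C1 : 1 <= C) (mw : measurable_fun setT w)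
  (wloc : forall x t, L1 mu (fun y => w y * (inb t (x - y : 'rV[R]_n))%:R))
  (wA1 : {ae mu, forall y, goodA1 w C y}).
Variables (b : E * E -> R) (q v : E -> R) (A s : R).
Hypotheses (mv : measurable_fun setT v) (A0 : 0 <= A)
  (bA : forall y xi, `|b (y, xi)| <= A * jbV xi)
  (ch : forall y i, exists be, [/\ chain i be, be 0%N = (fun xi => b (y, xi)),
     (forall m, measurable_fun setT (be m : E -> R)) &
     forall xi, `|be n.+1 xi| <= A * jbV xi])
  (vP : forall (g : E -> R) (D : R), 0 < D -> measurable_fun setT g -> (forall x, `|g x| <= D * Phi x) ->
  [/\ L1 mu (fun x => v x * g x),
   forall y, L1 mu (fun xi => b (y, xi) * Fy g y s xi),
   L1 mu (fun y => q y * \int[mu]_xi (b (y, xi) * Fy g y s xi)) &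
   \int[mu]_x (v x * g x) = \int[mu]_y (q y * \int[mu]_xi (b (y, xi) * Fy g y s xi))]).

Lemma inb_add t u (x y : 'rV[R]_n) : inb t x -> inb u y -> inb (t + u) (x - y).
Proof.
move=> /forallP hx /forallP hy; apply/forallP => i; rewrite !mxE.
by apply: (le_trans (ler_normB _ _)); apply: lerD.
Qed.

Lemma Phi_inb t (x : 'rV[R]_n) : inb t x -> (1 + t ^+ 2) ^- n <= Phi x.
Proof.
move=> /forallP tx; rewrite /Phi -exprVn -[X in _ ^+ X]card_ord -prodr_const.
apply: ler_prod => i _; rewrite invr_ge0 addr_ge0 ?sqr_ge0//=.
rewrite lef_pV2 ?posrE ?ltr_wpDr ?sqr_ge0// lerD2l -real_normK ?num_real//.
rewrite lerXn2r ?nnegrE//; exact: le_trans (tx i).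
Qed.

(** Tested with sgn(v) [wJ], the left side of [vP] is the integral of |v| [wJ]. On the right the
    inner integral is at most A Kap w(y) for almost every y, whatever J is, and monotone convergence
    removes the truncation. *)
Lemma weighted_bound : L1 mu (fun y => q y * w y) ->
  L1 mu (fun x => `|v x| * w x) /\
  \int[mu]_x (`|v x| * w x) <= A * Kap n C * \int[mu]_y (`|q y| * w y).
Proof.
move=> Iqw.
have Iqw' : L1 mu (fun y => `|q y| * w y).
  by apply: (L1_eq (L1_norm Iqw)) => y; rewrite normrM [`|w y|]ger0_norm.
pose wJ J (x : E) : R := Num.min (w x) J%:R * (inb (2 ^+ J) x)%:R.
have wJ0 J x : 0 <= wJ J x by apply: mulr_ge0; rewrite ?ler0n// le_min w0 ler0n.
have wJw J x : wJ J x <= w x.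
  rewrite /wJ; apply: (@le_trans _ _ (Num.min (w x) J%:R)); last by rewrite ge_min lexx.
  by case: inb; rewrite ?mulr1// mulr0 le_min w0 ler0n.
have mwJ J : measurable_fun setT (wJ J).
  by apply: measurable_funM; [apply: measurable_minr => //|exact: meas_inb].
pose g J (x : E) : R := Num.sg (v x) * wJ J x.
have mg J : measurable_fun setT (g J) by apply: measurable_funM; [exact: meas_sg|exact: mwJ].
have gwJ J x : `|g J x| <= wJ J x.
  rewrite normrM normr_sg [X in _ * X]ger0_norm//.
  by case: eqP => _ /=; rewrite ?mul0r ?mul1r.
(* On the cube of radius 2^J, [Phi] is at least (1 + 4^J)^-n; J + 1 in place of J keeps [D]
   positive. *)
pose D J : R := J.+1%:R * (1 + (2 ^+ J) ^+ 2) ^+ n.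
have T0 J : 0 < (1 + (2 ^+ J) ^+ 2) ^+ n :> R by rewrite exprn_gt0// ltr_wpDr ?sqr_ge0.
have D0 J : 0 < D J by rewrite mulr_gt0// ltr0n.
have gD J x : `|g J x| <= D J * Phi x.
  apply: (le_trans (gwJ J x)); rewrite /wJ; case: (boolP (inb _ x)) => [H|_]; last first.
    by rewrite mulr0 mulr_ge0 ?(ltW (D0 J)) ?(ltW (Phi_gt0 _)).
  rewrite mulr1 /D -mulrA -[leLHS]mulr1; apply: ler_pM => //.
  - by rewrite le_min w0 ler0n.
  - by rewrite ge_min; apply/orP; right; rewrite ler_nat.
  - by rewrite -ler_pdivrMl// mulr1; exact: Phi_inb.
have vg J x : v x * g J x = `|v x| * wJ J x by rewrite /g mulrA [v x * _]mulrC -normrEsg.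
have IvJ J : L1 mu (fun x => `|v x| * wJ J x).
  by have [I _ _ _] := vP (D0 J) (mg J) (gD J); exact: (L1_eq I (vg J)).
have vB J : \int[mu]_x (`|v x| * wJ J x) <= A * Kap n C * \int[mu]_y (`|q y| * w y).
  have [_ _ I3 E1] := vP (D0 J) (mg J) (gD J).
  under eq_Rintegral do rewrite -vg.
  rewrite E1 -(RintZ _ Iqw').
  apply: Rint_le_ae; [exact: I3|exact: (L1Z _ Iqw')|].
  apply: negligibleS wA1 => y /= nH gy; apply: nH.
  apply: (le_trans (ler_norm _)); rewrite normrM mulrCA; apply: ler_wpM2l => //.
  have [K0 HK] := inb_ev y.
  (* A common scale for y and for the support of [g J]; the differences then lie in the cube of
     radius 2^(K+1). *)
  pose K := maxn K0 J.
  have sp x : g J x != 0 -> inb (2 ^+ K.+1) (y - x : 'rV[R]_n).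
    move=> gx; have xJ : inb (2 ^+ J) x.
      by apply: contraNT gx => /negbTE H; rewrite /g /wJ H !mulr0.
    rewrite exprS mulr_natl mulr2n; apply: inb_add; first by apply: HK; exact: leq_maxl.
    by apply: inb_le xJ; rewrite ler_weXn2l// ?ler1n//; exact: leq_maxr.
  have gw x : `|g J x| <= w x by exact: le_trans (gwJ J x) (wJw J x).
  exact: (symbol_A1_bound n_gt0 w0 C1 wloc wA1 s (ch y) A0 (bA y) (mg J) gw sp gy).2.
apply: (L1_mono IvJ).
- by move=> k x; apply: mulr_ge0.
- move=> x k l kl; apply: ler_wpM2l => //; apply: ler_pM => //.
  + by rewrite le_min w0 ler0n.
  + by rewrite le_min ge_min lexx /= ge_min ler_nat kl orbT.
  + case: (boolP (inb (2 ^+ k) x)) => [H|_]; last by rewrite ler0n.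
    by rewrite (inb_le _ H)// ler_weXn2l// ler1n.
- move=> x; apply: cvg_near_cst.
  have [K0 HK] := inb_ev x.
  exists (maxn K0 (Num.truncn (w x)).+1) => // k /=; rewrite geq_max => /andP[k1 k2].
  rewrite /wJ HK// mulr1 min_l// (le_trans (ltW (truncnS_gt (w x))))// ler_nat//.
- exact: vB.
Qed.

End Weighted.

(** * Regularization of the symbol and of the weight *)

Lemma negligible_count d (X : measurableType d) (R : realType) (mu : {measure set X -> \bar R})
  (T : countType) (F : T -> set X) :
  (forall t, mu.-negligible (F t)) -> mu.-negligible (\bigcup_t F t).
Proof.
move=> NF.
have NB : mu.-negligible (\bigcup_k (if unpickle k is Some t then F t else set0)).
  apply: negligible_bigcup => k; case: unpickle => [t|]; first exact: NF.
  exact: negligible_set0.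
by apply: negligibleS NB => x [t _ Ft]; exists (pickle t) => //; rewrite pickleK.
Qed.

Lemma measurable_select d (X : measurableType d) (R : realType) (T : countType)
  (f : T -> X -> R) (sel : X -> T) : (forall t, measurable (sel @^-1` [set t])) ->
  (forall t, measurable_fun setT (f t)) -> measurable_fun setT (fun x => f (sel x) x).
Proof.
move=> ms mf _ B mB; rewrite setTI.
rewrite (_ : _ @^-1` B = \bigcup_t (sel @^-1` [set t] `&` (setT `&` f t @^-1` B))).
  apply: countable_bigcupT_measurable => [|t]; first exact: countableP.
  by apply: measurableI; [exact: ms|exact: mf].
apply/seteqP; split => [x Bx|x [t _ [/= <- [_ H]]] //].
by exists (sel x).
Qed.

Section Grid.
Variables (R : realType) (n : nat).
Local Notation E := (Esp R n).
Local Notation mu := (leb R n).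

Definition gp (p : 'rV[int]_n * nat) : 'rV[R]_n := \row_i ((p.1 0 i)%:~R / 2 ^+ p.2).
Definition gsel (j : nat) (xi : 'rV[R]_n) : 'rV[int]_n * nat :=
  (\row_i Num.floor (2 ^+ j * xi 0 i), j).

Lemma gp_near j (xi : 'rV[R]_n) i : `|xi 0 i - gp (gsel j xi) 0 i| <= 2 ^- j.
Proof.
have j0 : 0 < 2 ^+ j :> R by rewrite exprn_gt0.
rewrite !mxE /= -(ler_pM2l j0) divff ?gt_eqF// -{1}(gtr0_norm j0) -normrM mulrBr mulrCA divff ?gt_eqF// mulr1.
have := floor_itv (2 ^+ j * xi 0 i); move: (2 ^+ j * xi 0 i) => t /andP[h1 h2].
rewrite ger0_norm ?subr_ge0// lerBlDl; apply: (le_trans (ltW h2)).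
by rewrite intrD.
Qed.

Lemma gp_cvg (xi : 'rV[R]_n) : (fun j => gp (gsel j xi)) @ \oo --> xi.
Proof.
move=> A /obox_nbhs[e e0 HA].
have : \forall j \near \oo, (2^-1 : R) ^+ j < e.
  have := @cvg_expr R 2^-1; rewrite ger0_norm ?invr_ge0// invf_lt1// ltr1n => /(_ isT).
  by move/cvgrPdist_lt => /(_ e e0); apply: filterS => j; rewrite sub0r normrN ger0_norm// exprn_ge0// invr_ge0.
apply: filterS => j je; apply: HA => i.
have := gp_near j xi i; rewrite -exprVn => /le_lt_trans /(_ je).
by rewrite ltr_distlC => /andP[h1 h2]; apply/andP; split; lra.
Qed.

Lemma measurable_gsel j p : measurable (gsel j @^-1` [set p] : set E).
Proof.
case: p => m k; have [->|kj] := eqVneq k j; last first.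
  rewrite (_ : _ @^-1` _ = set0)//; apply/seteqP; split => // xi [_ jk].
  by move/eqP: kj; rewrite jk.
rewrite (_ : _ @^-1` _ = \bigcap_(i : 'I_n)
    ((fun xi : 'rV[R]_n => 2 ^+ j * xi 0 i) @^-1` `[(m 0 i)%:~R, (m 0 i + 1)%:~R[%classic)).
  apply: fin_bigcap_measurable => // i _; rewrite -[X in measurable X]setTI.
  have : measurable_fun setT (fun xi : E => 2 ^+ j * (xi : 'rV[R]_n) 0 i).
    by apply: measurable_funM => //; exact: measurable_coord.
  by apply.
apply/seteqP; split => xi /=.
  by case=> <- i _; rewrite mxE /= in_itv/=; exact: floor_itv.
move=> H; rewrite /gsel; congr pair; apply/rowP => i; rewrite mxE.
by apply: floor_def; have := H i Logic.I; rewrite /= in_itv/=.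
Qed.

End Grid.

Section Symbol.
Variables (R : realType) (n : nat).
Local Notation E := (Esp R n).
Local Notation mu := (leb R n).
Variable c : 'rV[R]_n -> 'rV[R]_n -> R.
Hypotheses (mc : forall xi, lmeasfun (fun x => c x xi)) (sc : forall x, smooth (c x))
  (bc : forall al : 'I_n -> nat, exists C : R, forall xi,
     ae (fun x => `|dpartial al (c x) xi| <= C * jb xi `^ (- n%:R - 0 * mabs R al))).

Lemma jb_powV (xi : 'rV[R]_n) t : jb xi `^ (- n%:R - 0 * t) = jbV xi.
Proof.
by rewrite mul0r subr0 powRN powR_mulrn// (le_trans ler01)// jb_ge1.
Qed.

Definition single (i : 'I_n) m : 'I_n -> nat := fun j => if j == i then m else 0%N.

Lemma dpartial0 (f : 'rV[R]_n -> R) : dpartial (fun=> 0%N) f = f.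
Proof. by rewrite /dpartial; elim: (enum _) => //= a l ->. Qed.

Lemma dpartial_single i m (f : 'rV[R]_n -> R) : dpartial (single i m) f = iter m (partial i) f.
Proof.
rewrite /dpartial; have := enum_uniq 'I_n; have : i \in enum 'I_n by rewrite mem_enum.
elim: (enum 'I_n) => //= a l IH; rewrite inE => /orP[/eqP <-|il] /andP[al ul].
  rewrite /single eqxx; congr (iter _ _ _).
  elim: l al {IH ul} => //= a' l IH'; rewrite inE negb_or => /andP[ia al].
  by rewrite [a' == i]eq_sym (negbTE ia) /= IH'.
have /negbTE ai : a != i by apply: contraNneq al => ->.
by rewrite {1}/single ai /= IH.
Qed.

(** In the symbol class the exceptional null set depends on xi. It is collected over the countable
    dyadic grid, and continuity in xi extends the bound from the grid to all xi. *)
Lemma symbol_bound (al : 'I_n -> nat) : exists2 A, 0 <= A &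
  {ae mu, forall y, forall xi, `|dpartial al (c y) xi| <= A * jbV xi}.
Proof.
have [A HA] := bc al.
have j0 (xi : 'rV[R]_n) : 0 <= jbV xi by exact: jbV_ge0.
exists `|A| => //.
have NH p : mu.-negligible [set y | ~ `|dpartial al (c y) (gp R p)| <= `|A| * jbV (gp R p)].
  have /aeP := HA (gp R p); apply: negligibleS => y /= nH H; apply: nH.
  apply: (le_trans H); rewrite jb_powV; apply: ler_wpM2r => //; exact: ler_norm.
apply: negligibleS (negligible_count NH) => y /= nH; apply: contrapT => H; apply: nH => xi.
have {}H p : `|dpartial al (c y) (gp R p)| <= `|A| * jbV (gp R p).
  by apply: contrapT => H'; apply: H; exists p.
have cd : {for xi, continuous (dpartial al (c y))}.
  exact: differentiable_continuous (sc y al xi).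
have c1 : (fun j => `|dpartial al (c y) (gp R (gsel j xi))|) @ \oo --> `|dpartial al (c y) xi|.
  by apply: cvg_norm; apply: (cvg_comp _ _ (@gp_cvg R n xi)); exact: cd.
have c2 : (fun j => `|A| * jbV (gp R (gsel j xi))) @ \oo --> `|A| * jbV xi.
  by apply: cvgM; [exact: cvg_cst|apply: (cvg_comp _ _ (@gp_cvg R n xi)); exact: cont_jbV].
by apply: (ler_cvg_to c1 c2); apply: nearW => j; exact: H.
Qed.

(* The symbol is sampled on dyadic grids in [xi], where only countably many exceptional null sets arise. *)
Lemma symbol_measurable : exists2 N : set E, measurable N /\ mu N = 0 &
  measurable_fun setT (fun p : E * E => \1_(~` N) p.1 * c p.1 p.2).
Proof.
have /choice[G HG] : forall p, exists g : E -> R, measurable_fun setT g /\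
    {ae mu, forall y, c y (gp R p) = g y}.
  by move=> p; have [g ? ?] := lmeasfun_borel (mc (gp R p)); exists g.
have [N [mN N0 HN]] := negligible_count (fun p => (HG p).2).
exists N => //.
apply: (measurable_fun_cvg (h := fun j (p : E * E) => \1_(~` N) p.1 * G (gsel j p.2) p.1)).
  move=> j; apply: measurable_funM.
    by apply: (measurableT_comp _ measurable_fst); apply: measurable_indic; exact: measurableC.
  apply: (measurable_select (sel := fun p : E * E => gsel j p.2) (f := fun t (p : E * E) => G t p.1)).
    move=> t; rewrite -[X in measurable X]setTI.
    exact: (@measurable_snd _ _ E E measurableT _ (@measurable_gsel R n j t)).
  by move=> t; exact: (measurableT_comp (HG t).1 measurable_fst).
move=> [y xi] _ /=; rewrite indicE; case: (boolP (y \in ~` N)) => [/set_mem /= yN|_]; last first.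
  by under eq_fun do rewrite mul0r; rewrite mul0r; exact: cvg_cst.
have E1 p : G p y = c y (gp R p).
  by apply: contrapT => H; apply: yN; apply: HN; exists p => // /esym.
under eq_fun do rewrite E1.
apply: cvgM; first exact: cvg_cst.
apply: (cvg_comp _ _ (@gp_cvg R n xi)).
have := differentiable_continuous (sc y (fun=> 0%N) xi).
by rewrite dpartial0.
Qed.

(** On one null set of y the symbol is replaced by 0, so that all bounds hold for every y. The
    bounds concern order 0 and the pure derivatives of order n + 1 in each direction, so finitely
    many constants add up to [A]. *)
Lemma symbol_regular : exists (b : E * E -> R) (A : R), [/\ measurable_fun setT b, 0 <= A,
  (forall y xi, `|b (y, xi)| <= A * jbV xi),
  (forall (y : E) i, exists be, [/\ chain i be, be 0%N = (fun xi => b (y, xi)),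
     (forall m, measurable_fun setT (be m : E -> R)) &
     forall xi, `|be n.+1 xi| <= A * jbV xi]) &
  {ae mu, forall y, forall xi, c y xi = b (y, xi)}].
Proof.
have [N [mN N0] mb] := symbol_measurable.
have [A0 A00 H0] := symbol_bound (fun=> 0%N).
have /choice[Ai HAi] : forall i : 'I_n, exists A, 0 <= A /\
  {ae mu, forall y, forall xi, `|dpartial (single i n.+1) (c y) xi| <= A * jbV xi}.
  by move=> i; have [A ? ?] := symbol_bound (single i n.+1); exists A.
have [N' [mN' N'0 HN']] := negligibleU H0 (negligible_count (fun i => (HAi i).2)).
pose good (y : E) : R := \1_(~` N') y * \1_(~` N) y.
pose b (p : E * E) : R := good p.1 * c p.1 p.2.
pose A := A0 + \sum_i Ai i.
have AiA i : Ai i <= A.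
  by rewrite /A (bigD1 i)//= addrCA lerDl addr_ge0// sumr_ge0// => k _; exact: (HAi k).1.
have AA0 : A0 <= A by rewrite /A lerDl sumr_ge0// => k _; exact: (HAi k).1.
have A_ge0 : 0 <= A := le_trans A00 AA0.
have j0 (xi : 'rV[R]_n) : 0 <= jbV xi by exact: jbV_ge0.
have gP (y : E) : good y = 0 \/ good y = 1 /\ ~ N' y.
  rewrite /good !indicE; case: (boolP (y \in ~` N')) => [/set_mem yN'|_]; last by left; rewrite mul0r.
  by case: (boolP (y \in ~` N)) => _; [right; rewrite mulr1|left; rewrite mulr0].
exists b, A; split => //.
- rewrite (_ : b = fun p => \1_(~` N') p.1 * (\1_(~` N) p.1 * c p.1 p.2)); last first.
    by apply/funext => p; rewrite /b /good mulrA.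
  apply: measurable_funM => //.
  by apply: (measurableT_comp _ measurable_fst); apply: measurable_indic; exact: measurableC.
- move=> y xi; rewrite /b /=; have [->|[-> yN']] := gP y.
    by rewrite mul0r normr0 mulr_ge0.
  rewrite mul1r; apply: (@le_trans _ _ (A0 * jbV xi)); last exact: ler_wpM2r.
  apply: contrapT => H; apply: yN'; apply: HN'; left => H'; apply: H.
  by have := H' xi; rewrite dpartial0.
- move=> y i; have [g0|[g1 yN']] := gP y.
    exists (fun _ _ => 0); split.
    + by move=> m x; exact: is_derive_cst.
    + by apply/funext => xi; rewrite /b g0 mul0r.
    + by move=> m; exact: measurable_cst.
    + by move=> xi; rewrite normr0 mulr_ge0.
  have dif m xi : differentiable (iter m (partial i) (c y)) xi.
    by have := sc y (single i m) xi; rewrite dpartial_single.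
  exists (fun m => iter m (partial i) (c y)); split.
  + move=> m xi /=; have /derivableP := @diff_derivable _ _ _ _ _ (delta_mx 0 i) (dif m xi).
    exact.
  + by apply/funext => xi; rewrite /b g1 mul1r.
  + move=> m; apply: measurable_cont_Esp => xi; exact: differentiable_continuous.
  + move=> xi; apply: (@le_trans _ _ (Ai i * jbV xi)); last exact: ler_wpM2r.
    apply: contrapT => H; apply: yN'; apply: HN'; right; exists i => // H'; apply: H.
    by have := H' xi; rewrite dpartial_single.
- exists (N `|` N'); split; first exact: measurableU.
    exact: null_set_setU.
  move=> y; apply: contra_notP => /not_orP[yN yN'] xi.
  by rewrite /b /= /good !indicE !mem_set//= mulr1 mul1r.
Qed.

End Symbol.

(** * A Borel version of an A_1 weight *)

Section A1Borel.
Variables (R : realType) (n : nat).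
Local Notation E := (Esp R n).
Local Notation mu := (leb R n).

Lemma cube_inb (x : 'rV[R]_n) t (y : 'rV[R]_n) :
  \1_(cube (x - const_mx t) (2 * t)) y = (inb t (x - y))%:R :> R.
Proof.
rewrite indicE; congr (_%:R); congr nat_of_bool; apply/idP/forallP => [/set_mem H i|H].
  have := H i; rewrite !mxE ler_norml => /andP[h1 h2]; apply/andP; split; lra.
apply/mem_set => i; have := H i; rewrite !mxE ler_norml => /andP[h1 h2].
apply/andP; split; lra.
Qed.

(** A point is good when the maximal inequality holds at it and w equals its Borel version there.
    Cubes given by corner and side 2 t become cubes with centre and radius t through [cube_inb]. *)
Lemma A1_borel (w : 'rV[R]_n -> R) : A1 w ->
  exists (w' : E -> R) (C : R), [/\ measurable_fun setT w', (forall x, 0 <= w' x), 1 <= C,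
    {ae mu, forall x, w x = w' x} &
    (forall x t, L1 mu (fun y => w' y * (inb t (x - y : 'rV[R]_n))%:R)) /\
    {ae mu, forall y, goodA1 w' C y}].
Proof.
case=> w0 mw wfin [C /aeP wC].
have [g mg wg] := lmeasfun_borel mw.
pose w' (x : E) : R := Num.max (g x) 0.
have mw' : measurable_fun setT w' by apply: measurable_maxr.
have w'0 x : 0 <= w' x by rewrite le_max lexx orbT.
have ww' : {ae mu, forall x, w x = w' x}.
  by apply: (aeS wg) => x E1; rewrite /w' -E1 max_l.
have b01 t (z : 'rV[R]_n) : 0 <= (inb t z)%:R :> R by exact: ler0n.
have mwi x t : measurable_fun setT (fun y : E => w' y * (inb t (x - (y : 'rV[R]_n)))%:R).
  by apply: measurable_funM => //; exact: meas_inbB.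
have LE (x : 'rV[R]_n) t : lint (fun y => (\1_(cube (x - const_mx t) (2 * t)) y * w y)%:E) =
    (\int[mu]_y (w' y * (inb t (x - (y : 'rV[R]_n)))%:R)%:E)%E.
  apply: lint_ae; first exact: mwi.
  - by move=> y; rewrite mulr_ge0.
  - by move=> y; rewrite mulr_ge0.
  - by apply: (aeS ww') => y ->; rewrite cube_inb mulrC.
have wloc (x : 'rV[R]_n) t : L1 mu (fun y : E => w' y * (inb t (x - (y : 'rV[R]_n)))%:R).
  apply: L1_lty; first exact: mwi.
  have := wfin (x - const_mx t) (2 * t); rewrite LE.
  by under [X in _ -> (X < _)%E]eq_integral do rewrite (ger0_norm (mulr_ge0 (w'0 _) (b01 _ _))).
exists w', (Num.max C 1); split => //; first by rewrite le_max lexx orbT.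
split=> //.
apply: (aeS (aeI wC ww')) => y [Cy wy] x t t0 xy.
have t2 : 0 < 2 * t by rewrite mulr_gt0.
have T0 : 0 < (2 * t) ^+ n by rewrite exprn_gt0.
have H : ((((2 * t) ^+ n)^-1)%:E * (\int[mu]_y (w' y * (inb t (x - (y : 'rV[R]_n)))%:R)%:E) <= (C * w y)%:E)%E.
  apply: le_trans Cy; apply: ereal_sup_ubound; exists (x - const_mx t), (2 * t); split => //.
    by apply: set_mem; move: (cube_inb x t y); rewrite indicE xy; case: (_ \in _) => // /eqP; rewrite eq_sym oner_eq0.
  by rewrite LE.
move: H; rewrite -(EFin_int (wloc x t)) -EFinM lee_fin ler_pdivrMl// => /le_trans; apply.
rewrite wy mulrA [_ * C]mulrC -!mulrA; apply: ler_wpM2r; first by rewrite mulr_ge0// ltW.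
by rewrite le_max lexx.
Qed.

End A1Borel.

(** * Uniqueness of the representing function *)

Section SchwartzBound.
Variables (R : realType) (n : nat).
Local Notation E := (Esp R n).

Lemma smooth_cont (f : 'rV[R]_n -> R) : smooth f -> continuous f.
Proof.
move=> sf x; have := differentiable_continuous (sf (fun=> 0%N) x).
by rewrite dpartial0.
Qed.

(** With A the set of coordinates where |x_i| >= 1, the monomial with exponent 2 on A is at least
    2^-n / Phi(x) in absolute value, since 1 + t^2 is at most 2 t^2 or at most 2. A depends on x but
    takes finitely many values, so the Schwartz bounds are summed over all A. *)
Lemma rschwartz_Phi (f : 'rV[R]_n -> R) : rschwartz f ->
  exists2 D : R, 0 < D & forall x, `|f x| <= D * Phi x.
Proof.
move=> [_ bf]; pose be (A : {set 'I_n}) (i : 'I_n) := if i \in A then 2%N else 0%N.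
have /choice[K HK] : forall A : {set 'I_n}, exists K : R, forall x, `|monom (be A) x * f x| <= K.
  by move=> A; have [K HK] := bf (fun=> 0%N) (be A); exists K => x; have := HK x; rewrite dpartial0.
have K0 A : 0 <= K A by exact: le_trans (normr_ge0 _) (HK A 0).
exists (2 ^+ n * \sum_A K A + 1).
  by rewrite ltr_wpDl// mulr_ge0 ?exprn_ge0// sumr_ge0.
move=> x; have P0 := Phi_gt0 x.
pose A : {set 'I_n} := finset (fun i => 1 <= `|x 0 i|).
have PA : (Phi x)^-1 <= 2 ^+ n * `|monom (be A) x|.
  rewrite /Phi prodfV invrK /monom normr_prod -[X in 2 ^+ X]card_ord -prodr_const -big_split /=.
  apply: ler_prod => i _; rewrite addr_ge0 ?sqr_ge0//= /be inE normrX.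
  rewrite -[x 0 i ^+ 2]real_normK ?num_real//.
  case: (lerP 1 `|x 0 i|) => [h|h]; rewrite ?expr0.
    by have : 1 <= `|x 0 i| ^+ 2 by [rewrite exprn_ege1]; lra.
  by have : `|x 0 i| ^+ 2 <= 1 by [rewrite exprn_ile1// ltW]; lra.
rewrite -ler_pdivrMr//.
apply: (@le_trans _ _ (`|f x| * (2 ^+ n * `|monom (be A) x|))); first exact: ler_wpM2l.
rewrite mulrCA -normrM [f x * _]mulrC.
apply: (@le_trans _ _ (2 ^+ n * K A)); first by rewrite ler_wpM2l// exprn_ge0.
apply: (@le_trans _ _ (2 ^+ n * \sum_A K A)); last by rewrite lerDl.
by rewrite ler_wpM2l ?exprn_ge0// (bigD1 A)//= lerDl sumr_ge0.
Qed.

End SchwartzBound.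

(** * Schwartz functions built from polynomials and exponentials *)

Section Tests.
Variables (R : realType) (n : nat).
Variable Q : 'I_n -> {poly R}.
Hypothesis Qb : forall i (P : {poly R}), exists C : R, forall t, `|P.[t] * expR (Q i).[t]| <= C.

Definition pexp (P q : {poly R}) (t : R) : R := P.[t] * expR q.[t].
(** This class is stable under partial derivatives and monomial factors, which change only the
    polynomials [P]; the Schwartz property thus reduces to boundedness, that is, to [Qb]. *)
Definition TF (P : 'I_n -> {poly R}) (x : 'rV[R]_n) : R := \prod_(i < n) pexp (P i) (Q i) (x 0 i).
Definition dP (i : 'I_n) (P : 'I_n -> {poly R}) (j : 'I_n) : {poly R} :=
  if j == i then (P j)^`() + P j * (Q j)^`() else P j.

Lemma pexp_derive (P q : {poly R}) t : is_derive t (1 : R) (pexp P q) (pexp (P^`() + P * q^`()) q t).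
Proof.
have d1 := is_derive_poly P t.
have d2 : is_derive t (1 : R) (expR \o horner q) (q^`().[t] * expR q.[t]).
  have d3 := is_derive_poly q t.
  have := is_derive1_comp (is_derive_expR q.[t]) d3.
  by move/is_derive_eq; apply; rewrite mulrC.
have := is_deriveM d1 d2; rewrite (_ : horner P * _ = pexp P q)//.
move/is_derive_eq; apply; rewrite /pexp /GRing.scale /= hornerD hornerM; ring.
Qed.

Lemma TF_diff P x : differentiable (TF P) x.
Proof.
have H (r : seq 'I_n) : differentiable (fun x : 'rV[R]_n => \prod_(i <- r) pexp (P i) (Q i) (x 0 i)) x.
  elim: r => [|i r IH].
    have -> : (fun z : 'rV[R]_n => \prod_(i <- [::]) pexp (P i) (Q i) (z 0 i)) = cst 1.
      by apply/funext => z; rewrite big_nil.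
    exact: differentiable_cst.
  under eq_fun do rewrite big_cons.
  apply: differentiableM; last exact: IH.
  apply: (@differentiable_comp _ _ _ _ (fun z : 'rV[R]_n => z 0 i) (pexp (P i) (Q i))).
    exact: differentiable_coord.
  by apply/derivable1_diffP; have := pexp_derive (P i) (Q i) (x 0 i) => -[].
exact: H.
Qed.

Lemma TF_partial i P : partial i (TF P) = TF (dP i P).
Proof.
apply/funext => x; rewrite /partial.
pose K := \prod_(j < n | j != i) pexp (P j) (Q j) (x 0 j).
have dP' := pexp_derive (P i) (Q i) (x 0 i).
have [d1 d2] := @is_deriveZ _ _ _ _ K _ _ _ dP'.
have TE (h : R) : TF P (h *: (delta_mx 0 i : 'rV[R]_n) + x) = K * pexp (P i) (Q i) (h *: (1:R) + x 0 i).
  rewrite /TF (bigD1 i)//= mulrC; congr (_ * _).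
    by apply: eq_bigr => j ji; rewrite !mxE eqxx /= (negbTE ji) mulr0 add0r.
  by rewrite !mxE !eqxx.
have -> : 'D_(delta_mx 0 i) (TF P) x = 'D_1 (K \*: pexp (P i) (Q i)) (x 0 i).
  have H : (fun h : R => h^-1 *: ((TF P \o shift x) (h *: delta_mx 0 i) - TF P x)) =
      (fun h : R => h^-1 *: (((K \*: pexp (P i) (Q i)) \o shift (x 0 i)) (h *: (1:R)) - (K \*: pexp (P i) (Q i)) (x 0 i))).
    apply/funext => h /=; congr (_ *: (_ - _)); first exact: TE.
    by have := TE 0; rewrite !scale0r !add0r.
  by rewrite /derive H.
rewrite d2 /TF [RHS](bigD1 i)//= /dP eqxx /GRing.scale /= mulrC; congr (_ * _).
by apply: eq_bigr => j ji; rewrite (negbTE ji).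
Qed.

Lemma TF_dpartial al P : exists P', dpartial al (TF P) = TF P'.
Proof.
rewrite /dpartial; elim: (enum _) => [|i l [P' IH]] /=; first by exists P.
rewrite IH; elim: (al i) => [|k [P'' IH']] /=; first by exists P'.
by rewrite IH'; exists (dP i P''); exact: TF_partial.
Qed.

Lemma TF_monom be P x : monom be x * TF P x = TF (fun i => 'X ^+ be i * P i) x.
Proof.
rewrite /monom /TF -big_split /=; apply: eq_bigr => i _.
by rewrite /pexp hornerM hornerXn mulrA.
Qed.

Lemma TF_bound P : exists C : R, forall x, `|TF P x| <= C.
Proof.
have /choice[C HC] : forall i, exists C : R, forall t, `|pexp (P i) (Q i) t| <= C.
  by move=> i; exact: Qb.
exists (\prod_i C i) => x; rewrite normr_prod; apply: ler_prod => i _.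
by rewrite normr_ge0 HC.
Qed.

Lemma TF_schwartz P : rschwartz (TF P).
Proof.
split=> [al x|al be]; have [P' ->] := TF_dpartial al P; first exact: TF_diff.
have [C HC] := TF_bound (fun i => 'X ^+ be i * P' i).
by exists C => x; rewrite TF_monom.
Qed.

End Tests.

Section BoxTests.
Variable R : realType.

(* The factor [m] makes [exp (- m s^(2m))] vanish in the limit at [|s| = 1] too, so that the limit is
   exactly the indicator of the open interval. *)
Definition qb (m : nat) (c r : R) : {poly R} :=
  - (m%:R *: (r^-1 *: ('X - c%:P)) ^+ m.*2).

Lemma qbE m c r t : (qb m c r).[t] = - (m%:R * ((t - c) / r) ^+ m.*2).
Proof. by rewrite /qb hornerN hornerZ horner_exp hornerZ hornerXsubC [r^-1 * _]mulrC. Qed.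

(** A bound uniform in m: u = s^2 is at most u^m when u >= 1, and for u < 1 the right side is
    positive. It provides a common Gaussian majorant. *)
Lemma qb_le m c r t : (0 < m)%N -> (qb m c r).[t] <= 1 - ((t - c) / r) ^+ 2.
Proof.
move=> m0; rewrite qbE; set s := (t - c) / r.
rewrite -mul2n exprM; have u0 : 0 <= s ^+ 2 := sqr_ge0 s; move: (s ^+ 2) u0 => u u0.
have u0m : 0 <= u ^+ m by apply: exprn_ge0.
have H : u ^+ m <= m%:R * u ^+ m by rewrite ler_peMl// ler1n.
case: (lerP 1 u) => u1; last by lra.
have : u <= u ^+ m by apply: ler_eXnr.
by lra.
Qed.

Lemma exprn_le_exp k (x : R) : 0 <= x -> x ^+ k <= k`!%:R * expR x.
Proof.
move=> x0; have e1 : 1 <= expR x by rewrite -expR0 ler_expR.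
case: k => [|k]; first by rewrite expr0 mul1r.
have := expR_ge1Dxn k x0 => H.
have f0 : 0 < (k.+1)`!%:R :> R by rewrite ltr0n fact_gt0.
by rewrite -ler_pdivrMl// mulrC; lra.
Qed.

Lemma poly_gauss (P : {poly R}) : exists C : R, forall s, `|P.[s]| * expR (1 - s ^+ 2) <= C.
Proof.
exists (\sum_(k < size P) `|P`_k| * (k`!%:R * expR 2)) => s.
rewrite horner_coef.
apply: (@le_trans _ _ ((\sum_(k < size P) `|P`_k| * `|s| ^+ k) * expR (1 - s ^+ 2))).
  apply: ler_wpM2r; first exact: expR_ge0.
  apply: (le_trans (ler_norm_sum _ _ _)); apply: ler_sum => k _.
  by rewrite normrM normrX.
rewrite mulr_suml; apply: ler_sum => k _; rewrite -mulrA; apply: ler_wpM2l => //.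
apply: (@le_trans _ _ (k`!%:R * expR `|s| * expR (1 - s ^+ 2))).
  by apply: ler_wpM2r; [exact: expR_ge0|exact: exprn_le_exp].
rewrite -mulrA -expRD; apply: ler_wpM2l; first exact: ler0n.
rewrite ler_expR -[s ^+ 2]real_normK ?num_real//; move: `|s| => u.
(* The exponent u + 1 - u^2 is at most 2, the origin of [expR 2]. *)
have := sqr_ge0 (u - 1); rewrite sqrrB1; nra.
Qed.

Lemma qb_bound m c r (P : {poly R}) : (0 < m)%N -> r != 0 ->
  exists C : R, forall t, `|P.[t] * expR (qb m c r).[t]| <= C.
Proof.
move=> m0 r0; have [C HC] := poly_gauss (P \Po (r *: 'X + c%:P)).
exists C => t; pose s := (t - c) / r; apply: le_trans (HC s).
rewrite normrM (ger0_norm (expR_ge0 _)) horner_comp hornerD hornerZ hornerX hornerC.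
have -> : r * s + c = t by rewrite /s; field.
by apply: ler_wpM2l => //; rewrite ler_expR; exact: qb_le.
Qed.

Lemma bernoulli_le (y : R) m : 0 <= y -> 1 + m%:R * y <= (1 + y) ^+ m.
Proof.
move=> y0; elim: m => [|m IH]; first by rewrite mul0r addr0 expr0.
rewrite exprS; apply: (@le_trans _ _ ((1 + y) * (1 + m%:R * y))).
  have : 0 <= m%:R * (y * y) by rewrite mulr_ge0// mulr_ge0.
  rewrite -natr1; move: (m%:R : R) => z; nra.
by apply: ler_wpM2l => //; lra.
Qed.

(** Writing x^-1 = 1 + y, Bernoulli's inequality gives x^m <= 1 / (m y), hence m x^(2m) <= 1 / (m
    y^2). *)
Lemma mexp_cvg0 (x : R) : 0 <= x < 1 -> (fun m => m.+1%:R * x ^+ m.+1.*2) @ \oo --> (0 : R).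
Proof.
move=> /andP[x0 x1]; have [->|xn0] := eqVneq x 0.
  by under eq_fun do rewrite doubleS exprS mul0r mulr0; exact: cvg_cst.
have xp : 0 < x by rewrite lt_def xn0.
pose y := x^-1 - 1; have y0 : 0 < y by rewrite subr_gt0 invf_gt1.
have H m : m.+1%:R * x ^+ m.+1.*2 <= (y ^+ 2)^-1 * m.+1%:R^-1.
  have m0 : 0 < m.+1%:R :> R by rewrite ltr0n.
  have B := bernoulli_le m.+1 (ltW y0).
  have B' : m.+1%:R * y <= (x ^+ m.+1)^-1.
    by rewrite -exprVn; have -> : x^-1 = 1 + y by [rewrite /y addrC subrK]; lra.
  have my : 0 < m.+1%:R * y by rewrite mulr_gt0.
  have B2 : x ^+ m.+1 <= (m.+1%:R * y)^-1 by rewrite -[leLHS]invrK lef_pV2// posrE// invr_gt0 exprn_gt0.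
  rewrite -muln2 exprM.
  have B3 : (x ^+ m.+1) ^+ 2 <= (m.+1%:R * y)^-1 ^+ 2.
    by rewrite lerXn2r// nnegrE ?exprn_ge0// invr_ge0 ltW.
  apply: (le_trans (ler_wpM2l (ltW m0) B3)); rewrite le_eqVlt; apply/orP; left; apply/eqP.
  field; by rewrite !gt_eqF.
have U : (fun m => (y ^+ 2)^-1 * m.+1%:R^-1) @ \oo --> (0 : R).
  rewrite -[X in _ --> X](mulr0 ((y ^+ 2)^-1)); apply: cvgM; first exact: cvg_cst.
  exact: cvg_harmonic.
have Z : (fun=> 0 : R) @ \oo --> (0 : R) by exact: cvg_cst.
apply: (squeeze_cvgr _ Z U).
by apply: nearW => m; rewrite H andbT mulr_ge0// exprn_ge0.
Qed.

Lemma expqb_cvg c r t : 0 < r ->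
  (fun m => expR (qb m.+1 c r).[t]) @ \oo --> ((`|t - c| < r)%R%:R : R).
Proof.
move=> r0; under eq_fun do rewrite qbE.
have sE m : ((t - c) / r) ^+ m.*2 = `|(t - c) / r| ^+ m.*2.
  by rewrite -!mul2n !exprM real_normK ?num_real.
under eq_fun do rewrite sE.
have -> : (`|t - c| < r) = (`|(t - c) / r| < 1).
  by rewrite normrM normfV (gtr0_norm r0) ltr_pdivrMr// mul1r.
have : 0 <= `|(t - c) / r| by [].
move: `|(t - c) / r| => s s0.
case: (ltP s 1) => s1 /=.
  have : (fun m => - (m.+1%:R * s ^+ m.+1.*2)) @ \oo --> (- 0 : R).
    by apply: cvgN; apply: mexp_cvg0; rewrite s0.
  rewrite oppr0 => H.
  by have := cvg_comp _ _ H (@continuous_expR R 0); rewrite /= expR0; apply.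
have Z : (fun=> 0 : R) @ \oo --> (0 : R) by exact: cvg_cst.
apply: (squeeze_cvgr _ Z (@cvg_harmonic R)).
apply: nearW => m; rewrite expR_ge0 /= expRN.
have m0 : 0 < m.+1%:R :> R by rewrite ltr0n.
have : m.+1%:R <= expR (m.+1%:R * s ^+ m.+1.*2).
  apply: (@le_trans _ _ (m.+1%:R * s ^+ m.+1.*2)).
    by rewrite ler_peMr ?ler0n// exprn_ege1.
  by have := expR_ge1Dx (m.+1%:R * s ^+ m.+1.*2); lra.
by move=> H; rewrite lef_pV2// posrE// expR_gt0.
Qed.

Variable n : nat.

Definition boxtest (c r : 'I_n -> R) m : 'rV[R]_n -> R :=
  TF (fun i => qb m.+1 (c i) (r i)) (fun=> 1).

Lemma boxtest_schwartz c r m : (forall i, 0 < r i) -> rschwartz (boxtest c r m).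
Proof.
by move=> r0; apply: TF_schwartz => i P; apply: qb_bound => //; rewrite gt_eqF.
Qed.

Lemma boxtestE c r m x : boxtest c r m x = \prod_(i < n) expR (qb m.+1 (c i) (r i)).[x 0 i].
Proof. by apply: eq_bigr => i _; rewrite /pexp hornerC mul1r. Qed.

(** For index 0 the exponent is exactly -s^2, and the uniform bound 1 - s^2 exceeds it by 1 in each
    coordinate. The majorant is thus a multiple of a test function, so that its integrability
    against [h] is contained in the hypothesis of [uniqueness]. *)
Lemma boxtest_dom c r m x : `|boxtest c r m x| <= expR 1 ^+ n * boxtest c r 0 x.
Proof.
rewrite !boxtestE -[X in _ ^+ X]card_ord -prodr_const -big_split /= normr_prod.
apply: ler_prod => i _; rewrite normr_ge0 /= ger0_norm ?expR_ge0// -expRD ler_expR.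
by apply: (le_trans (qb_le _ _ _ (ltn0Sn m))); rewrite qbE mul1r.
Qed.

Lemma boxtest_cvg c r x : (forall i, 0 < r i) ->
  (fun m => boxtest c r m x) @ \oo --> ([forall i, `|x 0 i - c i| < r i]%:R : R).
Proof.
move=> r0.
have H (s : seq 'I_n) : (fun m => \prod_(i <- s) expR (qb m.+1 (c i) (r i)).[x 0 i]) @ \oo -->
    \prod_(i <- s) ((`|x 0 i - c i| < r i)%R%:R : R).
  elim: s => [|i s IH].
    by under eq_fun do rewrite big_nil; rewrite big_nil; exact: cvg_cst.
  under eq_fun do rewrite big_cons.
  by rewrite big_cons; apply: cvgM => //; exact: expqb_cvg.
under eq_fun do rewrite boxtestE.
suff -> : ([forall i, `|x 0 i - c i| < r i]%:R : R) = \prod_(i < n) ((`|x 0 i - c i| < r i)%R%:R : R) by exact: H.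
case: (boolP [forall i, _]) => [/forallP h|].
  by rewrite big1// => i _; rewrite h.
by rewrite negb_forall => /existsP[i /negbTE hi]; rewrite (bigD1 i)//= hi mul0r.
Qed.

End BoxTests.

Section Density.
Context d (X : measurableType d) (R : realType).
Variables (mu : {measure set X -> \bar R}) (f : X -> R).
Hypotheses (mf : measurable_fun setT f) (f0 : forall x, 0 <= f x).

Definition density (A : set X) : \bar R := (\int[mu]_(x in A) (f x)%:E)%E.

Let density0 : density set0 = 0%E. Proof. exact: integral_set0. Qed.

Let density_ge0 A : (0 <= density A)%E.
Proof. by apply: integral_ge0 => x _; rewrite lee_fin. Qed.

Let density_sigma : semi_sigma_additive density.
Proof.
move=> F mF tF mUF; rewrite /density ge0_integral_bigcup//.
- by apply: is_cvg_ereal_nneg_natsum => k _; exact: density_ge0.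
- by apply/measurable_EFinP; exact: measurable_funS mf.
- by move=> x _; rewrite lee_fin.
Qed.

HB.instance Definition _ := isMeasure.Build _ _ _ density density0 density_ge0 density_sigma.

End Density.

(** * Functions orthogonal to all Schwartz functions vanish *)

Section Boxes.
Variables (R : realType) (n : nat).
Local Notation E := (Esp R n).
Local Notation mu := (leb R n).

Definition box (a b : 'I_n -> R) : set 'rV[R]_n := [set x | forall i, a i < x 0 i < b i].
Definition boxes : set (set 'rV[R]_n) := [set B | exists a b, B = box a b].
Definition bigbox k := box (fun=> - k%:R) (fun=> k%:R).

Lemma measurable_box a b : measurable (box a b : set E).
Proof.
have -> : box a b = \bigcap_(i : 'I_n) (fun x : 'rV[R]_n => x 0 i) @^-1` `]a i, b i[.
  apply/seteqP; split => x /=.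
    by move=> H i _; rewrite /= in_itv/=; exact: H.
  by move=> H i; have := H i Logic.I; rewrite /= in_itv/=.
apply: fin_bigcap_measurable => // i _.
rewrite -[X in measurable X]setTI; have := @measurable_coord R n i; apply => //.
Qed.

Lemma bigbox_cover (x : 'rV[R]_n) : exists k, bigbox k x.
Proof.
pose M := \sum_i `|x 0 i|.
exists (Num.truncn M).+1 => i.
have xM : `|x 0 i| <= M by rewrite /M (bigD1 i)//= lerDl sumr_ge0.
by rewrite -ltr_norml; exact: le_lt_trans xM (truncnS_gt M).
Qed.

Lemma bigbox_bigcup : \bigcup_k bigbox k = setT.
Proof. by apply/seteqP; split => // x _; have [k xk] := bigbox_cover x; exists k. Qed.

Lemma setI_boxes : setI_closed boxes.
Proof.
move=> _ _ [a [b ->]] [a' [b' ->]].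
exists (fun i => Num.max (a i) (a' i)), (fun i => Num.min (b i) (b' i)).
apply/seteqP; split => [x [H H'] i|x H].
  by have /andP[h1 h2] := H i; have /andP[h3 h4] := H' i; rewrite gt_max lt_min h1 h2 h3 h4.
by split => i; have := H i; rewrite gt_max lt_min => /andP[/andP[h1 h2] /andP[h3 h4]]; apply/andP.
Qed.

Lemma boxes_generate : (measurable : set (set E)) = <<s boxes >>.
Proof.
apply/seteqP; split => [A mA|]; last first.
  by apply: smallest_sub; [exact: sigma_algebra_measurable|move=> _ [a [b ->]]; exact: measurable_box].
pose G := g_sigma_algebraType boxes.
have mid : measurable_fun setT (id : G -> E).
  apply: measurable_to_Esp => i; apply: (measurability _ (RGenOpens.measurableE R)).
  move=> _ [_ [a [b ->] <-]]; rewrite setTI.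
  rewrite (_ : _ @^-1` _ = \bigcup_k box (fun j => if j == i then a else - k%:R) (fun j => if j == i then b else k%:R)).
    by apply: bigcupT_measurable => k; apply: sub_sigma_algebra; do 2 eexists.
  apply/seteqP; split => [x /=|x [k _ /(_ i)] /=]; last by rewrite eqxx in_itv.
  rewrite in_itv/= => xi; have [k xk] := bigbox_cover x; exists k => // j /=.
  by case: eqP => [->|_]; [exact: xi|exact: xk].
by have := mid measurableT A mA; rewrite setTI.
Qed.

(** In the limit of the box tests, [h] has integral 0 over every open box. The measures with
    densities [hp] and [hm] then agree on boxes, which form a generating pi-system, hence on all
    Borel sets. Where one part is nonzero the other vanishes, so on that set both measures are 0. *)
Lemma uniqueness (h : E -> R) : measurable_fun setT h ->
  (forall phi : 'rV[R]_n -> R, rschwartz phi -> L1 mu (fun x => h x * phi x) /\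
     \int[mu]_x (h x * phi x) = 0) ->
  {ae mu, forall x, h x = 0}.
Proof.
move=> mh H.
have mbox a b : measurable_fun setT (\1_(box a b) : E -> R) by apply: measurable_indic; exact: measurable_box.
have hbox a b : L1 mu (fun x => h x * \1_(box a b) x) /\ \int[mu]_x (h x * \1_(box a b) x) = 0.
  have [/forallP ab|] := boolP [forall i, a i < b i]; last first.
    rewrite negb_forall => /existsP[i]; rewrite -leNgt => ba.
    have B0 : box a b = set0.
      by apply/seteqP; split => // x /(_ i) /andP[h1 h2]; have := lt_le_trans (lt_trans h1 h2) ba; rewrite ltxx.
    have Z x : h x * \1_(box a b) x = 0 by rewrite B0 indicE in_set0 mulr0.
    split; first by apply: (L1_eq (L10 mu)) => x; rewrite Z.
    by under eq_Rintegral do rewrite Z; rewrite /Rintegral integral0.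
  pose c i := (a i + b i) / 2; pose r i := (b i - a i) / 2.
  have r0 i : 0 < r i by rewrite /r divr_gt0// subr_gt0.
  have Ih m := H _ (boxtest_schwartz c m r0).
  have ID : L1 mu (fun x => expR 1 ^+ n * `|h x * boxtest c r 0 x|) by exact: (L1Z _ (L1_norm (Ih 0%N).1)).
  have [] := @Rint_dcvg _ _ _ mu (fun m x => h x * boxtest c r m x) (fun x => h x * \1_(box a b) x) _ _ _ _ ID.
  - by move=> m; exact: (L1_meas (Ih m).1).
  - exact: measurable_funM.
  - move=> x; apply: cvgM; first exact: cvg_cst.
    have -> : \1_(box a b) x = [forall i, `|(x : 'rV[R]_n) 0 i - c i| < r i]%:R :> R.
      rewrite indicE; congr (_%:R); congr nat_of_bool.
      apply/idP/forallP => [/set_mem xB i|xB]; last apply/mem_set => i.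
        by have /andP[h1 h2] := xB i; rewrite ltr_norml /c /r; apply/andP; split; lra.
      by have := xB i; rewrite ltr_norml /c /r => /andP[h1 h2]; apply/andP; split; lra.
    exact: boxtest_cvg.
  - move=> m x; rewrite !normrM mulrCA; apply: ler_wpM2l => //.
    have t0 : 0 <= boxtest c r 0 x by rewrite boxtestE; apply: prodr_ge0 => i _; exact: expR_ge0.
    by rewrite (ger0_norm t0); exact: boxtest_dom.
  move=> I1 cv; split; first exact: I1.
  have cv0 : (fun m => \int[mu]_x (h x * boxtest c r m x)) @ \oo --> (0 : R).
    under eq_fun do rewrite (Ih _).2; exact: cvg_cst.
  exact: (cvg_unique _ cv cv0).
pose hp (x : E) : R := Num.max (h x) 0; pose hm (x : E) : R := Num.max (- h x) 0.
have hp0 x : 0 <= hp x by rewrite le_max lexx orbT.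
have hm0 x : 0 <= hm x by rewrite le_max lexx orbT.
have mhp : measurable_fun setT hp by apply: measurable_maxr.
have mhm : measurable_fun setT hm by apply: measurable_maxr => //; exact: measurable_funN.
have hE x : h x = hp x - hm x.
  rewrite /hp /hm; case: (lerP 0 (h x)) => h0.
    by rewrite [X in _ - X]max_r ?oppr_le0// subr0.
  by rewrite max_l ?oppr_ge0 ?ltW// sub0r opprK.
have bx (f : E -> R) a b : (forall x, `|f x| <= `|h x|) -> (forall x, 0 <= f x) -> measurable_fun setT f ->
   L1 mu (fun x => f x * \1_(box a b) x) /\
   (\int[mu]_(x in box a b) (f x)%:E = (\int[mu]_x (f x * \1_(box a b) x))%:E)%E.
  move=> fh f0 mf; have I1 : L1 mu (fun x => f x * \1_(box a b) x).
    apply: (L1_dom _ (L1_norm (hbox a b).1)); first exact: measurable_funM.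
    by move=> x; rewrite !normrM; apply: ler_wpM2r.
  split; first exact: I1.
  rewrite (EFin_int I1) [LHS]integral_mkcond; apply: eq_integral => x _.
  rewrite patchE indicE; case: ifP => _; first by rewrite mulr1.
  by rewrite mulr0.
have hpb x : `|hp x| <= `|h x|.
  by rewrite ger0_norm// ge_max normr_ge0 ler_norm.
have hmb x : `|hm x| <= `|h x|.
  by rewrite ger0_norm// ge_max normr_ge0 -normrN ler_norm.
have eqm A : measurable A -> density mu hp A = density mu hm A.
  apply: (@measure_unique _ R E boxes bigbox boxes_generate setI_boxes _ bigbox_bigcup (density mu hp) (density mu hm)).
  - by move=> k; do 2 eexists.
  - move=> _ [a [b ->]].
    have [I1 E1] := bx hp a b hpb hp0 mhp; have [I2 E2] := bx hm a b hmb hm0 mhm.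
    rewrite /= /density E1 E2; congr (_%:E); apply/eqP; rewrite -subr_eq0 -(RintB I1 I2); apply/eqP.
    have [_ <-] := hbox a b; apply: eq_Rintegral => x _.
    by rewrite -mulrBl -hE.
  - by move=> k; have [_ E1] := bx hp (fun=> - k%:R) (fun=> k%:R) hpb hp0 mhp; rewrite /= /density E1 ltry.
have zero (f g : E -> R) : measurable_fun setT f -> measurable_fun setT g ->
    (forall x, 0 <= f x) -> (forall x, f x != 0 -> g x = 0) ->
    (forall A, measurable A -> density mu f A = density mu g A) -> {ae mu, forall x, f x = 0}.
  move=> mf mg f0 fg fgA.
  pose A : set E := [set x | f x != 0].
  have mA : measurable A.
    rewrite (_ : A = setT `&` f @^-1` (~` [set 0])); first by apply: mf => //; apply: measurableC.
    by rewrite setTI; apply/seteqP; split => x /= /eqP.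
  have fA0 : density mu f A = 0%E.
    rewrite fgA// /density; apply: integral0_eq => x /= fx.
    by rewrite fg.
  have /ae_eq_integral_abs : (\int[mu]_(x in setT) `|(f x)%:E| = 0)%E.
    rewrite -fA0 /density [RHS]integral_mkcond; apply: eq_integral => x _.
    rewrite patchE; case: ifPn => [_|]; first by rewrite gee0_abs ?lee_fin.
    rewrite notin_setE /A /= => /negP; rewrite negbK => /eqP ->.
    by rewrite normr0.
  move=> /(_ measurableT) H0.
  have : ae_eq mu setT (EFin \o f) (cst 0%E) by apply: H0; apply/measurable_EFinP.
  by apply: negligibleS => x /= nf K; apply: nf; have [] := K Logic.I.
have Zp := zero hp hm mhp mhm hp0 _ eqm.
have Zm := zero hm hp mhm mhp hm0 _ (fun A mA => esym (eqm A mA)).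
apply: (aeS (aeI (Zp _) (Zm _))).
- move=> x; rewrite /hp /hm; case: (lerP (h x) 0) => h0; first by rewrite eqxx.
  by move=> _; rewrite max_r// oppr_le0 ltW.
- move=> x; rewrite /hp /hm; case: (lerP (h x) 0) => h0; first by [].
  by rewrite max_r ?eqxx// oppr_le0 ltW.
- by move=> x [h1 h2]; rewrite hE h1 h2 subr0.
Qed.

End Boxes.

(** * Assembly *)

Lemma Rint_lin d (X : measurableType d) (R : realType) (mu : {measure set X -> \bar R})
  (I : finType) (c : I -> R) (f : I -> X -> R) : (forall p, L1 mu (f p)) ->
  L1 mu (fun x => \sum_p c p * f p x) /\
  \int[mu]_x (\sum_p c p * f p x) = \sum_p c p * \int[mu]_x f p x.
Proof.
move=> If; have Ic p : L1 mu (fun x => c p * f p x) by exact: L1Z.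
split; first exact: L1_sum.
by rewrite Rint_sum//; apply: eq_bigr => p _; rewrite RintZ.
Qed.

Section Assembly.
Variables (R : realType) (n : nat) (n_gt0 : (0 < n)%N).
Local Notation E := (Esp R n).
Local Notation mu := (leb R n).

Definition mulIu (j : bool) (z : R * R) : R * R := if j then (- z.2, z.1) else z.
Definition cpart (f : 'rV[R]_n -> R * R) (j : bool) (x : E) : R := if j then (f x).2 else (f x).1.
Definition ph (t : bool) : R := if t then - (pi / 2) else 0.

Lemma sum3E (F : bool * bool * bool -> R) : \sum_p F p =
  F (true, true, true) + F (true, true, false) + (F (true, false, true) + F (true, false, false)) +
  (F (false, true, true) + F (false, true, false) + (F (false, false, true) + F (false, false, false))).
Proof.
transitivity (\sum_(q : bool * bool) \sum_(t : bool) F (q, t)).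
  by rewrite [RHS]pair_bigA /=; apply: eq_bigr => -[].
transitivity (\sum_(i : bool) \sum_(j : bool) \sum_(t : bool) F (i, j, t)).
  by rewrite [RHS]pair_bigA /=; apply: eq_bigr => -[].
by rewrite !big_bool.
Qed.

Lemma sum4E (F : bool * bool * bool * bool -> R) : \sum_p F p =
  \sum_(q : bool * bool * bool) (F (q, true) + F (q, false)).
Proof.
transitivity (\sum_(q : bool * bool * bool) \sum_(t : bool) F (q, t)).
  by rewrite [RHS]pair_bigA /=; apply: eq_bigr => -[].
by apply: eq_bigr => q _; rewrite big_bool.
Qed.

(* An index [true] selects an imaginary part (of [b], of [u], of the exponential, and in [c4] of the test
   function) and thus contributes a factor i. *)
Definition c3 (p : bool * bool * bool) : R * R := mulIu p.1.1 (mulIu p.1.2 (mulIu p.2 (1, 0))).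
Definition c4 (p : bool * bool * bool * bool) : R * R := mulIu p.2 (c3 p.1).

Lemma cmul_sum3r (z : bool * bool * bool -> R) (w : R * R) :
  cmul w (\sum_p (c3 p).1 * z p, \sum_p (c3 p).2 * z p) =
  (\sum_p (c4 p).1 * ((if p.1.1.2 then w.2 else w.1) * z (p.1.1.1, p.1.2, p.2)),
   \sum_p (c4 p).2 * ((if p.1.1.2 then w.2 else w.1) * z (p.1.1.1, p.1.2, p.2))).
Proof. by rewrite !sum4E !sum3E /cmul /c4 /c3 /mulIu /=; congr pair; ring. Qed.

Lemma cmul_sum3l (z : bool * bool * bool -> R) (w : R * R) K :
  cmul (Defs.cscale K (\sum_p (c3 p).1 * z p, \sum_p (c3 p).2 * z p)) w =
  (\sum_p K * (c4 p).1 * (z p.1 * (if p.2 then w.2 else w.1)),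
   \sum_p K * (c4 p).2 * (z p.1 * (if p.2 then w.2 else w.1))).
Proof. by rewrite !sum4E !sum3E /cmul /Defs.cscale /c4 /c3 /mulIu /=; congr pair; ring. Qed.

Lemma cint_ae (f : 'rV[R]_n -> R * R) (g1 g2 : E -> R) : L1 mu g1 -> L1 mu g2 ->
  {ae mu, forall x, f x = (g1 x, g2 x)} ->
  cint f = (\int[mu]_x g1 x, \int[mu]_x g2 x) /\ cintegrable f.
Proof.
move=> I1 I2 fg.
have f1 : {ae mu, forall x, (f x).1 = g1 x} by apply: (aeS fg) => x ->.
have f2 : {ae mu, forall x, (f x).2 = g2 x} by apply: (aeS fg) => x ->.
split; first by rewrite /cint (rint_ae I1 f1) (rint_ae I2 f2).
by split; [exact: rintegrable_ae I1 f1|exact: rintegrable_ae I2 f2].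
Qed.

Variables (a : 'rV[R]_n -> 'rV[R]_n -> R * R) (b : bool -> E * E -> R) (A : R).
Hypotheses (mb : forall l, measurable_fun setT (b l)) (A0 : 0 <= A)
  (bA : forall l y xi, `|b l (y, xi)| <= A * jbV xi)
  (ab : {ae mu, forall y, forall xi, a y xi = (b false (y, xi), b true (y, xi))}).
Variable u : 'rV[R]_n -> R * R.
Hypothesis uS : schwartz u.

Lemma cpart_schwartz (f : 'rV[R]_n -> R * R) : schwartz f -> forall j, rschwartz (cpart f j).
Proof. by move=> [f1 f2] []. Qed.

Lemma cpart_bound (f : 'rV[R]_n -> R * R) j : schwartz f -> measurable_fun setT (cpart f j) /\
  exists2 D : R, 0 < D & forall x, `|cpart f j x| <= D * Phi x.
Proof.
move=> /cpart_schwartz /(_ j) fS; split; last exact: rschwartz_Phi fS.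
by apply: measurable_cont_Esp; apply: smooth_cont; exact: fS.1.
Qed.

Lemma cpart_L1 (f : 'rV[R]_n -> R * R) j : schwartz f -> L1 mu (cpart f j).
Proof.
move=> /(cpart_bound j)[mf [D D0 fD]].
exact: (L1_dom mf (L1Z D (@Phi_L1 R n)) fD).
Qed.

Definition JJ l t (g : E -> R) (y : E) : R := \int[mu]_xi (b l (y, xi) * Fy g y (ph t) xi).

(** The weak identity for one real component: [l] selects the part of the symbol, [j] that of u, and
    [t] the cosine or the sine. *)
Definition represents (v : E -> R) l j t := forall (g : E -> R) (D : R), 0 < D ->
  measurable_fun setT g -> (forall x, `|g x| <= D * Phi x) ->
  [/\ L1 mu (fun x => v x * g x),
   forall y, L1 mu (fun xi => b l (y, xi) * Fy g y (ph t) xi),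
   L1 mu (fun y => cpart u j y * JJ l t g y) &
   \int[mu]_x (v x * g x) = \int[mu]_y (cpart u j y * JJ l t g y)].

Lemma representatives : exists V : bool * bool * bool -> E -> R,
  forall l j t, measurable_fun setT (V (l, j, t)) /\ represents (V (l, j, t)) l j t.
Proof.
have /choice[V HV] : forall p : bool * bool * bool, exists v : E -> R,
    measurable_fun setT v /\ represents v p.1.1 p.1.2 p.2.
  by move=> [[l j] t] /=; exact: (representative n_gt0 (ph t) (mb l) A0 (bA l) (cpart_L1 j uS)).
by exists V => l j t; exact: (HV (l, j, t)).
Qed.

Variable V : bool * bool * bool -> E -> R.
Hypothesis VP : forall l j t, measurable_fun setT (V (l, j, t)) /\ represents (V (l, j, t)) l j t.

Definition vrep (x : 'rV[R]_n) : R * R :=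
  Defs.cscale ((2 * pi) ^- n) (\sum_p (c3 p).1 * V p x, \sum_p (c3 p).2 * V p x).

Lemma fourierE phi xi : schwartz phi ->
  cint (fun x => cmul (cexpi (dotR x xi)) (phi x)) =
  (Fc (cpart phi false) 0 xi - Fc (cpart phi true) (- (pi / 2)) xi,
   Fc (cpart phi false) (- (pi / 2)) xi + Fc (cpart phi true) 0 xi).
Proof.
move=> fS; have I j s := L1_cosx s xi (cpart_L1 j fS).
have [|-> _] := @cint_ae (fun x => cmul (cexpi (dotR x xi)) (phi x)) _ _
    (L1B (I false 0) (I true (- (pi / 2)))) (L1D (I false (- (pi / 2))) (I true 0)).
  apply: aeT => x; rewrite !cosBpihalf !addr0 /cmul /cexpi /cpart /=.
  by congr pair; ring.
by rewrite (RintB (I _ _) (I _ _)) (RintD (I _ _) (I _ _)).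
Qed.

(** The factor e^(-i y.xi) becomes the phase shift in [Fy]; what remains is the expansion of the
    complex product into real components. *)
Lemma kernelE phi y : schwartz phi ->
  (forall xi, a y xi = (b false (y, xi), b true (y, xi))) ->
  cint (fun xi => cmul (cmul (cexpi (- dotR y xi)) (a y xi))
                   (cint (fun x => cmul (cexpi (dotR x xi)) (phi x)))) =
  (\sum_(p : bool * bool * bool) (c3 p).1 * JJ p.1.1 p.1.2 (cpart phi p.2) y,
   \sum_(p : bool * bool * bool) (c3 p).2 * JJ p.1.1 p.1.2 (cpart phi p.2) y).
Proof.
move=> fS ay.
pose f (p : bool * bool * bool) (xi : E) : R := b p.1.1 (y, xi) * Fy (cpart phi p.2) y (ph p.1.2) xi.
have If p : L1 mu (f p).
  have [mf [D D0 fD]] := cpart_bound p.2 fS.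
  by have [_ H _ _] := (VP p.1.1 false p.1.2).2 _ _ D0 mf fD; exact: H.
have [I1 E1] := Rint_lin (fun p => (c3 p).1) If.
have [I2 E2] := Rint_lin (fun p => (c3 p).2) If.
have [|-> _] := @cint_ae (fun xi => cmul (cmul (cexpi (- dotR y xi)) (a y xi))
                   (cint (fun x => cmul (cexpi (dotR x xi)) (phi x)))) _ _ I1 I2; last by rewrite E1 E2.
apply: aeT => xi; rewrite fourierE// ay !sum3E /f /c3 /mulIu /=.
have FE j t : Fy (cpart phi j) y t xi = cos (t - dotR y xi) * Fc (cpart phi j) 0 xi
    - sin (t - dotR y xi) * Fc (cpart phi j) (- (pi / 2)) xi.
  by rewrite /Fy FcE//; exact: cpart_L1.
rewrite /ph !FE !sub0r.
have -> : - (pi / 2) - dotR y xi = - dotR y xi - pi / 2 by ring.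
have sBp (x : R) : sin (x - pi / 2) = - cos x.
  by rewrite sinB cos_pihalf sin_pihalf mulr0 mulr1 sub0r.
rewrite cosBpihalf sBp /cmul /cexpi /=.
by congr pair; ring.
Qed.

Lemma vrep_Tstar : Tstar_rep a u vrep.
Proof.
have mV p : measurable_fun setT (V p) by case: p => -[l j] t; exact: (VP l j t).1.
have mvr (c : bool * bool * bool -> R) : measurable_fun setT (fun x : E => (2 * pi) ^- n * \sum_p c p * V p x).
  by apply: measurable_funM => //; apply: meas_sum => p; apply: measurable_funM.
split.
  by split; [apply: (lmeasfun_ae (mvr (fun p => (c3 p).1)))|apply: (lmeasfun_ae (mvr (fun p => (c3 p).2)))];
    exact: aeT.
move=> phi fS; set K := (2 * pi) ^- n.
pose f (p : bool * bool * bool * bool) (x : E) : R := V p.1 x * cpart phi p.2 x.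
pose g (p : bool * bool * bool * bool) (y : E) : R := cpart u p.1.1.2 y * JJ p.1.1.1 p.1.2 (cpart phi p.2) y.
have fg p : [/\ L1 mu (f p), L1 mu (g p) & \int[mu]_x f p x = \int[mu]_x g p x].
  have [mf [D D0 fD]] := cpart_bound p.2 fS.
  case: p mf fD => -[[l j] t] i mf fD.
  by have [H1 _ H2 H3] := (VP l j t).2 _ _ D0 mf fD; split.
have If p : L1 mu (f p) by have [] := fg p.
have Ig p : L1 mu (g p) by have [] := fg p.
have [I1 E1] := Rint_lin (fun p => K * (c4 p).1) If.
have [I2 E2] := Rint_lin (fun p => K * (c4 p).2) If.
have [I3 E3] := Rint_lin (fun p => (c4 p).1) Ig.
have [I4 E4] := Rint_lin (fun p => (c4 p).2) Ig.
have [|-> cI] := @cint_ae (fun x => cmul (vrep x) (phi x)) _ _ I1 I2.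
  apply: aeT => x; exact: (cmul_sum3l (V ^~ x) (phi x) K).
split; first exact: cI.
have [|-> _] := @cint_ae (fun y => cmul (u y)
         (cint (fun xi => cmul (cmul (cexpi (- dotR y xi)) (a y xi))
                   (cint (fun x => cmul (cexpi (dotR x xi)) (phi x)))))) _ _ I3 I4.
  apply: (aeS ab) => y ay; rewrite (kernelE fS ay).
  exact: (cmul_sum3r (fun p => JJ p.1.1 p.1.2 (cpart phi p.2) y) (u y)).
rewrite E1 E2 E3 E4 /Defs.cscale /= !mulr_sumr.
by congr pair; apply: eq_bigr => p _; have [_ _ ->] := fg p; rewrite mulrA.
Qed.

End Assembly.

(** * Two representatives agree almost everywhere *)

Section Uniqueness.
Variables (R : realType) (n : nat).
Local Notation E := (Esp R n).
Local Notation mu := (leb R n).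
Variables (a : 'rV[R]_n -> 'rV[R]_n -> R * R) (u : 'rV[R]_n -> R * R).

Lemma rschwartz0 : rschwartz (fun _ : 'rV[R]_n => 0 : R).
Proof.
have D0 al : dpartial al (fun _ : 'rV[R]_n => 0 : R) = fun=> 0.
  rewrite /dpartial; elim: (enum _) => //= i l ->; elim: (al i) => //= k ->.
  by apply/funext => x; rewrite /partial derive_cst.
split=> [al x|al be]; rewrite D0; first exact: differentiable_cst.
by exists 0 => x; rewrite mulr0 normr0.
Qed.

(** Tested against the real function (phi, 0), the two components of [v] separate. *)
Lemma Tstar_comp v j : Tstar_rep a u v -> exists2 g : E -> R, measurable_fun setT g &
  {ae mu, forall x, cpart v j x = g x} /\
  forall phi : 'rV[R]_n -> R, rschwartz phi -> L1 mu (fun x => g x * phi x) /\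
    \int[mu]_x (g x * phi x) =
      if j then (cint (fun x => cmul (v x) (phi x, 0))).2 else (cint (fun x => cmul (v x) (phi x, 0))).1.
Proof.
move=> [[m1 m2] vT].
have mv : lmeasfun (cpart v j) by case: j.
have [g mg vg] := lmeasfun_borel mv.
exists g => //; split=> // phi fS.
have [[I1 I2] _] := vT (fun x => (phi x, 0)) (conj fS rschwartz0).
have mphi : measurable_fun setT (phi : E -> R) by apply: measurable_cont_Esp; apply: smooth_cont; exact: fS.1.
have mgp : measurable_fun setT (fun x : E => g x * phi x) by exact: measurable_funM.
have E0 : {ae mu, forall x, cpart (fun x => cmul (v x) (phi x, 0)) j x = g x * phi x}.
  by apply: (aeS vg) => x <-; rewrite /cmul /cpart /=; case: j {mv vg}; ring.
have I : L1 mu (fun x => g x * phi x).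
  by apply: (rintegrable_L1f mgp E0); case: j {mv vg E0}.
by split; [exact: I|rewrite -(rint_ae I E0); case: j {mv vg E0}].
Qed.

Lemma Tstar_unique v1 v2 : Tstar_rep a u v1 -> Tstar_rep a u v2 ->
  {ae mu, forall x, v1 x = v2 x}.
Proof.
move=> T1 T2.
have H j : {ae mu, forall x, cpart v1 j x = cpart v2 j x}.
  have [g1 mg1 [e1 P1]] := Tstar_comp j T1; have [g2 mg2 [e2 P2]] := Tstar_comp j T2.
  have /uniqueness : measurable_fun setT (fun x => g1 x - g2 x) by exact: measurable_funB.
  move=> U; have {}U : {ae mu, forall x, g1 x - g2 x = 0}.
    apply: U => phi fS; have [I1 E1] := P1 _ fS; have [I2 E2] := P2 _ fS.
    have E x : g1 x * phi x - g2 x * phi x = (g1 x - g2 x) * phi x by rewrite mulrBl.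
    split; first exact: (L1_eq (L1B I1 I2) E).
    under eq_Rintegral do rewrite -E.
    rewrite (RintB I1 I2) E1 E2.
    have [_ ->] := T1.2 (fun x => (phi x, 0)) (conj fS rschwartz0).
    by have [_ ->] := T2.2 (fun x => (phi x, 0)) (conj fS rschwartz0); rewrite subrr.
  by apply: (aeS (aeI (aeI e1 e2) U)) => x [[-> ->]] /eqP; rewrite subr_eq0 => /eqP.
apply: (aeS (aeI (H false) (H true))) => x; rewrite /cpart /=.
by case: (v1 x) (v2 x) => [? ?] [? ?] /= [-> ->].
Qed.

End Uniqueness.

Section CabsBounds.
Variable R : realType.

Lemma cabs_ge (z : R * R) j : `|if j then z.2 else z.1| <= cabs z.
Proof.
by rewrite /cabs -sqrtr_sqr ler_wsqrtr//; case: j; rewrite ?lerDl ?lerDr sqr_ge0.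
Qed.

Lemma cabs_le (z : R * R) : cabs z <= `|z.1| + `|z.2|.
Proof.
rewrite /cabs -[leRHS]ger0_norm ?addr_ge0// -sqrtr_sqr ler_wsqrtr//.
rewrite -[z.1 ^+ 2]real_normK ?num_real// -[z.2 ^+ 2]real_normK ?num_real//.
have : 0 <= `|z.1| * `|z.2| by rewrite mulr_ge0.
by rewrite sqrrD; lra.
Qed.

Lemma meas_cabs d (X : measurableType d) (f g : X -> R) : measurable_fun setT f ->
  measurable_fun setT g -> measurable_fun setT (fun x => cabs (f x, g x)).
Proof.
move=> mf mg.
have ms : measurable_fun setT (fun t : R => Num.sqrt t).
  by apply: continuous_measurable_fun; exact: sqrt_continuous.
apply: (measurableT_comp (g := fun x => f x ^+ 2 + g x ^+ 2) ms).
by apply: measurable_funD; exact: measurable_funX.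
Qed.

Lemma c3_le1 p : `|(@c3 R p).1| <= 1 /\ `|(@c3 R p).2| <= 1.
Proof.
by case: p => -[[] []] []; rewrite /c3 /mulIu /= ?normrN ?normr0 ?normr1 ?lexx ?ler01.
Qed.

End CabsBounds.

(** [Tstar_rep] fixes [v] only up to a null set, so the estimate is proved for the constructed
    [vrep] and carried over by [Tstar_unique]. *)
Theorem theorem1p3 (R : realType) (n : nat) (n_gt0 : (0 < n)%N)
    (a : 'rV[R]_n -> 'rV[R]_n -> R * R) (w : 'rV[R]_n -> R) :
  Linf_symbol (- n%:R) 0 a -> A1 w ->
  exists C : R, forall u : 'rV[R]_n -> R * R, schwartz u ->
    (exists v, Tstar_rep a u v) /\
    (forall v, Tstar_rep a u v -> (wL1w w v <= C%:E * L1w w u)%E).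
Proof.
move=> [am asm ab] wA.
have [w' [C [mw' w'0 C1 ww' [wloc wA1]]]] := A1_borel wA.
have w0 : forall x, 0 <= w x by case: wA.
pose mu := leb R n.
have /choice[b Hb] : forall l : bool, exists b : Esp R n * Esp R n -> R, exists A : R,
    [/\ measurable_fun setT b, 0 <= A,
    (forall y xi, `|b (y, xi)| <= A * jbV xi),
    (forall (y : Esp R n) i, exists be, [/\ chain i be, be 0%N = (fun xi => b (y, xi)),
       (forall m, measurable_fun setT (be m : Esp R n -> R)) &
       forall xi, `|be n.+1 xi| <= A * jbV xi]) &
    {ae mu, forall y, forall xi, cpart (a y) l xi = b (y, xi)}].
  move=> l; apply: (@symbol_regular R n (fun y xi => cpart (a y) l xi)).
  - by move=> xi; have [H1 H2] := am xi; case: l.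
  - by move=> y; have [H1 H2] := asm y; case: l.
  - move=> al; have [B HB] := ab al; exists B => xi; apply/aeP.
    have /aeP H := HB xi; apply: (aeS H) => y /(le_trans _); apply.
    have := cabs_ge (dpartial al (fun eta => (a y eta).1) xi, dpartial al (fun eta => (a y eta).2) xi) l.
    by case: l.
have /choice[A HA] := Hb.
pose A' := A false + A true.
have AA l : A l <= A'.
  have [_ h1 _ _ _] := HA false; have [_ h2 _ _ _] := HA true.
  by rewrite /A'; case: l; [rewrite lerDr|rewrite lerDl].
have A0 : 0 <= A' by apply: le_trans (AA true); have [] := HA true.
have jV0 (xi : 'rV[R]_n) : 0 <= jbV xi by exact: jbV_ge0.
have mb l : measurable_fun setT (b l) by have [] := HA l.
have bA l y xi : `|b l (y, xi)| <= A' * jbV xi.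
  by have [_ _ H _ _] := HA l; apply: (le_trans (H y xi)); apply: ler_wpM2r.
have ch l (y : Esp R n) i : exists be, [/\ chain i be, be 0%N = (fun xi => b l (y, xi)),
     (forall m, measurable_fun setT (be m : Esp R n -> R)) &
     forall xi, `|be n.+1 xi| <= A' * jbV xi].
  have [_ _ _ H _] := HA l; have [be [h1 h2 h3 h4]] := H y i; exists be; split => // xi.
  by apply: (le_trans (h4 xi)); apply: ler_wpM2r.
have abE : {ae mu, forall y, forall xi, a y xi = (b false (y, xi), b true (y, xi))}.
  have [_ _ _ _ h1] := HA false; have [_ _ _ _ h2] := HA true.
  apply: (aeS (aeI h1 h2)) => y [e1 e2] xi; rewrite -e1 -e2 /cpart.
  by case: (a y xi).
pose K : R := (2 * pi) ^- n.
have K0 : 0 <= K by rewrite invr_ge0 exprn_ge0// mulr_ge0// pi_ge0.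
pose M := A' * Kap n C.
have M0 : 0 <= M by rewrite mulr_ge0// Kap_ge0.
(* The 16 is 8 components times the 2 from |z| <= |Re z| + |Im z|. The summand 1 makes the constant
   positive, which settles the case of an infinite right side. *)
exists (K * (16 * M) + 1) => u uS.
have C0 : 0 < K * (16 * M) + 1 by rewrite ltr_wpDl// mulr_ge0// mulr_ge0.
have [V VP] := representatives n_gt0 mb A0 bA uS.
have TV := vrep_Tstar abE VP.
split; first by exists (vrep V).
move=> v vT; have vE := Tstar_unique vT TV.
have mcu : measurable_fun setT (fun x : Esp R n => cabs (u x)).
  have [m1 _] := cpart_bound false uS; have [m2 _] := cpart_bound true uS.
  rewrite (_ : (fun x => cabs (u x)) = fun x => cabs (cpart u false x, cpart u true x)).
    exact: meas_cabs.
  by apply/funext => x; rewrite /cpart; case: (u x).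
have mcuw : measurable_fun setT (fun x : Esp R n => cabs (u x) * w' x) by exact: measurable_funM.
have LE : L1w w u = (\int[mu]_x (cabs (u x) * w' x)%:E)%E.
  apply: lint_ae => //.
  - by move=> x; rewrite mulr_ge0// sqrtr_ge0.
  - by move=> x; rewrite mulr_ge0// sqrtr_ge0.
  - by apply: (aeS ww') => x ->.
have [Loo|Lfin] := eqVneq (L1w w u) +oo%E.
  by rewrite Loo gt0_muley ?lte_fin// leey.
have cu0 x : 0 <= cabs (u x) * w' x by rewrite mulr_ge0// sqrtr_ge0.
have IL : L1 mu (fun x => cabs (u x) * w' x).
  apply: L1_lty => //; under eq_integral do rewrite (ger0_norm (cu0 _)).
  by rewrite -LE ltey.
pose L := \int[mu]_x (cabs (u x) * w' x).
have VB p : L1 mu (fun x => `|V p x| * w' x) /\ \int[mu]_x (`|V p x| * w' x) <= M * L.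
  case: p => -[l j] t; have [mV RV] := VP l j t.
  have qw x : `|cpart u j x * w' x| <= cabs (u x) * w' x.
    by rewrite normrM (ger0_norm (w'0 x)); apply: ler_wpM2r => //; exact: cabs_ge.
  have Iq : L1 mu (fun y => cpart u j y * w' y).
    apply: (L1_dom _ IL qw); apply: measurable_funM => //.
    exact: (cpart_bound j uS).1.
  have [I1 B1] := weighted_bound n_gt0 w'0 C1 mw' wloc wA1 mV A0 (bA l) (ch l) RV Iq.
  split; first exact: I1.
  apply: (le_trans B1); apply: ler_wpM2l => //.
  apply: Rint_le; [|exact: IL|].
    by apply: (L1_eq (L1_norm Iq)) => x; rewrite normrM (ger0_norm (w'0 x)).
  by move=> x; apply: le_trans (qw x); rewrite normrM (ger0_norm (w'0 x)).
have mV p : measurable_fun setT (V p) by case: p => -[l j] t; exact: (VP l j t).1.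
have vB x : cabs (vrep V x) * w' x <= \sum_p (K * 2) * (`|V p x| * w' x).
  rewrite -mulr_sumr -mulr_suml mulrA; apply: ler_wpM2r => //.
  apply: (le_trans (cabs_le _)); rewrite /vrep /Defs.cscale /= -/K !normrM (ger0_norm K0) -mulrDr -mulrA.
  apply: ler_wpM2l => //; rewrite mulr_natl mulr2n.
  by apply: lerD; apply: (le_trans (ler_norm_sum _ _ _)); apply: ler_sum => p _;
    rewrite normrM ler_piMl//; have [] := c3_le1 R p.
have [IS ES] := Rint_lin (fun=> K * 2) (fun p => (VB p).1).
have SB : \int[mu]_x (\sum_p (K * 2) * (`|V p x| * w' x)) <= (K * (16 * M)) * L.
  rewrite ES; apply: (@le_trans _ _ (\sum_(p : bool * bool * bool) (K * 2) * (M * L))).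
    by apply: ler_sum => p _; apply: ler_wpM2l; [rewrite mulr_ge0|exact: (VB p).2].
  by rewrite sum3E le_eqVlt; apply/orP; left; apply/eqP; ring.
apply: ge_ereal_sup => _ [lam [lam0 ->]].
pose g (x : Esp R n) : R := if lam < cabs (vrep V x) then w' x else 0.
have mcv : measurable_fun setT (fun x : Esp R n => cabs (vrep V x)).
  by apply: meas_cabs; apply: measurable_funM => //; apply: meas_sum => p; apply: measurable_funM.
have mg : measurable_fun setT g.
  by apply: measurable_fun_ifT => //; exact: measurable_fun_ltr.
have g0 x : 0 <= g x by rewrite /g; case: ifP.
(* Chebyshev's inequality, pointwise. *)
have gle x : lam * g x <= \sum_p (K * 2) * (`|V p x| * w' x).
  apply: le_trans (vB x); rewrite /g; case: ifP => [h|_].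
    by apply: ler_wpM2r => //; exact: ltW.
  by rewrite mulr0 mulr_ge0// sqrtr_ge0.
have Ig : L1 mu (fun x => lam * g x).
  apply: (L1_dom _ IS); first by apply: measurable_funM.
  by move=> x; rewrite ger0_norm ?gle// mulr_ge0// ltW.
rewrite (@lint_ae _ _ _ g mg)//; last first.
- apply: (aeS (aeI vE ww')) => x [vx ->]; rewrite /g indicE -vx.
  case: ifP => h; first by rewrite mem_set ?mul1r.
  by rewrite memNset ?mul0r//= h.
- by move=> x; rewrite mulr_ge0.
rewrite LE -(EFin_int IL) -/L.
have -> : (lam%:E * \int[leb R n]_x (g x)%:E = (\int[mu]_x (lam * g x))%:E)%E.
  rewrite (EFin_int Ig) -ge0_integralZl//; first by apply/measurable_EFinP.
  - by move=> x _; rewrite lee_fin.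
  - by rewrite lee_fin ltW.
rewrite -EFinM lee_fin; apply: (le_trans (Rint_le Ig IS gle)); apply: (le_trans SB).
by apply: ler_wpM2r; [exact: Rint_ge0|rewrite lerDl].
Qed.
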